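(* Let $d_1,d_0,k\in\mathbb{N}$ (with $0\in\mathbb N$). Let $X$ be a $\mathbb{Z}/2$-CW-complex with involution $\tau$. Assume that the free cells of $X$ have dimension at most $d_1$ and that the trivial (fixed) cells of $X$ have dimension at most $d_0$. Let $$k_0 := \max\left\{ \left\lceil\frac{d_0-3}{2}\right\rceil, \left\lceil \frac{d_1-1}{2}\right\rceil\right\},\qquad k_1 := \max\left\{ \left\lceil\frac{d_0-2}{2}\right\rceil, \left\lceil \frac{d_1}{2}\right\rceil\right\}.$$ (1) Let $E$ be a ``quaternionic'' vector bundle over $X$ of rank $k\ge k_0$. Then there is an isomorphism of ``quaternionic'' vector bundles $E\cong E_0\oplus \theta_X^{2\lfloor (k-k_0)/2\rfloor}$ for some ``quaternionic'' vector bundle $E_0$ over $X$ and the trivial ``quaternionic'' vector bundle $\theta_X^{2\lfloor (k-k_0)/2\rfloor}$ of rank $2\lfloor (k-k_0)/2\rfloor$. (2) Let $E_1$ and $E_2$ be two ``quaternionic'' vector bundles over $X$ of rank $k\ge k_1$. If $E_1$ and $E_2$ are stably isomorphic, that is, $E_1\oplus E_3\cong E_2\oplus E_3$ for some ``quaternionic'' vector bundle $E_3$ over $X$, then $E_1\cong E_2$ as ``quaternionic'' vector bundles.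
   Context: An involutive space $(X,\tau)$ is a topological space $X$ with a continuous map $\tau\colon X\to X$ satisfying $\tau^2=\mathrm{id}_X$. A $\mathbb{Z}/2$-CW-complex is an involutive space obtained from the empty set by attaching $\mathbb{Z}/2$-cells of increasing dimensions (by equivariant attaching maps). There are two types of $\mathbb{Z}/2$-cells: free cells $\mathbb{D}^j\times\mathbb{Z}/2$ of dimension $j$, on which the generator of $\mathbb{Z}/2$ acts by $(x,i)\mapsto(x,i+1)$, and fixed (also called trivial) cells $\mathbb{D}^j$ of dimension $j$ with the trivial $\mathbb{Z}/2$-action. A ``quaternionic'' vector bundle over an involutive space $(X,\tau)$ is a complex vector bundle $\pi\colon E\to X$ with a homeomorphism $\Theta\colon E\to E$ such that (i) $\pi\circ\Theta=\tau\circ\pi$; (ii) $\Theta$ is fibrewise additive and $\Theta(\lambda p)=\overline{\lambda}\,\Theta(p)$ for all $\lambda\in\mathbb{C}$, $p\in E$; (iii) $\Theta^2$ is fibrewise multiplication by $-1$. It has rank $k$ if all its fibres are isomorphic to $\mathbb{C}^k$ (complex rank). Isomorphisms of ``quaternionic'' vector bundles are isomorphisms of complex vector bundles over $\mathrm{id}_X$ that intertwine the maps $\Theta$; direct sums carry the direct sum of the maps $\Theta$. The trivial ``quaternionic'' vector bundle $\theta_X^{2m}$ of rank $2m$ over $X$ is $X\times\mathbb{C}^{2m}$ with $\Theta(x,\lambda_1,\lambda_2,\dotsc,\lambda_{2m-1},\lambda_{2m})=(\tau(x),\overline{\lambda_2},-\overline{\lambda_1},\dotsc,\overline{\lambda_{2m}},-\overline{\lambda_{2m-1}})$.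 *)

(* Defs.v *)
From HB Require Import structures.
From mathcomp Require Import all_boot all_order all_algebra.
From mathcomp Require Import complex.
From mathcomp Require Import all_classical all_reals all_analysis.
From mathcomp Require Import zify.

Set Implicit Arguments.
Unset Strict Implicit.
Unset Printing Implicit Defensive.

Import Order.TTheory GRing.Theory Num.Theory.
Import numFieldNormedType.Exports.

Local Open Scope classical_set_scope.
Local Open Scope ring_scope.

(* R[i] carries the topology of its norm. *)
HB.instance Definition _ (R : realType) := NormedModule.copy R[i] R[i]^o.

Definition homeomorphism (S T : topologicalType) (f : S -> T) : Prop :=
  continuous f /\
  exists2 g : T -> S, continuous g & cancel f g /\ cancel g f.

Record involutive_space := InvolutiveSpace {
  space :> topologicalType;
  tau : space -> space;
  tau_continuous : continuous tau;
  tau_involutive : involutive tau }.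

Section discs.
Variables (R : realType) (n : nat).
Definition sqnorm (v : 'rV[R]_n) : R := \sum_i v ord0 i ^+ 2.
Definition closed_disc : set 'rV[R]_n := [set v | sqnorm v <= 1].
Definition open_disc : set 'rV[R]_n := [set v | sqnorm v < 1].
Definition sphere : set 'rV[R]_n := [set v | sqnorm v = 1].
End discs.

(* A free cell D^n x Z/2 consists of two copies of D^n indexed by bool, so an
   element of A * bool + B names one copy of D^n; this is the involution on
   these copies. *)
Definition flip_cell (A B : Type) (e : A * bool + B) : A * bool + B :=
  match e with inl (c, b) => inl (c, ~~ b) | inr c => inr c end.

(* Z/2-CW-structures. Here cw_skel n is the union of the cells of dimension < n.
   The fields from cw_skelS to cw_open_skelS say that cw_skel n.+1 (with the
   subspace topology) is the adjunction space of cw_skel n and all n-cells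
   along the restrictions of the characteristic maps to the spheres: as a set
   it is the disjoint union of cw_skel n and the open n-cells, and it has the
   quotient topology. The last two fields say that X is the colimit of its
   skeleta. *)
Record Z2_CW (R : realType) (X : involutive_space) := Z2CW {
  free_cell : nat -> Type;
  fixed_cell : nat -> Type;
  cw_skel : nat -> set X;
  cw_map : forall n, free_cell n * bool + fixed_cell n -> 'rV[R]_n -> X;
  cw_map_continuous : forall n (e : free_cell n * bool + fixed_cell n),
    {within @closed_disc R n, continuous (cw_map e)};
  cw_map_equivariant : forall n (e : free_cell n * bool + fixed_cell n) v,
    closed_disc v -> cw_map (flip_cell e) v = tau (cw_map e v);
  cw_skel0 : cw_skel 0 = set0;
  cw_skelS : forall n, cw_skel n.+1 = cw_skel n `|`
    \bigcup_(e in [set: free_cell n * bool + fixed_cell n])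
      cw_map e @` @closed_disc R n;
  cw_map_sphere : forall n (e : free_cell n * bool + fixed_cell n) v,
    sphere v -> cw_skel n (cw_map e v);
  cw_map_open_disc : forall n (e : free_cell n * bool + fixed_cell n) v,
    open_disc v -> ~ cw_skel n (cw_map e v);
  cw_map_inj : forall n (e e' : free_cell n * bool + fixed_cell n) v v',
    open_disc v -> open_disc v' -> cw_map e v = cw_map e' v' ->
    e = e' /\ v = v';
  cw_open_skelS : forall n (A : set X),
    open (A : set (subspace (cw_skel n.+1))) <->
    open (A : set (subspace (cw_skel n))) /\
    forall e : free_cell n * bool + fixed_cell n,
      open (cw_map e @^-1` A : set (subspace (@closed_disc R n)));
  cw_skel_cover : \bigcup_n cw_skel n = setT;
  cw_open : forall A : set X,
    open A <-> forall n, open (A : set (subspace (cw_skel n))) }.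

(* Total space of a family of fibres. This is not the type sigT because the
   library gives the latter the disjoint union topology. *)
Record total (X : Type) (F : X -> Type) := Tot { base : X; vec : F base }.
Arguments Tot {X F} base vec.

HB.instance Definition _ (X : Type) (F : X -> Type) := gen_eqMixin (total F).
HB.instance Definition _ (X : Type) (F : X -> Type) :=
  gen_choiceMixin (total F).

(* Family of complex vector spaces over X, with a topology on its total
   space. *)
Record vfamily (R : realType) (X : Type) := VFamily {
  fibre :> X -> lmodType R[i];
  total_topology : Topological (total fibre) }.

Definition tot (R : realType) (X : Type) (F : vfamily R X) : topologicalType :=
  Topological.Pack (total_topology F).

Definition tot_map (R : realType) (X Y : Type) (F : vfamily R X)
    (G : vfamily R Y) (f : X -> Y) (h : forall x, F x -> G (f x))
    (e : tot F) : tot G :=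
  Tot (f (base e)) (h (base e) (vec e)).

Definition proj (R : realType) (X : Type) (F : vfamily R X) (e : tot F) : X :=
  base e.

(* phi is a homeomorphism from U x C^n onto the part of the total space that
   lies over U, with inverse e |-> (proj e, psi e), and it is linear on fibres.
   The values of phi and psi outside U are irrelevant. *)
Definition locally_trivial (R : realType) (X : topologicalType)
    (F : vfamily R X) : Prop :=
  forall x : X, exists (U : set X) (n : nat)
      (phi : forall y, 'rV[R[i]]_n -> F y) (psi : tot F -> 'rV[R[i]]_n),
    [/\ open U /\ U x,
        forall y, U y -> linear (phi y),
        forall y, U y -> cancel (phi y) (fun w => psi (Tot y w)) /\
                         cancel (fun w => psi (Tot y w)) (phi y),
        {within U `*` setT,
          continuous (fun p : X * 'rV[R[i]]_n => Tot p.1 (phi p.1 p.2) : tot F)}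
      & {within @proj _ _ F @^-1` U, continuous psi}].

Record vbundle (R : realType) (X : topologicalType) := VBundle {
  vb_family :> vfamily R X;
  vb_proj_continuous : continuous (@proj R X vb_family);
  vb_locally_trivial : locally_trivial vb_family }.

(* "Quaternionic" vector bundles; qtheta is the family of the maps
   E_x -> E_(tau x) induced by Theta. *)
Record qbundle (R : realType) (X : involutive_space) := QBundle {
  qvb :> vbundle R X;
  qtheta : forall x : X, qvb x -> qvb (tau x);
  qtheta_homeo : homeomorphism (tot_map qtheta);
  qthetaD : forall (x : X) (v w : qvb x), qtheta (v + w) = qtheta v + qtheta w;
  qthetaZ : forall (x : X) (a : R[i]) (v : qvb x),
    qtheta (a *: v) = Num.conj a *: qtheta v;
  qthetaK : forall (x : X) (v : qvb x),
    tot_map qtheta (tot_map qtheta (Tot x v : tot qvb)) = Tot x (- v) }.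

Definition has_rank (R : realType) (X : topologicalType) (E : vbundle R X)
    (k : nat) : Prop :=
  forall x, exists f : {linear 'rV[R[i]]_k -> E x}, bijective f.

Definition qiso (R : realType) (X : involutive_space) (E1 E2 : qbundle R X) :
    Prop :=
  exists f : forall x : X, {linear E1 x -> E2 x},
    homeomorphism (tot_map (f := id) f) /\
    forall (x : X) (v : E1 x), f (tau x) (qtheta v) = qtheta (f x v).

Section auxiliary.
Variable R : realType.

Lemma numClosed_conj_continuous (C : numClosedFieldType) :
  continuous (fun z : C => Num.conj z).
Proof.
move=> z A [e /= e0 sA]; exists e => //= t zt; apply: sA => /=.
by rewrite -rmorphB norm_conjC.
Qed.

Lemma conj_continuous : continuous (fun z : R[i] => Num.conj z).
Proof. exact: numClosed_conj_continuous. Qed.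

Lemma mx_continuous (T : topologicalType) (n : nat) (f : T -> 'rV[R[i]]_n) :
  (forall i, continuous (fun t => f t ord0 i)) -> continuous f.
Proof.
move=> fc t A [P Pn PA].
have : \forall s \near t, forall i, P ord0 i (f s ord0 i).
  by apply: filter_forall => i; apply: fc; exact: Pn.
by apply: filterS => s Ps; apply: PA => i j; rewrite (ord1 i).
Qed.

Lemma row_coord_continuous n i : continuous (fun v : 'rV[R[i]]_n => v ord0 i).
Proof. exact: coord_continuous. Qed.

Lemma lsubmx_continuous m n :
  continuous (fun v : 'rV[R[i]]_(m + n) => lsubmx v).
Proof.
apply: mx_continuous => i; under eq_fun do rewrite mxE.
exact: row_coord_continuous.
Qed.

Lemma rsubmx_continuous m n :
  continuous (fun v : 'rV[R[i]]_(m + n) => rsubmx v).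
Proof.
apply: mx_continuous => i; under eq_fun do rewrite mxE.
exact: row_coord_continuous.
Qed.

Lemma row_mx_continuous m n :
  continuous (fun p : 'rV[R[i]]_m * 'rV[R[i]]_n => row_mx p.1 p.2).
Proof.
apply: mx_continuous => i; under eq_fun do rewrite mxE.
case: (fintype.split i) => j p.
  apply: (@continuous_comp _ _ _ fst (fun v : 'rV[R[i]]_m => v ord0 j)).
    exact: cvg_fst.
  exact: row_coord_continuous.
apply: (@continuous_comp _ _ _ snd (fun v : 'rV[R[i]]_n => v ord0 j)).
  exact: cvg_snd.
exact: row_coord_continuous.
Qed.

Lemma pair_continuous_at (T U V : topologicalType) (f : T -> U) (g : T -> V)
    (t : T) :
  {for t, continuous f} -> {for t, continuous g} ->
  {for t, continuous (fun t => (f t, g t))}.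
Proof. exact: cvg_pair. Qed.

Lemma open_cylinder (S T : topologicalType) (U : set S) :
  open U -> open (U `*` [set: T]).
Proof.
move=> oU; have -> : U `*` [set: T] = fst @^-1` U.
  by apply/seteqP; split=> [p []|p].
by apply: open_comp => // p _; exact: cvg_fst.
Qed.

Lemma Tot_inj (X : Type) (F : X -> Type) (x : X) (v w : F x) :
  Tot x v = Tot x w -> v = w.
Proof.
move=> vw; have [p] : exists p : base (Tot x v) = base (Tot x w),
    eq_rect _ F (vec (Tot x v)) _ p = vec (Tot x w) by rewrite vw; exists erefl.
by rewrite (Prop_irrelevance p erefl).
Qed.

Lemma Tot_pair (X : Type) (F G : X -> Type) (x y : X) (a : F y) (b : G y)
    (v : F x) (w : G x) :
  y = x -> Tot y a = Tot x v -> Tot y b = Tot x w ->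
  Tot y (a, b) = Tot x (v, w) :> total (fun x => (F x * G x)%type).
Proof.
move=> yx; subst y => av bw.
by rewrite (Tot_inj (F := F) av) (Tot_inj (F := G) bw).
Qed.

Lemma tot_map_homeomorphism (X : Type) (F : vfamily R X) (f : X -> X)
    (h : forall x, F x -> F (f x)) :
  continuous (tot_map h) ->
  (forall x v, tot_map h (tot_map h (Tot x v : tot F)) = Tot x (- v)) ->
  homeomorphism (tot_map h).
Proof.
move=> hc h2; split=> //; exists (tot_map h \o (tot_map h \o tot_map h)).
  by move=> t; do 2 (apply: continuous_comp; last exact: hc); exact: hc.
have h4 e : tot_map h (tot_map h (tot_map h (tot_map h e))) = e.
  by case: e => x v; rewrite (h2 x v) (h2 x (- v)) opprK.
by split=> e; exact: h4.
Qed.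

End auxiliary.

Section direct_sum.
Variable R : realType.

Section family.
Variables (X : Type) (F G : vfamily R X).

Definition sum_split (e : total (fun x => (F x * G x)%type)) : tot F * tot G :=
  (Tot (base e) (vec e).1, Tot (base e) (vec e).2).

(* The total space of the direct sum is the fibre product of the total spaces,
   with the topology induced by the product. *)
Definition vfamily_sum : vfamily R X :=
  @VFamily R X (fun x => (F x * G x)%type)
    (Topological.class (initial_topology sum_split)).
End family.

Section vbundle.
Variables (X : topologicalType) (E F : vbundle R X).

Lemma sum_split_continuous :
  continuous (@sum_split X E F : tot (vfamily_sum E F) -> _).
Proof. exact: (@initial_continuous _ _ (@sum_split X E F)). Qed.

Lemma tot_sum_continuous (T : topologicalType)
    (f : T -> tot (vfamily_sum E F)) :
  continuous (@sum_split X E F \o f) -> continuous f.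
Proof. exact: (@continuous_comp_initial _ _ _ (@sum_split X E F)). Qed.

Lemma vbundle_sum_proj : continuous (@proj R X (vfamily_sum E F)).
Proof.
move=> e; apply: (@continuous_comp (tot (vfamily_sum E F)) _ _
  (@sum_split X E F) (fun p : tot E * tot F => proj p.1)); first exact: sum_split_continuous.
by apply: continuous_comp; [exact: cvg_fst|exact: vb_proj_continuous].
Qed.

Lemma vbundle_sum_locally_trivial : locally_trivial (vfamily_sum E F).
Proof.
move=> x.
have [U [m [f [g [[oU Ux] flin fK fc gc]]]]] := @vb_locally_trivial _ _ E x.
have [V [n [f' [g' [[oV Vx] flin' fK' fc' gc']]]]] :=
  @vb_locally_trivial _ _ F x.
exists (U `&` V), (m + n)%N,
  (fun y v => (f y (lsubmx v), f' y (rsubmx v))),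
  (fun e => row_mx (g (@sum_split X E F e).1) (g' (@sum_split X E F e).2)).
split.
- by split; [exact: openI|].
- move=> y [Uy Vy] a v w.
  by rewrite !linearP /= (flin _ Uy) (flin' _ Vy).
- move=> y [Uy Vy]; have [K1 K2] := fK _ Uy; have [K1' K2'] := fK' _ Vy.
  split=> [v|[w w']] /=; first by rewrite K1 K1' hsubmxK.
  by rewrite row_mxKl row_mxKr K2 K2'.
- apply: tot_sum_continuous.
  rewrite continuous_open_subspace; last exact/open_cylinder/openI.
  move=> -[y v] /set_mem[[/= Uy Vy] _].
  rewrite (continuous_open_subspace _ (open_cylinder oU)) in fc.
  rewrite (continuous_open_subspace _ (open_cylinder oV)) in fc'.
  apply: pair_continuous_at.
    apply: (@continuous_comp _ _ _
      (fun p : X * 'rV[R[i]]_(m + n) => (p.1, lsubmx p.2))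
      (fun p => Tot p.1 (f p.1 p.2) : tot E)); last first.
      by apply: fc; apply/mem_set.
    apply: pair_continuous_at; first exact: cvg_fst.
    by apply: continuous_comp; [exact: cvg_snd|exact: lsubmx_continuous].
  apply: (@continuous_comp _ _ _
    (fun p : X * 'rV[R[i]]_(m + n) => (p.1, rsubmx p.2))
    (fun p => Tot p.1 (f' p.1 p.2) : tot F)); last first.
    by apply: fc'; apply/mem_set.
  apply: pair_continuous_at; first exact: cvg_fst.
  by apply: continuous_comp; [exact: cvg_snd|exact: rsubmx_continuous].
- have oP : open (@proj _ _ (vfamily_sum E F) @^-1` (U `&` V)).
    apply: open_comp; last exact: openI.
    by move=> ? _; exact: vbundle_sum_proj.
  have oPU : open (@proj _ _ E @^-1` U).
    by apply: open_comp => // ? _; exact: vb_proj_continuous.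
  have oPV : open (@proj _ _ F @^-1` V).
    by apply: open_comp => // ? _; exact: vb_proj_continuous.
  rewrite continuous_open_subspace// in gc.
  rewrite continuous_open_subspace// in gc'.
  rewrite continuous_open_subspace// => e /set_mem[Ue Ve].
  apply: (@continuous_comp _ _ _
    (fun e : tot (vfamily_sum E F) =>
       (g (@sum_split X E F e).1, g' (@sum_split X E F e).2))
    (fun p => row_mx p.1 p.2)); last exact: row_mx_continuous.
  apply: pair_continuous_at.
    apply: (@continuous_comp _ _ _
      (fun e : tot (vfamily_sum E F) => (@sum_split X E F e).1) g).
      by apply: continuous_comp; [exact: sum_split_continuous|exact: cvg_fst].
    by apply: gc; apply/mem_set.
  apply: (@continuous_comp _ _ _
    (fun e : tot (vfamily_sum E F) => (@sum_split X E F e).2) g').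
    by apply: continuous_comp; [exact: sum_split_continuous|exact: cvg_snd].
  by apply: gc'; apply/mem_set.
Qed.

Definition vbundle_sum : vbundle R X :=
  VBundle vbundle_sum_proj vbundle_sum_locally_trivial.
End vbundle.

Section qbundle.
Variables (X : involutive_space) (E F : qbundle R X).

Definition qsum_theta (x : X) (v : vbundle_sum E F x) :
    vbundle_sum E F (tau x) :=
  (qtheta v.1, qtheta v.2).

Lemma qsum_thetaK (x : X) (v : vbundle_sum E F x) :
  tot_map qsum_theta (tot_map qsum_theta (Tot x v : tot (vbundle_sum E F))) =
  Tot x (- v).
Proof.
case: v => v w; apply: Tot_pair; first exact: tau_involutive.
  exact: qthetaK.
exact: qthetaK.
Qed.

Lemma qsum_theta_homeo : homeomorphism (tot_map qsum_theta).
Proof.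
apply: tot_map_homeomorphism; last exact: qsum_thetaK.
apply: tot_sum_continuous => e.
have sE := @sum_split_continuous X E F e.
have H1 : {for e, continuous (tot_map (@qtheta R X E) \o
    (fun e : tot (vbundle_sum E F) => (@sum_split X E F e).1))}.
  apply: continuous_comp; last by have [+ _] := qtheta_homeo E; apply.
  by apply: continuous_comp; [exact: sE|exact: cvg_fst].
have H2 : {for e, continuous (tot_map (@qtheta R X F) \o
    (fun e : tot (vbundle_sum E F) => (@sum_split X E F e).2))}.
  apply: continuous_comp; last by have [+ _] := qtheta_homeo F; apply.
  by apply: continuous_comp; [exact: sE|exact: cvg_snd].
exact: (pair_continuous_at H1 H2).
Qed.

Lemma qsum_thetaD (x : X) (v w : vbundle_sum E F x) :
  qsum_theta (v + w) = qsum_theta v + qsum_theta w.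
Proof. by rewrite /qsum_theta !qthetaD. Qed.

Lemma qsum_thetaZ (x : X) (a : R[i]) (v : vbundle_sum E F x) :
  qsum_theta (a *: v) = Num.conj a *: qsum_theta v.
Proof. by rewrite /qsum_theta !qthetaZ. Qed.

Definition qsum : qbundle R X :=
  QBundle qsum_theta_homeo qsum_thetaD qsum_thetaZ qsum_thetaK.
End qbundle.
End direct_sum.

Section trivial.
Variables (R : realType) (X : involutive_space) (m : nat).

Definition qtrivial_split (e : total (fun _ : X => 'rV[R[i]]_(2 * m))) :
    X * 'rV[R[i]]_(2 * m) :=
  (base e, vec e).

Definition qtrivial_family : vfamily R X :=
  @VFamily R X (fun _ => 'rV[R[i]]_(2 * m))
    (Topological.class (initial_topology qtrivial_split)).

Lemma qtrivial_split_continuous :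
  continuous (qtrivial_split : tot qtrivial_family -> _).
Proof. exact: (@initial_continuous _ _ qtrivial_split). Qed.

Lemma tot_qtrivial_continuous (T : topologicalType)
    (f : T -> tot qtrivial_family) :
  continuous (qtrivial_split \o f) -> continuous f.
Proof. exact: (@continuous_comp_initial _ _ _ qtrivial_split). Qed.

Lemma qtrivial_base_continuous : continuous (@proj R X qtrivial_family).
Proof.
move=> e; apply: (@continuous_comp (tot qtrivial_family) _ _ qtrivial_split fst).
  exact: qtrivial_split_continuous.
exact: cvg_fst.
Qed.

Lemma qtrivial_vec_continuous :
  continuous (fun e : tot qtrivial_family => vec e : 'rV[R[i]]_(2 * m)).
Proof.
move=> e; apply: (@continuous_comp (tot qtrivial_family) _ _ qtrivial_split snd).
  exact: qtrivial_split_continuous.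
exact: cvg_snd.
Qed.

Lemma qtrivial_locally_trivial : locally_trivial qtrivial_family.
Proof.
move=> x; exists setT, (2 * m)%N, (fun _ v => v), (fun e => vec e).
split=> //; first by split=> //; exact: openT.
  apply: continuous_subspaceT; apply: tot_qtrivial_continuous.
  rewrite (_ : _ \o _ = id); last by apply/funext => -[].
  by move=> p; exact: cvg_id.
by apply: continuous_subspaceT; exact: qtrivial_vec_continuous.
Qed.

Definition qtrivial_vbundle : vbundle R X :=
  VBundle qtrivial_base_continuous qtrivial_locally_trivial.

(* Coordinates are numbered from 0: this exchanges 2j and 2j + 1. *)
Lemma swap_subproof (i : 'I_(2 * m)) : ((if odd i then i.-1 else i.+1) < 2 * m)%N.
Proof. by have := ltn_ord i; case: ifP; lia. Qed.

Definition swap (i : 'I_(2 * m)) : 'I_(2 * m) := Ordinal (swap_subproof i).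

Lemma swapK : involutive swap.
Proof.
move=> [[|n] ltn]; apply: val_inj => //=.
by case: (boolP (odd n)) => on /=; rewrite ?on //= (negPf on).
Qed.

Lemma odd_swap (i : 'I_(2 * m)) : odd (swap i) = ~~ odd i.
Proof. case: i => [[|n] ltn] //=; case on: (odd n) => //=; by rewrite on. Qed.

Definition qtrivial_theta (x : X) (v : qtrivial_vbundle x) :
    qtrivial_vbundle (tau x) :=
  \row_i if odd i then - Num.conj ((v : 'rV_(2 * m)) ord0 (swap i))
         else Num.conj ((v : 'rV_(2 * m)) ord0 (swap i)).

Lemma qtrivial_thetaK (x : X) (v : qtrivial_vbundle x) :
  tot_map qtrivial_theta (tot_map qtrivial_theta
    (Tot x v : tot qtrivial_vbundle)) = Tot x (- v).
Proof.
rewrite /tot_map /= tau_involutive; congr Tot.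
apply/rowP => i; rewrite !mxE odd_swap swapK.
by case: (odd i); rewrite /= ?rmorphN /= conjCK.
Qed.

Lemma qtrivial_theta_homeo : homeomorphism (tot_map qtrivial_theta).
Proof.
apply: tot_map_homeomorphism; last exact: qtrivial_thetaK.
apply: tot_qtrivial_continuous => e.
have H1 : {for e, continuous (@tau X \o @proj R X qtrivial_family)}.
  by apply: continuous_comp;
    [exact: qtrivial_base_continuous|exact: tau_continuous].
have H2 : {for e, continuous (@qtrivial_theta (base e) \o
    (fun e : tot qtrivial_family => vec e : 'rV[R[i]]_(2 * m)))}.
  apply: continuous_comp; first exact: qtrivial_vec_continuous.
  apply: mx_continuous => i; under eq_fun do rewrite mxE.
  have c (v : 'rV[R[i]]_(2 * m)) :
      {for v, continuous
        (fun v : 'rV[R[i]]_(2 * m) => Num.conj (v ord0 (swap i)))}.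
    apply: (@continuous_comp _ _ _
      (fun v : 'rV[R[i]]_(2 * m) => v ord0 (swap i)) Num.conj); first exact: row_coord_continuous.
    exact: conj_continuous.
  case: odd => v; last exact: c.
  have oc : continuous (fun z : R[i] => - z) by exact: opp_continuous.
  exact: (continuous_comp (c v) (oc _)).
exact: (pair_continuous_at H1 H2).
Qed.

Lemma qtrivial_thetaD (x : X) (v w : qtrivial_vbundle x) :
  qtrivial_theta (v + w) = qtrivial_theta v + qtrivial_theta w.
Proof.
by apply/rowP => i; rewrite !mxE; case: odd; rewrite rmorphD ?opprD.
Qed.

Lemma qtrivial_thetaZ (x : X) (a : R[i]) (v : qtrivial_vbundle x) :
  qtrivial_theta (a *: v) = Num.conj a *: qtrivial_theta v.
Proof.
by apply/rowP => i; rewrite !mxE; case: odd; rewrite rmorphM ?mulrN.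
Qed.

Definition qtrivial : qbundle R X :=
  QBundle qtrivial_theta_homeo qtrivial_thetaD qtrivial_thetaZ qtrivial_thetaK.
End trivial.

Definition k0 (d0 d1 : nat) : int :=
  Num.max (Num.ceil ((d0%:R - 3) / 2 : rat)) (Num.ceil ((d1%:R - 1) / 2 : rat)).

Definition k1 (d0 d1 : nat) : int :=
  Num.max (Num.ceil ((d0%:R - 2) / 2 : rat)) (Num.ceil (d1%:R / 2 : rat)).

(* floor((k - k0) / 2), which is a natural number when k0 <= k. *)
Definition trivial_summand (d0 d1 k : nat) : nat :=
  `|Num.floor ((k%:Z - k0 d0 d1)%:~R / 2 : rat)|%N.

(* Main.v *)
(* After a choice of frames in all fibres, a bundle is a family of transition
   matrices and of matrices of Theta, and an equivariant homomorphism is an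
   equivariant family of matrices. Such families are built cell by cell. Over a
   free cell nothing is required of the complex matrices; over a fixed cell they
   are linear over the quaternions. The matrices with m rows and n columns whose
   rows are dependent have real codimension 2 (n - m) + 2 in the complex case and
   2 (n - m) + 4 in the quaternionic case. So a Lipschitz approximation of a map
   from a disc can be translated by a small generic vector into the matrices with
   independent rows.

   (1) Hence there is an injective equivariant homomorphism from the trivial
   bundle to E; its orthogonal complement for an equivariant metric is E_0.

   (2) Let Phi be an isomorphism from E_1 + E_3 to E_2 + E_3. One more dimension
   is available, and gives a homomorphism u from E_3 to E_2 + E_3 such that the
   segments from u to the inclusion of E_3, and from u Phi^-1 to the inclusion of
   E_3 in E_1 + E_3, consist of injective homomorphisms. The ends of such a
   segment W_t differ by an automorphism: if r_t is the orthogonal right inverse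
   of W_t, then 1 + r_t (W_t' - W_t) carries W_t to W_t' and is invertible for t'
   near t. So Phi may be assumed to be the identity on E_3, and its block from
   E_1 to E_2 is an isomorphism. The rank of E_3 need only be locally constant, so
   this is done separately over the open and closed subsets where it is constant. *)

Require Import Defs.
From HB Require Import structures.
From mathcomp Require Import all_boot all_order all_algebra.
From mathcomp Require Import complex.
From mathcomp Require Import all_classical all_reals all_analysis.
From mathcomp Require Import zify ring lra.
Import Order.TTheory GRing.Theory Num.Theory.
Import numFieldNormedType.Exports.

Set Implicit Arguments.
Unset Strict Implicit.
Unset Printing Implicit Defensive.
Local Open Scope classical_set_scope.
Local Open Scope ring_scope.

(** * Limits of matrices *)

(** The chosen frames of the fibres are not continuous. A homomorphism is thus a bare function from
    [X] to matrices, which can be defined cell by cell, and its continuity is tested after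
    multiplication by the matrices [gauge] of local trivialisations. Vectors are rows and
    homomorphisms act from the right.

    General position needs compact parameter sets. A relation among rows is therefore divided by its
    largest coefficient, and a segment is traversed in the parameter t/(1-t) up to a neighbourhood
    of its end, where openness suffices.

    In (2) two families of segments must be injective at once. General position serves one of them;
    the other comes from contraction along the given segments and survives a small perturbation.

    The product of the automorphisms along a segment must depend continuously on the point and
    commute with Theta, but X need not be compact and no single subdivision need work everywhere.
    The step length is therefore canonical: [mesh], half the infimum of |det|^2 + |t - t'| over the
    unit square, is continuous and invariant under changes of frame and conjugation. Subdivisions
    stop at 1, so any sufficient number of steps gives the same product. *)

Section matrix_limits.
Context {K : numFieldType} {T : Type} {F : set_system T} {FF : Filter F}.

Lemma mx_cvg m n (f : T -> 'M[K]_(m, n)) (l : 'M[K]_(m, n)) :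
  (forall i j, f t i j @[t --> F] --> l i j) -> f @ F --> l.
Proof.
move=> fl A [P Pl PA].
have : \forall t \near F, forall i j, P i j (f t i j).
  by apply: filter_forall => i; apply: filter_forall => j; apply: fl; exact: Pl.
by apply: filterS => t Pt; apply: PA.
Qed.

Lemma cvg_coord m n (f : T -> 'M[K]_(m, n)) (l : 'M[K]_(m, n)) i j :
  f @ F --> l -> f t i j @[t --> F] --> l i j.
Proof.
move=> fl; apply: (cvg_comp f (fun M : 'M[K]_(m, n) => M i j) fl).
exact: coord_continuous.
Qed.

Lemma cvg_sum_fin (I : Type) (r : seq I) (P : pred I) (f : I -> T -> K)
    (l : I -> K) :
  (forall i, P i -> f i @ F --> l i) ->
  \sum_(i <- r | P i) f i t @[t --> F] --> \sum_(i <- r | P i) l i.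
Proof.
move=> fl; elim: r => [|i r IH].
  under eq_fun do rewrite big_nil; rewrite big_nil; exact: cvg_cst.
under eq_fun do rewrite big_cons; rewrite big_cons.
by case: ifPn => // Pi; apply: cvgD => //; apply: fl.
Qed.

Lemma cvg_prod_fin (I : Type) (r : seq I) (P : pred I) (f : I -> T -> K)
    (l : I -> K) :
  (forall i, P i -> f i @ F --> l i) ->
  \prod_(i <- r | P i) f i t @[t --> F] --> \prod_(i <- r | P i) l i.
Proof.
move=> fl; elim: r => [|i r IH].
  under eq_fun do rewrite big_nil; rewrite big_nil; exact: cvg_cst.
under eq_fun do rewrite big_cons; rewrite big_cons.
by case: ifPn => // Pi; apply: cvgM => //; apply: fl.
Qed.

Lemma cvg_mulmx m n p (f : T -> 'M[K]_(m, n)) (g : T -> 'M[K]_(n, p))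
    (a : 'M[K]_(m, n)) (b : 'M[K]_(n, p)) :
  f @ F --> a -> g @ F --> b -> f t *m g t @[t --> F] --> a *m b.
Proof.
move=> fa gb; apply: mx_cvg => i j; under eq_fun do rewrite mxE; rewrite mxE.
by apply: cvg_sum_fin => k _; apply: cvgM; apply: cvg_coord.
Qed.

Lemma cvg_addmx m n (f g : T -> 'M[K]_(m, n)) (a b : 'M[K]_(m, n)) :
  f @ F --> a -> g @ F --> b -> f t + g t @[t --> F] --> a + b.
Proof. exact: cvgD. Qed.

Lemma cvg_oppmx m n (f : T -> 'M[K]_(m, n)) (a : 'M[K]_(m, n)) :
  f @ F --> a -> - f t @[t --> F] --> - a.
Proof. exact: cvgN. Qed.

Lemma cvg_scalemx m n (c : T -> K) (f : T -> 'M[K]_(m, n)) (k : K)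
    (a : 'M[K]_(m, n)) :
  c @ F --> k -> f @ F --> a -> c t *: f t @[t --> F] --> k *: a.
Proof.
move=> ck fa; apply: mx_cvg => i j; under eq_fun do rewrite mxE; rewrite mxE.
by apply: cvgM => //; apply: cvg_coord.
Qed.

Lemma cvg_trmx m n (f : T -> 'M[K]_(m, n)) (a : 'M[K]_(m, n)) :
  f @ F --> a -> (f t)^T @[t --> F] --> a^T.
Proof.
move=> fa; apply: mx_cvg => i j; under eq_fun do rewrite mxE; rewrite mxE.
exact: cvg_coord.
Qed.

Lemma cvg_det n (f : T -> 'M[K]_n) (a : 'M[K]_n) :
  f @ F --> a -> \det (f t) @[t --> F] --> \det a.
Proof.
move=> fa; apply: cvg_sum_fin => s _; apply: cvgM; first exact: cvg_cst.
by apply: cvg_prod_fin => i _; apply: cvg_coord.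
Qed.

Lemma cvg_adj n (f : T -> 'M[K]_n) (a : 'M[K]_n) :
  f @ F --> a -> \adj (f t) @[t --> F] --> \adj a.
Proof.
move=> fa; apply: mx_cvg => i j; under eq_fun do rewrite mxE; rewrite mxE.
apply: cvgM; first exact: cvg_cst.
apply: cvg_det; apply: mx_cvg => i' j'.
by under eq_fun do rewrite !mxE; rewrite !mxE; apply: cvg_coord.
Qed.

Lemma cvg_unitmx n (f : T -> 'M[K]_n) (a : 'M[K]_n) :
  f @ F --> a -> a \in unitmx -> \forall t \near F, f t \in unitmx.
Proof.
move=> /cvg_det fa; rewrite unitmxE unitfE => a0.
by apply: filterS (@cvgr_neq0 _ K^o _ _ _ _ _ fa a0) => t; rewrite unitmxE unitfE.
Qed.

Lemma cvg_invmx n (f : T -> 'M[K]_n) (a : 'M[K]_n) :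
  f @ F --> a -> a \in unitmx -> invmx (f t) @[t --> F] --> invmx a.
Proof.
move=> fa ua; have nu := cvg_unitmx fa ua.
suff : (\det (f t))^-1 *: \adj (f t) @[t --> F] --> invmx a.
  apply: cvg_trans; apply: near_eq_cvg; apply: filterS nu => t ut.
  by rewrite /invmx ut.
rewrite /invmx ua; apply: cvg_scalemx; last exact: cvg_adj.
by apply: cvgV; [rewrite -unitfE -unitmxE|exact: cvg_det].
Qed.

Lemma cvg_row_mx m n p (f : T -> 'M[K]_(m, n)) (g : T -> 'M[K]_(m, p))
    (a : 'M[K]_(m, n)) (b : 'M[K]_(m, p)) :
  f @ F --> a -> g @ F --> b -> row_mx (f t) (g t) @[t --> F] --> row_mx a b.
Proof.
move=> fa gb; apply: mx_cvg => i j; rewrite mxE; under eq_fun do rewrite mxE.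
by case: (fintype.split j) => k; apply: cvg_coord.
Qed.

Lemma cvg_col_mx m n p (f : T -> 'M[K]_(m, n)) (g : T -> 'M[K]_(p, n))
    (a : 'M[K]_(m, n)) (b : 'M[K]_(p, n)) :
  f @ F --> a -> g @ F --> b -> col_mx (f t) (g t) @[t --> F] --> col_mx a b.
Proof.
move=> fa gb; apply: mx_cvg => i j; rewrite mxE; under eq_fun do rewrite mxE.
by case: (fintype.split i) => k; apply: cvg_coord.
Qed.

Lemma cvg_usubmx m n p (f : T -> 'M[K]_(m + n, p)) (a : 'M[K]_(m + n, p)) :
  f @ F --> a -> usubmx (f t) @[t --> F] --> usubmx a.
Proof.
move=> fa; apply: mx_cvg => i j; rewrite mxE; under eq_fun do rewrite mxE.
exact: cvg_coord.
Qed.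

Lemma cvg_lsubmx m n p (f : T -> 'M[K]_(m, n + p)) (a : 'M[K]_(m, n + p)) :
  f @ F --> a -> lsubmx (f t) @[t --> F] --> lsubmx a.
Proof.
move=> fa; apply: mx_cvg => i j; rewrite mxE; under eq_fun do rewrite mxE.
exact: cvg_coord.
Qed.

End matrix_limits.

Section complex_limits.
Variable R : realType.
Local Notation C := R[i].
Context {T : Type} {F : set_system T} {FF : Filter F}.

Definition conjmx m n (A : 'M[C]_(m, n)) : 'M[C]_(m, n) := map_mx Num.conj A.

Lemma cvg_conjmx m n (f : T -> 'M[C]_(m, n)) (a : 'M[C]_(m, n)) :
  f @ F --> a -> conjmx (f t) @[t --> F] --> conjmx a.
Proof.
move=> fa; apply: mx_cvg => i j; rewrite mxE; under eq_fun do rewrite mxE.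
apply: (cvg_comp (fun t => f t i j) (fun z : C => Num.conj z)).
  exact: cvg_coord fa.
exact: conj_continuous.
Qed.
End complex_limits.

(** * General position of Lipschitz maps *)

Section lipschitz_images.
Variable R : realType.

Lemma mx_norm_le m n (A : 'M[R]_(m, n)) (e : R) : 0 <= e ->
  (forall i j, `|A i j| <= e) -> `|A| <= e.
Proof.
move=> e0 Ae; rewrite [leLHS]/Num.norm /= mx_normrE.
by apply/bigmax_leP; split=> // i _; exact: Ae.
Qed.

Lemma mx_norm_ge m n (A : 'M[R]_(m, n)) i j : `|A i j| <= `|A|.
Proof.
by rewrite [leRHS]/Num.norm /= mx_normrE; apply/bigmax_geP; right; exists (i, j).
Qed.

Lemma truncn_eq_dist (x y : R) : 0 <= x -> 0 <= y ->
  Num.truncn x = Num.truncn y -> `|x - y| <= 1.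
Proof.
move=> x0 y0 xy; have /andP[x1 x2] := truncn_itv x0.
have /andP[y1 y2] := truncn_itv y0; rewrite xy in x1 x2.
by rewrite -natr1 in x2 y2; rewrite ler_norml; apply/andP; split; lra.
Qed.

(* A grid of M^N points of spacing eps / M cannot be met by r * O(M^q) sets of
   smaller diameter when q < N. *)
Lemma lipschitz_avoid (q N r : nat) (G : 'I_r -> 'rV[R]_q -> 'rV[R]_N) (L : R) :
  (forall i x y, `|x| <= 1 -> `|y| <= 1 -> `|G i x - G i y| <= L * `|x - y|) ->
  (q < N)%N -> forall eps, 0 < eps ->
  exists p, `|p| <= eps /\ forall i x, `|x| <= 1 -> G i x != p.
Proof.
move=> GL qN eps eps0; pose L' := Num.max L 0.
have L'0 : 0 <= L' by rewrite le_max lexx orbT.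
(* Two points of the source in one cell of side [2 / (c * M)] have images closer than the spacing
   [eps / M] of the grid. *)
pose c := (Num.truncn (2 * L' / eps)).+1.
have cP : 2 * L' < c%:R * eps.
  by rewrite -ltr_pdivrMr//; apply: truncnS_gt.
(* [M] exceeds [r * (c + 1) ^ q], so the number of codes, at most [r * (c + 1) ^ q * M ^ q], is
   below [M ^ (q + 1)]. *)
pose M := (r * c.+1 ^ q).+1; pose K := (c * M)%N.
have M0 : 0 < M%:R :> R by rewrite ltr0n.
have K0 : 0 < K%:R :> R by rewrite ltr0n muln_gt0.
apply: contrapT => /forallNP noP.
pose p (a : {ffun 'I_N -> 'I_M}) : 'rV[R]_N := \row_j (eps * (a j)%:R / M%:R).
have pe a : `|p a| <= eps.
  apply: mx_norm_le; first exact: ltW.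
  move=> i j; rewrite mxE ger0_norm; last by rewrite !mulr_ge0// ltW// invr_gt0.
  by rewrite ler_pdivrMr// ler_pM2l// ler_nat ltnW.
have hit a : exists ix : 'I_r * 'rV[R]_q, `|ix.2| <= 1 /\ G ix.1 ix.2 = p a.
  have := noP (p a); rewrite not_andP => -[//|].
  by move=> /existsNP[i /existsNP[x /not_implyP[x1 /negP/negPn/eqP Gx]]]; exists (i, x).
have {noP hit} [f fP] := choice hit.
pose y a l := ((f a).2 ord0 l + 1) / 2 * K%:R.
have y_ge0 a l : 0 <= y a l.
  have [x1 _] := fP a; have := le_trans (mx_norm_ge (f a).2 ord0 l) x1.
  by rewrite ler_norml => /andP[? ?]; rewrite /y; apply: mulr_ge0; [lra|exact: ltW].
have y_lt a l : (Num.truncn (y a l) < K.+1)%N.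
  rewrite ltnS -(ler_nat R); have /andP[yl _] := truncn_itv (y_ge0 a l).
  apply: le_trans yl _; rewrite /y; apply: ler_piMl; first exact: ltW.
  have [x1 _] := fP a; have := le_trans (mx_norm_ge (f a).2 ord0 l) x1.
  by rewrite ler_norml => /andP[? ?]; lra.
(* Pigeonhole: a grid point is encoded by the index of a map that hits it and the cell of a
   preimage. *)
pose code a : 'I_r * {ffun 'I_q -> 'I_K.+1} :=
  ((f a).1, [ffun l => Ordinal (y_lt a l)]).
have : injective code.
  move=> a a' []; have [x1 Gx] := fP a; have [x1' Gx'] := fP a'.
  move=> i12 /ffunP cc; apply/ffunP => j; apply/val_inj => /=.
  have xx : `|(f a).2 - (f a').2| <= 2 / K%:R.
    apply: mx_norm_le => [|i l]; first by rewrite divr_ge0// ltW.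
    have := cc l; rewrite !ffunE => -[] /(truncn_eq_dist (y_ge0 _ _) (y_ge0 _ _)).
    rewrite /y -mulrBl normrM (ger0_norm (ltW K0)) -ler_pdivlMr// mul1r.
    rewrite (_ : _ - _ = ((f a).2 ord0 l - (f a').2 ord0 l) / 2); last by lra.
    rewrite normrM (ger0_norm (_ : 0 <= 2^-1))// ler_pdivrMr// (ord1 i) !mxE.
    by rewrite mulrC.
  have : `|p a - p a'| <= L' * (2 / K%:R).
    rewrite -Gx -Gx' i12; apply: le_trans (GL _ _ _ x1 x1') _.
    apply: le_trans (_ : L' * `|(f a).2 - (f a').2| <= _).
      by rewrite ler_wpM2r// le_max lexx.
    by rewrite ler_wpM2l.
  move=> /(le_trans (mx_norm_ge _ ord0 j)); rewrite !mxE -mulrBl -mulrBr.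
  rewrite !normrM (gtr0_norm eps0) normfV (gtr0_norm M0).
  rewrite /K natrM invfM => le1; apply/eqP/negPn/negP => aa'.
  have d1 : 1 <= `|(a j)%:R - (a' j)%:R| :> R.
    case/orP: (leq_total (a j) (a' j)) => jj.
      rewrite distrC -natrB// normr_nat ler1n subn_gt0 ltn_neqAle aa'//.
    rewrite -natrB// normr_nat ler1n subn_gt0 ltn_neqAle eq_sym aa'//.
  have : eps / M%:R <= L' * (2 * (c%:R^-1 / M%:R)).
    apply: le_trans le1; rewrite ler_pM2r ?invr_gt0//.
    by rewrite ler_peMr// ltW.
  rewrite !mulrA ler_pM2r ?invr_gt0// ler_pdivlMr; last by rewrite ltr0n.
  by rewrite leNgt => /negP; apply; rewrite mulrC [eps * _]mulrC.
move=> /leq_card; apply/negP; rewrite -ltnNge card_prod !card_ffun !card_ord.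
have Ks : (K.+1 <= c.+1 * M)%N by rewrite /K mulSn -addn1 addnC leq_add2r.
apply: leq_ltn_trans (_ : r * (c.+1 * M) ^ q < _)%N.
  have leqX a b e : (a <= b)%N -> (a ^ e <= b ^ e)%N.
    by case: e => // e ab; rewrite leq_exp2r.
  by rewrite leq_mul// leqX.
rewrite expnMn mulnA; apply: (@leq_trans (M ^ q.+1)); last by rewrite leq_pexp2l.
by rewrite expnS ltn_pmul2r// expn_gt0.
Qed.
End lipschitz_images.

(** * Lipschitz approximation on cubes *)

Section lipschitz_approximation.
Variable R : realType.

Definition cube j : set 'rV[R]_j := [set v | `|v| <= 1].

Lemma compact_cube j : compact (@cube j).
Proof.
apply: bounded_closed_compact.
  exists 1; split; first exact: num_real.
  by move=> M M1 v /= v1; apply: le_trans v1 _; exact: ltW.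
rewrite (_ : @cube j = (fun v : 'rV[R]_j => `|v|) @^-1` [set x | x <= 1])//.
apply: closed_comp => [v _|]; first exact: norm_continuous.
exact: closed_le.
Qed.

(** Only [x] is confined to the compact set. Covering by balls of half the radius of continuity
    leaves room for a point [y] of the whole space. *)
Lemma compact_uniformly_continuous (V W : normedModType R) (K : set V)
    (f : V -> W) (e : R) : compact K -> continuous f -> 0 < e ->
  exists2 d, 0 < d & forall x y, K x -> `|x - y| < d -> `|f x - f y| < e.
Proof.
move=> /compact_near_coveringP cK fc e0.
have e20 : 0 < e / 2 by rewrite divr_gt0.
have : \forall d \near 0^'+, K `<=` [set x : V | forall y, `|x - y| < d -> `|f x - f y| < e].
  apply: (cK R 0^'+ (fun d x => forall y, `|x - y| < d -> `|f x - f y| < e)) => x Kx.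
  have /cvgrPdist_lt /(_ _ e20) /nbhs_normP [d /= d0 dP] := fc x.
  exists (ball x (d / 2), [set d' : R | d' < d / 2]) => /=.
    split; first by apply: nbhsx_ballx; rewrite divr_gt0.
    by apply: nbhs_right_lt; rewrite divr_gt0.
  move=> [x' d'] /= [xx' dd'] y x'y.
  have fx' : `|f x - f x'| < e / 2.
    apply: dP; rewrite -ball_normE/= in xx' *; apply: lt_trans xx' _.
    by rewrite ltr_pdivrMr// ltr_pMr// ltr1n.
  have fy : `|f x - f y| < e / 2.
    apply: dP; rewrite -ball_normE/= in xx' *.
    have -> : x - y = (x - x') + (x' - y) by rewrite addrA subrK.
    apply: le_lt_trans (ler_normD _ _) _; rewrite (splitr d) ltrD//.
    exact: lt_trans x'y _.
  have -> : f x' - f y = - (f x - f x') + (f x - f y) by rewrite opprB addrA subrK.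
  by apply: le_lt_trans (ler_normD _ _) _; rewrite normrN (splitr e) ltrD.
move=> near_d; have := @filter_ex _ _ _ _ (filterI near_d (nbhs_right_gt 0)).
by move=> [d [Kd d0]]; exists d => // x y Kx; exact: Kd.
Qed.

(* The infimal convolution of f with a steep cone. *)
Lemma lipschitz_approx (j : nat) (f : 'rV[R]_j -> R) (e : R) :
  continuous f -> 0 < e ->
  exists2 g : 'rV[R]_j -> R, exists L, forall x y, `|g x - g y| <= L * `|x - y|
    & forall x, cube x -> `|g x - f x| <= e.
Proof.
move=> fc e0.
have [d d0 df] := compact_uniformly_continuous (@compact_cube j) fc e0.
have [M M0 fM] : exists2 M, 0 < M & forall x, cube x -> `|f x| <= M.
  have : compact (f @` @cube j).
    apply: continuous_compact; last exact: compact_cube.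
    exact: continuous_subspaceT.
  move=> /compact_bounded [M [_ MP]]; exists (`|M| + 1) => [|x cx].
    by rewrite ltr_wpDl.
  apply: MP; last by exists x.
  by apply: le_lt_trans (ler_norm _) _; rewrite ltrDl.
(* At distance [d] or more a cone of this slope rises by at least [2 * M], the largest possible
   oscillation of [f] on the cube, so only points within [d] can lower the infimum. *)
pose n := 2 * M / d.
have n0 : 0 < n by rewrite /n divr_gt0// mulr_gt0.
pose S x := [set f y + n * `|x - y| | y in @cube j].
have c0 : cube (0 : 'rV[R]_j) by rewrite /cube/= normr0.
have S0 x : S x !=set0 by exists (f 0 + n * `|x - 0|), 0.
have lbS x : has_lbound (S x).
  exists (- M) => _ [y cy <-]; have := fM _ cy; rewrite ler_norml => /andP[h _].
  by apply: le_trans h _; rewrite lerDl mulr_ge0// ltW.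
exists (fun x => inf (S x)).
  exists n.
  have lip x y : inf (S x) - n * `|x - y| <= inf (S y).
    apply: lb_le_inf => // _ [z cz <-]; rewrite lerBlDr.
    apply: le_trans (_ : f z + n * `|x - z| <= _); first by apply: ge_inf => //; exists z.
    rewrite -addrA lerD2l -mulrDr ler_pM2l// [leRHS]addrC.
    have -> : x - z = (x - y) + (y - z) by rewrite addrA subrK.
    exact: ler_normD.
  move=> x y; have := lip x y; have := lip y x; rewrite (distrC y x) => h1 h2.
  by rewrite ler_norml; apply/andP; split; lra.
move=> x cx.
have le_f : inf (S x) <= f x.
  by apply: ge_inf => //; exists x => //; rewrite subrr normr0 mulr0 addr0.
have : f x - e <= inf (S x).
  apply: lb_le_inf => // _ [y cy <-].
  have [xy|xy] := ltP (`|x - y|) d.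
    have := df _ _ cx xy; rewrite ltr_norml => /andP[h1 h2].
    by have : 0 <= n * `|x - y|; [rewrite mulr_ge0// ltW|lra].
  have : 2 * M <= n * `|x - y|.
    apply: le_trans (_ : n * d <= _); last by rewrite ler_pM2l.
    by rewrite /n divfK// gt_eqF.
  have := fM _ cy; have := fM _ cx; rewrite !ler_norml => /andP[? ?] /andP[? ?].
  by move=> ?; lra.
by move=> h; rewrite ler_norml; apply/andP; split; lra.
Qed.
End lipschitz_approximation.

(** * Translations into general position *)

Section general_position.
Variable R : realType.

Lemma lsubmx_norm m n p (A : 'M[R]_(m, n + p)) : `|lsubmx A| <= `|A|.
Proof. by apply: mx_norm_le => // i j; rewrite mxE; exact: mx_norm_ge. Qed.

Lemma rsubmx_norm m n p (A : 'M[R]_(m, n + p)) : `|rsubmx A| <= `|A|.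
Proof. by apply: mx_norm_le => // i j; rewrite mxE; exact: mx_norm_ge. Qed.

Lemma row_mx_norm m n p (A : 'M[R]_(m, n)) (B : 'M[R]_(m, p)) (e : R) :
  0 <= e -> `|A| <= e -> `|B| <= e -> `|row_mx A B| <= e.
Proof.
move=> e0 Ae Be; apply: mx_norm_le => // i j; rewrite mxE.
by case: fintype.splitP => k _; [apply: le_trans Ae|apply: le_trans Be];
  exact: mx_norm_ge.
Qed.

Lemma mxvec_norm m n (A : 'M[R]_(m, n)) : `|mxvec A| = `|A|.
Proof.
apply/eqP; rewrite eq_le; apply/andP; split; apply: mx_norm_le => // i j.
  by case/mxvec_indexP: j => k l; rewrite (ord1 i) mxvecE; exact: mx_norm_ge.
by rewrite -(mxvecE A); exact: mx_norm_ge.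
Qed.

Lemma row_norm m n (A : 'M[R]_(m, n)) i : `|row i A| <= `|A|.
Proof. by apply: mx_norm_le => // k j; rewrite mxE; exact: mx_norm_ge. Qed.

Definition insert_row a n (i : 'I_a.+1) (r : 'rV[R]_n) (A : 'M[R]_(a, n)) :
    'M[R]_(a.+1, n) :=
  \matrix_(l, c) if unlift i l is Some l' then A l' c else r ord0 c.

Lemma insert_row_norm a n (i : 'I_a.+1) (r : 'rV[R]_n) A (e : R) :
  0 <= e -> `|r| <= e -> `|A| <= e -> `|insert_row i r A| <= e.
Proof.
move=> e0 re Ae; apply: mx_norm_le => // l c; rewrite mxE.
by case: unlift => [k|]; [apply: le_trans Ae|apply: le_trans re];
  exact: mx_norm_ge.
Qed.

Lemma insert_rowB a n (i : 'I_a.+1) (r r' : 'rV[R]_n) A A' :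
  insert_row i r A - insert_row i r' A' = insert_row i (r - r') (A - A').
Proof. by apply/matrixP => l c; rewrite !mxE; case: unlift => [k|]; rewrite ?mxE. Qed.

(* The matrices with [row i B = comb i z B] for some [i] and some [z] in a cube
   of dimension e form a set of codimension n - e. *)
Lemma general_position (J e n a : nat)
    (comb : 'I_a -> 'rV[R]_e -> 'M[R]_(a, n) -> 'rV[R]_n)
    (f : 'rV[R]_J -> 'M[R]_(a, n)) (Lf : R) :
  (forall i z B B', (forall l, l != i -> row l B = row l B') ->
     comb i z B = comb i z B') ->
  (forall M, exists2 L, 0 <= L & forall i z z' B B', `|z| <= 1 -> `|z'| <= 1 ->
     `|B| <= M -> `|B'| <= M ->
     `|comb i z B - comb i z' B'| <= L * (`|z - z'| + `|B - B'|)) ->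
  (forall x y, `|f x - f y| <= Lf * `|x - y|) ->
  (J + e < n)%N -> forall eps, 0 < eps ->
  exists2 p, `|p| <= eps & forall i t z, `|t| <= 1 -> `|z| <= 1 ->
    row i (f t + p) != comb i z (f t + p).
Proof.
case: a comb f => [|a] comb f combD combL fL Jen eps eps0.
  by exists 0; [rewrite normr0 ltW|case].
pose tt (x : 'rV[R]_(J + (e + a * n))) := lsubmx x.
pose zz (x : 'rV[R]_(J + (e + a * n))) := lsubmx (rsubmx x).
pose pp (x : 'rV[R]_(J + (e + a * n))) : 'M[R]_(a, n) := vec_mx (rsubmx (rsubmx x)).
have pp1 x : `|pp x| <= `|x|.
  by rewrite -mxvec_norm vec_mxK; do 2 apply: le_trans (rsubmx_norm _) _.
have zz1 x : `|zz x| <= `|x|.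
  by apply: le_trans (lsubmx_norm _) _; exact: rsubmx_norm.
have tt1 x : `|tt x| <= `|x| by exact: lsubmx_norm.
have ppB x y : pp (x - y) = pp x - pp y by rewrite /pp !linearB.
have zzB x y : zz (x - y) = zz x - zz y by rewrite /zz !linearB.
have ttB x y : tt (x - y) = tt x - tt y by rewrite /tt !linearB.
pose B i x := f (tt x) + insert_row i 0 (pp x).
(* A parametrisation of the bad translations for the index [i]: once the point, the relation and the
   other rows of [p] are given, [combD] leaves a single value for row [i]. The source has dimension
   [J + e + a * n], less than [(a + 1) * n]. *)
pose G i x := mxvec (insert_row i (comb i (zz x) (B i x) - row i (f (tt x))) (pp x)).
pose Lf' := Num.max Lf 0.
have Lf'0 : 0 <= Lf' by rewrite le_max lexx orbT.
have fL' x y : `|f x - f y| <= Lf' * `|x - y|.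
  by apply: le_trans (fL _ _) _; rewrite ler_wpM2r// le_max lexx.
pose M := `|f 0| + Lf' + 1.
have BM i x : `|x| <= 1 -> `|B i x| <= M.
  move=> x1; apply: le_trans (ler_normD _ _) _; apply: lerD; last first.
    by apply: insert_row_norm; rewrite ?normr0//; apply: le_trans (pp1 x) x1.
  rewrite -[f _](subrK (f 0)) addrC; apply: le_trans (ler_normD _ _) _.
  rewrite lerD2l; apply: le_trans (fL' _ _) _; rewrite subr0 ler_piMr//.
  exact: le_trans (tt1 x) x1.
have BB i x y : `|B i x - B i y| <= (Lf' + 1) * `|x - y|.
  rewrite /B opprD addrACA insert_rowB subrr mulrDl mul1r.
  apply: le_trans (ler_normD _ _) _; apply: lerD.
    apply: le_trans (fL' _ _) _; rewrite ler_wpM2l// -ttB; exact: tt1.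
  by apply: insert_row_norm; rewrite ?normr0// -ppB; exact: pp1.
have [L L0 LP] := combL M.
have GL i x y : `|x| <= 1 -> `|y| <= 1 ->
    `|G i x - G i y| <= (L * (1 + (Lf' + 1)) + Lf' + 1) * `|x - y|.
  move=> x1 y1; rewrite /G -linearB mxvec_norm insert_rowB.
  have K0 : 0 <= L * (1 + (Lf' + 1)) + Lf' by rewrite addr_ge0// mulr_ge0// !addr_ge0.
  apply: insert_row_norm; first by rewrite mulr_ge0// addr_ge0.
    rewrite [- (_ - row i _)]opprD addrACA -opprD -linearB.
    apply: le_trans (_ : (L * (1 + (Lf' + 1)) + Lf') * `|x - y| <= _); last first.
      by rewrite ler_wpM2r// lerDl.
    rewrite [leRHS]mulrDl; apply: le_trans (ler_normD _ _) _; apply: lerD.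
      apply: le_trans (LP _ _ _ _ _ _ _ (BM _ _ x1) (BM _ _ y1)) _.
      - exact: le_trans (zz1 _) _.
      - exact: le_trans (zz1 _) _.
      rewrite -mulrA ler_wpM2l// mulrDl mul1r; apply: lerD; last exact: BB.
      by rewrite -zzB; exact: zz1.
    rewrite normrN; apply: le_trans (row_norm _ _) _.
    by apply: le_trans (fL' _ _) _; rewrite ler_wpM2l// -ttB; exact: tt1.
  rewrite -ppB; apply: le_trans (pp1 _) _; rewrite ler_peMl// lerDr//.
have qN : (J + (e + a * n) < a.+1 * n)%N by rewrite addnA mulSn ltn_add2r.
(* The parameters of [G] fill the unit cube only, so the other rows of the translation must have
   norm at most 1 to be among them. *)
have m0 : 0 < Num.min eps 1 by rewrite lt_min eps0 ltr01.
have [p' [p'm p'G]] := lipschitz_avoid GL qN m0.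
move: p'm; rewrite le_min => /andP[p'eps p'1].
exists (vec_mx p'); first by rewrite -mxvec_norm vec_mxK.
move=> i t z t1 z1; apply/eqP => bad.
pose x : 'rV[R]_(J + (e + a * n)) := row_mx t (row_mx z (mxvec (row' i (vec_mx p')))).
have x1 : `|x| <= 1.
  do 2 (apply: row_mx_norm => //); rewrite mxvec_norm; apply: le_trans p'1.
  have -> : `|p'| = `|(vec_mx p' : 'M[R]_(a.+1, n))| by rewrite -(mxvec_norm (vec_mx p')) vec_mxK.
  by apply: mx_norm_le => // k l; rewrite mxE; exact: mx_norm_ge.
have := p'G i x x1; rewrite /G /B /tt /zz /pp /x row_mxKr !row_mxKl row_mxKr mxvecK.
move=> /eqP; apply; apply: (can_inj (@vec_mxK _ _ _)); rewrite mxvecK.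
have -> : comb i z (f t + insert_row i 0 (row' i (vec_mx p'))) = comb i z (f t + vec_mx p').
  apply: combD => l li; apply/rowP => c; rewrite !mxE.
  by case: unliftP => [k ->|ll]; [rewrite ?mxE|rewrite ll eqxx in li].
rewrite -bad; apply/matrixP => l c; rewrite !mxE.
by case: unliftP => [k ->|->]; rewrite ?mxE// addrAC subrr add0r.
Qed.
End general_position.

(** * The Euclidean norm, radial projection and the retraction onto the disc *)

Section euclidean_norm.
Variables (R : realType) (j : nat).
Implicit Types v : 'rV[R]_j.

(** Cells are Euclidean discs, whereas [|v|] is the sup norm. *)
Definition nrm v := Num.sqrt (sqnorm v).

Lemma sqnorm_ge0 v : 0 <= sqnorm v.
Proof. by apply: sumr_ge0 => i _; exact: sqr_ge0. Qed.

Lemma nrm_ge0 v : 0 <= nrm v. Proof. exact: sqrtr_ge0. Qed.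

Lemma sqr_nrm v : nrm v ^+ 2 = sqnorm v.
Proof. by rewrite sqr_sqrtr// sqnorm_ge0. Qed.

Lemma nrmZ r v : nrm (r *: v) = `|r| * nrm v.
Proof.
rewrite /nrm /sqnorm; under eq_bigr do rewrite mxE exprMn.
by rewrite -mulr_sumr sqrtrM ?sqr_ge0// sqrtr_sqr.
Qed.

Lemma mx_norm_nrm v : `|v| <= nrm v.
Proof.
apply: mx_norm_le => [|i k]; first exact: nrm_ge0.
rewrite -sqrtr_sqr /nrm ler_wsqrtr// (ord1 i) /sqnorm (bigD1 k)//= lerDl.
by apply: sumr_ge0 => l _; exact: sqr_ge0.
Qed.

Lemma nrm_eq0 v : nrm v = 0 -> v = 0.
Proof.
by move=> v0; apply/eqP; rewrite -normr_le0 -v0; exact: mx_norm_nrm.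
Qed.

Lemma nrm0 : nrm 0 = 0.
Proof. by rewrite -(scale0r 0) nrmZ normr0 mul0r. Qed.

Lemma sphereE v : sphere v <-> nrm v = 1.
Proof.
rewrite /sphere/=; split=> [v1|v1]; first by rewrite /nrm v1 sqrtr1.
by rewrite -sqr_nrm v1 expr1n.
Qed.

Lemma closed_discE v : closed_disc v <-> nrm v <= 1.
Proof.
rewrite /closed_disc/= -sqr_nrm -[X in _ <= X](expr1n _ 2).
by rewrite ler_sqr ?nnegrE ?nrm_ge0.
Qed.

Lemma open_discE v : open_disc v <-> nrm v < 1.
Proof.
rewrite /open_disc/= -sqr_nrm -[X in _ < X](expr1n _ 2).
by rewrite ltr_sqr ?nnegrE ?nrm_ge0.
Qed.

Lemma sphere_disc v : sphere v -> closed_disc v.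
Proof. by move=> /sphereE v1; apply/closed_discE; rewrite v1. Qed.

Lemma disc_cube v : closed_disc v -> cube v.
Proof. by move/closed_discE; apply: le_trans; exact: mx_norm_nrm. Qed.

Lemma sqnorm_continuous : continuous (@sqnorm R j).
Proof.
move=> v; apply: (@cvg_sum_fin _ _ (nbhs v)) => i _.
under eq_fun do rewrite expr2; rewrite expr2.
by apply: cvgM; exact: coord_continuous.
Qed.

Lemma nrm_continuous : continuous nrm.
Proof.
move=> v; apply: (@continuous_comp _ _ _ (@sqnorm R j) Num.sqrt).
  exact: sqnorm_continuous.
exact: sqrt_continuous.
Qed.

Lemma closed_disc_closed : closed (@closed_disc R j).
Proof.
rewrite (_ : @closed_disc R j = @sqnorm R j @^-1` [set x | x <= 1])//.
by apply: closed_comp => [v _|]; [exact: sqnorm_continuous|exact: closed_le].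
Qed.

Lemma sphere_closed : closed (@sphere R j).
Proof.
rewrite (_ : @sphere R j = @sqnorm R j @^-1` [set x | x = 1])//.
by apply: closed_comp => [v _|]; [exact: sqnorm_continuous|exact: closed_eq].
Qed.

Lemma compact_disc : compact (@closed_disc R j).
Proof.
by apply: (subclosed_compact closed_disc_closed (@compact_cube R j)) => v /disc_cube.
Qed.

Lemma compact_sphere : compact (@sphere R j).
Proof.
apply: (subclosed_compact sphere_closed (@compact_cube R j)).
by move=> v /sphere_disc /disc_cube.
Qed.

Definition dirv v := (nrm v)^-1 *: v.

Lemma dirv_sphere v : v != 0 -> sphere (dirv v).
Proof.
move=> v0; have n0 : nrm v != 0 by apply: contra v0 => /eqP /nrm_eq0 ->.
by apply/sphereE; rewrite nrmZ normfV ger0_norm ?nrm_ge0// mulVf.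
Qed.

Lemma dirvK v : nrm v *: dirv v = v.
Proof.
rewrite /dirv scalerA; have [/nrm_eq0 ->|n0] := eqVneq (nrm v) 0.
  by rewrite scaler0.
by rewrite divff// scale1r.
Qed.

Lemma dirv_id v : sphere v -> dirv v = v.
Proof. by move=> /sphereE v1; rewrite /dirv v1 invr1 scale1r. Qed.

Lemma dirv_cvg v : v != 0 -> dirv u @[u --> v] --> dirv v.
Proof.
move=> v0; apply: (@cvg_scalemx _ _ (nbhs v)); last exact: cvg_id.
apply: (@cvgV _ _ (nbhs v)); last exact: nrm_continuous.
by apply: contra v0 => /eqP /nrm_eq0 ->.
Qed.

(** The radial retraction onto the closed disc. It turns maps given on a disc into maps on the whole
    space. *)
Definition retr v := (Num.max 1 (nrm v))^-1 *: v.

Lemma retr_disc v : closed_disc (retr v).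
Proof.
have m0 : 0 < Num.max 1 (nrm v) by rewrite lt_max ltr01.
apply/closed_discE; rewrite nrmZ normfV (gtr0_norm m0) mulrC ler_pdivrMr//.
by rewrite mul1r le_max lexx orbT.
Qed.

Lemma retr_id v : closed_disc v -> retr v = v.
Proof.
by move=> /closed_discE v1; rewrite /retr max_l// invr1 scale1r.
Qed.

Lemma retr_continuous : continuous retr.
Proof.
move=> v; apply: (@cvg_scalemx _ _ (nbhs v)); last exact: cvg_id.
apply: (@cvgV _ _ (nbhs v)); first by rewrite gt_eqF// lt_max ltr01.
apply: (@continuous_max _ _ (fun=> 1) nrm); first exact: cst_continuous.
exact: nrm_continuous.
Qed.

(* At 0 the value of u is irrelevant, and there is no sphere if j = 0. *)
Lemma radial_continuous (W : normedModType R) (u : 'rV[R]_j -> W) (w0 : W) :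
  {within @sphere R j, continuous u} ->
  continuous (fun v => nrm v *: (u (dirv v) - w0)).
Proof.
move=> uc v; have [->|v0] := eqVneq v 0; last first.
  apply: (@cvgZ _ _ _ (nbhs v) _ nrm _ (nrm v)); first exact: nrm_continuous.
  apply: cvgB; last exact: cvg_cst.
  have uv := (subspace_continuousP _ _).1 uc _ (dirv_sphere v0).
  apply: (cvg_comp dirv u _ uv) => A; rewrite /within/= => nA.
  have := dirv_cvg v0 nA; rewrite /nbhs/=.
  apply: filterS2 (_ : nbhs v [set u | u != 0]); last first.
    by apply: (@cvgr_neq0 R 'rV[R]_j _ (nbhs v) _ (fun z => z) v).
  by move=> z z0 /=; apply; exact: dirv_sphere.
have [M M0 uM] : exists2 M, 0 < M & forall v, sphere v -> `|u v - w0| <= M.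
  have : compact ((fun v => u v - w0) @` @sphere R j).
    apply: continuous_compact; last exact: compact_sphere.
    move=> z; apply: cvgB; first exact: uc.
    exact: cvg_cst.
  move=> /compact_bounded [M [_ MP]]; exists (`|M| + 1) => [|x cx].
    by rewrite ltr_wpDl.
  apply: MP; last by exists x.
  by apply: le_lt_trans (ler_norm _) _; rewrite ltrDl.
suff : nrm v *: (u (dirv v) - w0) @[v --> nbhs (0 : 'rV[R]_j)] --> (0 : W).
  by rewrite /continuous_at nrm0 scale0r.
apply/(@cvgrPdist_lt _ _ _ (nbhs (0 : 'rV[R]_j))) => e e0; near=> z.
rewrite sub0r normrN normrZ ger0_norm ?nrm_ge0//.
have [->|z0] := eqVneq z 0; first by rewrite nrm0 mul0r.
apply: le_lt_trans (_ : nrm z * M < e).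
  by rewrite ler_wpM2l ?nrm_ge0// uM//; exact: dirv_sphere.
rewrite -ltr_pdivlMr//; near: z.
have : nrm z @[z --> nbhs (0 : 'rV[R]_j)] --> nrm 0 by exact: nrm_continuous.
rewrite nrm0 => /(@cvgrPdist_lt _ _ _ (nbhs (0 : 'rV[R]_j))) /(_ _ (divr_gt0 e0 M0)).
by apply: filterS => z; rewrite sub0r normrN ger0_norm ?nrm_ge0.
Unshelve. all: by end_near. Qed.
End euclidean_norm.

(** * Perturbation relative to the boundary sphere *)

Section perturbation.
Variable R : realType.

Lemma lipschitz_approx_mx (j m n : nat) (f : 'rV[R]_j -> 'M[R]_(m, n)) (e : R) :
  continuous f -> 0 < e ->
  exists2 g : 'rV[R]_j -> 'M[R]_(m, n),
    exists2 L, 0 <= L & forall x y, `|g x - g y| <= L * `|x - y|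
    & forall x, cube x -> `|g x - f x| <= e.
Proof.
move=> fc e0.
have /choice[gL gLP] : forall i, exists gL : ('rV[R]_j -> R) * R,
    (forall x y, `|gL.1 x - gL.1 y| <= gL.2 * `|x - y|) /\
    forall x, cube x -> `|gL.1 x - f x i.1 i.2| <= e.
  move=> [i k]; have fik : continuous (fun x => f x i k).
    by move=> x; apply: (@cvg_coord _ _ (nbhs x)); exact: fc.
  by have [g [L gL] gf] := lipschitz_approx fik e0; exists (g, L).
exists (fun x => \matrix_(i, k) (gL (i, k)).1 x); last first.
  move=> x cx; apply: mx_norm_le => [|i k]; first exact: ltW.
  by rewrite !mxE; exact: (gLP (i, k)).2.
exists (\sum_(ik : 'I_m * 'I_n) `|(gL ik).2|); first exact: sumr_ge0.
move=> x y; apply: mx_norm_le => [|i k].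
  by rewrite mulr_ge0// sumr_ge0.
rewrite !mxE; apply: le_trans ((gLP (i, k)).1 x y) _.
rewrite ler_wpM2r//; apply: le_trans (ler_norm _) _.
by rewrite (bigD1 (i, k))//= lerDl sumr_ge0.
Qed.

(* All points of the segment from A to B if b, and A alone if not. *)
Definition segment_in (V : lmodType R) (good : set V) (b : bool) (B A : V) :=
  forall t, 0 <= t <= b%:R -> good ((1 - t) *: A + t *: B).

(** By compactness of the sphere times [[0, b]], the open condition [good] spreads from the segments
    over the sphere to a collar of the sphere and to all starting points close to [w]. *)
Lemma segment_margin (j : nat) (V : normedModType R) (good : set V)
    (b : bool) (B : V) (w : 'rV[R]_j -> V) :
  open good -> continuous w ->
  (forall v, sphere v -> segment_in good b B (w v)) ->
  exists2 d, 0 < d & forall v A, closed_disc v -> 1 - d <= nrm v ->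
    `|A - w v| < d -> segment_in good b B A.
Proof.
move=> go wc wS.
pose Xi (p : 'rV[R]_j * R * (R * V)) :=
  (1 - p.1.2) *: (w (p.2.1 *: p.1.1) + p.2.2) + p.1.2 *: B.
have Xic : continuous Xi.
  move=> p; apply: (@cvgD _ _ _ (nbhs p)).
    apply: (@cvgZ _ _ _ (nbhs p)).
      apply: cvgB; first exact: cvg_cst.
      by apply: (@cvg_comp _ _ _ fst snd _ _ _ cvg_fst); exact: cvg_snd.
    apply: (@cvgD _ _ _ (nbhs p)).
      have h : (fun p : 'rV[R]_j * R * (R * V) => p.2.1 *: p.1.1) @ nbhs p --> p.2.1 *: p.1.1.
        apply: (@cvgZ _ _ _ (nbhs p)).
          by apply: (@cvg_comp _ _ _ snd fst _ _ _ cvg_snd); exact: cvg_fst.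
        by apply: (@cvg_comp _ _ _ fst fst _ _ _ cvg_fst); exact: cvg_fst.
      exact: (cvg_comp _ w h (wc _)).
    by apply: (@cvg_comp _ _ _ snd snd _ _ _ cvg_snd); exact: cvg_snd.
  apply: (@cvgZ _ _ _ (nbhs p)); last exact: cvg_cst.
  by apply: (@cvg_comp _ _ _ fst snd _ _ _ cvg_fst); exact: cvg_snd.
have cK : compact (@sphere R j `*` (`[0, b%:R]%classic : set R)).
  by apply: compact_setX; [exact: compact_sphere|exact: segment_compact].
move/compact_near_coveringP : cK => /(_ R 0^'+ (fun d ut => forall r A,
   1 - d <= r <= 1 -> `|A - w (r *: ut.1)| < d ->
   good ((1 - ut.2) *: A + ut.2 *: B))) [].
  move=> [u t] [/= su]; rewrite in_itv/= => t01.
  have : nbhs (((u, t), (1, 0)) : 'rV[R]_j * R * (R * V)) (Xi @^-1` good).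
    apply: Xic; apply: open_nbhs_nbhs; split=> //.
    by rewrite /Xi/= scale1r addr0; exact: wS.
  move=> /nbhs_ballP [e /= e0 eP].
  exists (ball (u, t) e, [set d | d < e]).
    by split; [exact: nbhsx_ballx|exact: nbhs_right_lt].
  move=> [[u' t'] d] [/= utb de] r A /andP[r1 r2] Ad.
  have := eP ((u', t'), (r, A - w (r *: u'))); rewrite /Xi/= [w _ + _]addrC subrK.
  apply; split=> //; split=> /=; rewrite -ball_normE/=.
    by apply: le_lt_trans de; rewrite ger0_norm; lra.
  by rewrite sub0r normrN; exact: lt_trans Ad de.
move=> d1 /= d10 dP.
(* Below [d1], and small enough that the collar misses 0, where there is no direction. *)
pose d := Num.min (d1 / 2) (1 / 2).
have d0 : 0 < d by rewrite lt_min !divr_gt0.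
have dd1 : d < d1 by rewrite gt_min ltr_pdivrMr// ltr_pMr// ltr1n.
have d2 : d <= 1 / 2 by rewrite ge_min lexx orbT.
exists d => // v A /closed_discE v1 vd Av t t01.
have v0 : v != 0 by apply: contraTneq vd => ->; rewrite nrm0 -ltNge; lra.
have /(_ d)/= := dP; rewrite sub0r normrN gtr0_norm// => /(_ dd1 d0 (dirv v, t)) h.
apply: (h _ (nrm v)) => /=; first by split; [exact: dirv_sphere|rewrite /= in_itv].
  by rewrite vd v1.
by rewrite dirvK.
Qed.

(** In the collar given by [segment_margin] any small change is harmless, so a cutoff [chi] fades
    the perturbation out there. Inside, [w] is replaced by a generic translate of a Lipschitz
    approximation. Up to the positive factor [1 - t], the segment to [B0] is a ray in the direction
    [B0]; this costs one more dimension when [b] holds, and is the reason why [good] is required to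
    be a cone. *)
Lemma perturb_rel_sphere (j e N a : nat) (b : bool)
    (comb : 'I_a -> 'rV[R]_e -> 'M[R]_(a, N) -> 'rV[R]_N)
    (good : set 'M[R]_(a, N)) (B0 : 'M[R]_(a, N))
    (w : 'rV[R]_j -> 'M[R]_(a, N)) :
  (forall i z B B', (forall l, l != i -> row l B = row l B') ->
     comb i z B = comb i z B') ->
  (forall M, exists2 L, 0 <= L & forall i z z' B B', `|z| <= 1 -> `|z'| <= 1 ->
     `|B| <= M -> `|B'| <= M ->
     `|comb i z B - comb i z' B'| <= L * (`|z - z'| + `|B - B'|)) ->
  (forall B, (forall i z, `|z| <= 1 -> row i B != comb i z B) -> good B) ->
  open good -> (forall B r, 0 < r -> good B -> good (r *: B)) ->
  (b -> good B0) -> continuous w ->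
  (forall v, sphere v -> segment_in good b B0 (w v)) ->
  (j + b + e < N)%N -> forall eps, 0 < eps ->
  exists w' : 'rV[R]_j -> 'M[R]_(a, N),
    [/\ continuous w', forall v, sphere v -> w' v = w v
      & forall v, closed_disc v ->
          `|w' v - w v| <= eps /\ segment_in good b B0 (w' v)].
Proof.
move=> combD combL gn go gs gB0 wc wS jbe eps eps0.
have [d d0 dP] := segment_margin go wc wS.
pose e1 := Num.min eps (d / 2) / 2.
have e10 : 0 < e1 by rewrite divr_gt0// lt_min eps0 divr_gt0.
have e1eps : 2 * e1 <= eps by rewrite mulrC divfK// ge_min lexx.
have e1d : 2 * e1 < d.
  rewrite mulrC divfK//; apply: le_lt_trans (_ : d / 2 < d).
    by rewrite ge_min lexx orbT.
  by rewrite ltr_pdivrMr// ltr_pMr// ltr1n.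
have [f [L L0 fL] fw] := lipschitz_approx_mx wc e10.
have [M M0 wM] : exists2 M, 0 <= M & forall v, cube v -> `|w v| <= M.
  have : compact (w @` @cube R j).
    apply: continuous_compact; last exact: compact_cube.
    exact: continuous_subspaceT.
  move=> /compact_bounded [M [_ MP]]; exists (`|M| + 1); first by rewrite addr_ge0.
  move=> x cx; apply: MP; last by exists x.
  by apply: le_lt_trans (ler_norm _) _; rewrite ltrDl.
have [eta eta0 etaP] : exists2 eta, 0 < eta &
    forall A, b -> `|A - B0| < eta -> good A.
  have [bT|bF] := boolP b; last by exists 1.
  have /nbhs_ballP[eta /= eta0 etaP] : nbhs B0 good.
    by apply: open_nbhs_nbhs; split=> //; exact: gB0.
  by exists eta => // A _ AB; apply: etaP; rewrite -ball_normE/= distrC.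
pose M1 := M + eps + `|B0|.
have M10 : 0 < M1 by rewrite /M1; have := normr_ge0 B0; lra.
(* [M1] bounds the distance from the new values to [B0]. A ray parameter [t / (1 - t)] above [s]
   puts the point within [eta] of [B0], so only the parameters in [[0, s]] are left to general
   position. *)
pose s := M1 / eta; have s0 : 0 < s by rewrite divr_gt0.
pose F (x : 'rV[R]_(j + b)) :=
  f (lsubmx x) + (s * \sum_l (rsubmx x) ord0 l) *: B0.
have FL x y : `|F x - F y| <= (L + s * b%:R * `|B0|) * `|x - y|.
  rewrite /F opprD addrACA -scalerBl -mulrBr -sumrB.
  apply: le_trans (ler_normD _ _) _; rewrite mulrDl; apply: lerD.
    by apply: le_trans (fL _ _) _; rewrite ler_wpM2l// -linearB lsubmx_norm.
  rewrite normrZ normrM (gtr0_norm s0).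
  have -> : s * b%:R * `|B0| * `|x - y| = s * (b%:R * `|x - y|) * `|B0| by ring.
  rewrite ler_wpM2r// ler_wpM2l ?(ltW s0)//.
  apply: le_trans (ler_norm_sum _ _ _) _.
  apply: le_trans (_ : \sum_(i < b) `|x - y| <= _).
    apply: ler_sum => l _; apply: le_trans (rsubmx_norm (x - y)).
    by apply: le_trans (mx_norm_ge _ ord0 l); rewrite !mxE.
  by rewrite sumr_const card_ord mulr_natl.
have [p pe pP] := general_position combD combL FL jbe e10.
pose chi (v : 'rV[R]_j) : R := Num.min 1 ((1 - nrm v) / d).
have chi1 v : closed_disc v -> 0 <= chi v <= 1.
  move=> /closed_discE v1; rewrite /chi ge_min lexx /= andbT le_min ler01/=.
  by rewrite divr_ge0 ?(ltW d0)// subr_ge0.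
have fpw v : closed_disc v -> `|f v + p - w v| <= 2 * e1.
  move=> dv; rewrite addrAC; apply: le_trans (ler_normD _ _) _.
  by rewrite mulrDl mul1r lerD// fw//; exact: disc_cube.
exists (fun v => w v + chi v *: (f v + p - w v)); split.
- have chic : continuous chi.
    move=> v; apply: (@continuous_min _ _ (fun=> 1) (fun v => (1 - nrm v) / d)).
      exact: cst_continuous.
    apply: (@cvgM _ _ (nbhs v)); last exact: cvg_cst.
    by apply: (@cvgB _ _ _ (nbhs v)); [exact: cvg_cst|exact: nrm_continuous].
  have fc : continuous f.
    move=> v; apply/(@cvgrPdist_lt _ _ _ (nbhs v)) => c c0.
    near=> z; apply: le_lt_trans (fL _ _) _.
    apply: le_lt_trans (_ : (L + 1) * `|v - z| < _).
      by rewrite ler_wpM2r// lerDl.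
    rewrite mulrC -ltr_pdivlMr ?ltr_wpDl//; near: z.
    by apply: cvgr_dist_lt; [exact: cvg_id|rewrite divr_gt0// ltr_wpDl].
  move=> v; apply: (@cvgD _ _ _ (nbhs v)); first exact: wc.
  apply: (@cvgZ _ _ _ (nbhs v)); first exact: chic.
  apply: (@cvgB _ _ _ (nbhs v)); last exact: wc.
  by apply: (@cvgD _ _ _ (nbhs v)); [exact: fc|exact: cvg_cst].
- move=> v /sphereE v1.
  by rewrite /chi v1 subrr mul0r min_r// scale0r addr0.
move=> v dv; have /andP[chi0 chi_1] := chi1 _ dv.
have close : `|w v + chi v *: (f v + p - w v) - w v| <= 2 * e1.
  rewrite addrAC subrr add0r normrZ (ger0_norm chi0).
  by apply: le_trans (fpw _ dv); exact: ler_piMl.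
split; first exact: (le_trans close e1eps).
have [vd|vd] := leP (1 - d) (nrm v).
  by apply: (dP v) => //; exact: le_lt_trans close e1d.
have -> : chi v = 1 by rewrite /chi min_l// ler_pdivlMr// mul1r; lra.
rewrite scale1r [w v + _]addrC subrK => t /andP[t0 t1].
have fvB : `|f v + p - B0| <= M1.
  have -> : f v + p - B0 = (f v + p - w v) + (w v - B0) by rewrite addrA subrK.
  have -> : M1 = eps + (M + `|B0|) by rewrite /M1; ring.
  apply: le_trans (ler_normD _ _) _; apply: lerD.
    exact: le_trans (fpw _ dv) e1eps.
  by apply: le_trans (ler_normB _ _) _; rewrite lerD2r wM//; exact: disc_cube.
have [ts|ts] := leP t (s * (1 - t)).
  have t1' : 0 < 1 - t.
    rewrite lt_neqAle; have [t1''|] := leP 1 t; last first.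
      by rewrite -subr_gt0 => h; rewrite lt_eqF//= ltW.
    have : s * (1 - t) <= 0 by rewrite mulr_ge0_le0 ?(ltW s0)// subr_le0.
    by move: ts; lra.
  (* Empty if [b] is false, and then [t = 0]. *)
  pose tau0 : 'rV[R]_b := const_mx (t / (1 - t) / s).
  have tau1 : `|tau0| <= 1.
    apply: mx_norm_le => // i k; rewrite mxE ger0_norm.
      by rewrite !ler_pdivrMr// mul1r.
    by rewrite !divr_ge0// ltW.
  have -> : (1 - t) *: (f v + p) + t *: B0 = (1 - t) *: (F (row_mx v tau0) + p).
    rewrite /F row_mxKl row_mxKr addrAC [in RHS]scalerDr; congr (_ + _).
    rewrite scalerA; congr (_ *: _); under eq_bigr do rewrite mxE.
    rewrite sumr_const card_ord; case: (b) t1 tau0 tau1 => /= t1 _ _.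
      have h (u r : R) : u != 0 -> r != 0 -> t = u * (r * (t / u / r)).
        by move=> u0 r0; rewrite [r * _]mulrC divfK// mulrC divfK.
      by rewrite mulr1n -h// gt_eqF.
    by rewrite mulr0n !mulr0; apply/eqP; rewrite eq_le t1 t0.
  apply: gs => //; apply: gn => i z z1; apply: pP => //.
  by apply: row_mx_norm => //; exact: disc_cube.
have bT : b.
  by case: (b) t1 => //= t1'; move: ts; have -> : t = 0; [lra|rewrite subr0 mulr1; lra].
apply: etaP => //.
have -> : (1 - t) *: (f v + p) + t *: B0 - B0 = (1 - t) *: (f v + p - B0).
  rewrite [RHS]scalerBr -[LHS]addrA; congr (_ + _).
  by rewrite scalerBl scale1r opprB.
have t1' : t <= 1 by rewrite bT in t1.
rewrite normrZ ger0_norm ?subr_ge0//.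
apply: le_lt_trans (_ : (1 - t) * M1 < eta).
  by rewrite ler_wpM2l// subr_ge0.
have : s * (1 - t) < 1 by apply: lt_le_trans ts t1'.
by rewrite /s mulrAC ltr_pdivrMr// mul1r mulrC.
Unshelve. all: by end_near. Qed.
End perturbation.

(** * Injective complex and quaternionic matrices *)

Section realification.
Variable R : realType.
Local Notation C := R[i].
Local Notation RC x := (real_complex R x).
Local Notation Re := (@complex.Re R).
Local Notation Im := (@complex.Im R).

(** The norm of a complex matrix has values in [C]; [|reify A|] is its real replacement in the
    estimates. Rows correspond to rows, so relations among rows can be read on both sides. *)
Definition reify m n (A : 'M[C]_(m, n)) : 'M[R]_(m, n + n) :=
  row_mx (map_mx Re A) (map_mx Im A).

Definition cplx m n (B : 'M[R]_(m, n + n)) : 'M[C]_(m, n) :=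
  \matrix_(i, k) Complex (lsubmx B i k) (rsubmx B i k).

Lemma ReD (x y : C) : Re (x + y) = Re x + Re y.
Proof. by case: x; case: y. Qed.

Lemma ImD (x y : C) : Im (x + y) = Im x + Im y.
Proof. by case: x; case: y. Qed.

Lemma ReN (x : C) : Re (- x) = - Re x. Proof. by case: x. Qed.
Lemma ImN (x : C) : Im (- x) = - Im x. Proof. by case: x. Qed.

Lemma ReM (x y : C) : Re (x * y) = Re x * Re y - Im x * Im y.
Proof. by case: x; case: y. Qed.

Lemma ImM (x y : C) : Im (x * y) = Re x * Im y + Im x * Re y.
Proof. by case: x; case: y. Qed.

Lemma Re_conj (x : C) : Re (Num.conj x) = Re x.
Proof. by case: x. Qed.

Lemma Im_conj (x : C) : Im (Num.conj x) = - Im x.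
Proof. by case: x. Qed.

Lemma Re_sum I (r : seq I) (P : pred I) (f : I -> C) :
  Re (\sum_(i <- r | P i) f i) = \sum_(i <- r | P i) Re (f i).
Proof. by apply: (big_morph _ ReD). Qed.

Lemma Im_sum I (r : seq I) (P : pred I) (f : I -> C) :
  Im (\sum_(i <- r | P i) f i) = \sum_(i <- r | P i) Im (f i).
Proof. by apply: (big_morph _ ImD). Qed.

Lemma reifyK m n : cancel (@reify m n) (@cplx m n).
Proof.
move=> A; apply/matrixP => i k; rewrite !mxE /reify.
by rewrite (unsplitK (inl _ k)) (unsplitK (inr _ k)) !mxE; case: (A i k).
Qed.

Lemma cplxK m n : cancel (@cplx m n) (@reify m n).
Proof.
move=> B; rewrite -[RHS]hsubmxK /reify; congr row_mx.
  by apply/matrixP => i k; rewrite !mxE.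
by apply/matrixP => i k; rewrite !mxE.
Qed.

Lemma reifyD m n (A B : 'M[C]_(m, n)) : reify (A + B) = reify A + reify B.
Proof.
by rewrite /reify add_row_mx; congr row_mx; apply/matrixP => i k;
  rewrite !mxE ?ReD ?ImD.
Qed.

Lemma reifyN m n (A : 'M[C]_(m, n)) : reify (- A) = - reify A.
Proof.
by rewrite /reify opp_row_mx; congr row_mx; apply/matrixP => i k;
  rewrite !mxE ?ReN ?ImN.
Qed.

Lemma reifyB m n (A B : 'M[C]_(m, n)) : reify (A - B) = reify A - reify B.
Proof. by rewrite reifyD reifyN. Qed.

Lemma cplxD m n (A B : 'M[R]_(m, n + n)) : cplx (A + B) = cplx A + cplx B.
Proof. by apply: (can_inj (@reifyK _ _)); rewrite reifyD !cplxK. Qed.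

Lemma cplxB m n (A B : 'M[R]_(m, n + n)) : cplx (A - B) = cplx A - cplx B.
Proof. by apply: (can_inj (@reifyK _ _)); rewrite reifyB !cplxK. Qed.

Lemma cplxZ m n r (A : 'M[R]_(m, n + n)) : cplx (r *: A) = RC r *: cplx A.
Proof.
apply/matrixP => i k; rewrite !mxE.
by apply/eqP; rewrite eq_complex ReM ImM /= !mul0r subr0 addr0 !eqxx.
Qed.

Lemma row_reify m n i (A : 'M[C]_(m, n)) : row i (reify A) = reify (row i A).
Proof. by rewrite /reify row_row_mx -!map_row. Qed.

Lemma reify_le m n (A : 'M[C]_(m, n)) (e : R) : 0 <= e ->
  (forall i k, `|Re (A i k)| <= e /\ `|Im (A i k)| <= e) -> `|reify A| <= e.
Proof.
move=> e0 Ae; apply: row_mx_norm => //; apply: mx_norm_le => // i k;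
  by rewrite mxE; case: (Ae i k).
Qed.

Lemma reify_geRe m n (A : 'M[C]_(m, n)) i k : `|Re (A i k)| <= `|reify A|.
Proof.
apply: le_trans (lsubmx_norm _); rewrite row_mxKl.
by apply: le_trans (mx_norm_ge _ i k); rewrite mxE.
Qed.

Lemma reify_geIm m n (A : 'M[C]_(m, n)) i k : `|Im (A i k)| <= `|reify A|.
Proof.
apply: le_trans (rsubmx_norm _); rewrite row_mxKr.
by apply: le_trans (mx_norm_ge _ i k); rewrite mxE.
Qed.

Lemma reify_mulmx m n p (A : 'M[C]_(m, n)) (B : 'M[C]_(n, p)) :
  `|reify (A *m B)| <= (2 * n%:R) * `|reify A| * `|reify B|.
Proof.
have e0 : 0 <= (2 * n%:R) * `|reify A| * `|reify B| by rewrite !mulr_ge0.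
have h (f : 'I_n -> R) : (forall l, `|f l| <= 2 * (`|reify A| * `|reify B|)) ->
    `|\sum_l f l| <= (2 * n%:R) * `|reify A| * `|reify B|.
  move=> fl; apply: le_trans (ler_norm_sum _ _ _) _.
  have -> : (2 * n%:R) * `|reify A| * `|reify B| =
      \sum_(l < n) 2 * (`|reify A| * `|reify B|).
    by rewrite sumr_const card_ord -mulr_natl; ring.
  exact: ler_sum.
have h2 (x y z t : R) : `|x| <= `|reify A| -> `|z| <= `|reify A| ->
    `|y| <= `|reify B| -> `|t| <= `|reify B| ->
    `|x * y + z * t| <= 2 * (`|reify A| * `|reify B|).
  move=> xA zA yB tB; apply: le_trans (ler_normD _ _) _.
  by rewrite !normrM mulrDl !mul1r; apply: lerD; apply: ler_pM.
apply: reify_le => // i k; rewrite mxE Re_sum Im_sum; split; apply: h => l.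
  rewrite ReM -mulNr; apply: h2; rewrite ?normrN;
    by [exact: reify_geRe|exact: reify_geIm].
by rewrite ImM; apply: h2; [exact: reify_geRe|exact: reify_geIm
  |exact: reify_geIm|exact: reify_geRe].
Qed.

Lemma reify_conj m n (A : 'M[C]_(m, n)) : `|reify (conjmx A)| <= `|reify A|.
Proof.
apply: reify_le => // i k; rewrite mxE Re_conj Im_conj normrN.
by split; [exact: reify_geRe|exact: reify_geIm].
Qed.

Lemma reify_row' m n i (A : 'M[C]_(m, n)) : `|reify (row' i A)| <= `|reify A|.
Proof.
apply: reify_le => // l k; rewrite mxE.
by split; [exact: reify_geRe|exact: reify_geIm].
Qed.

Section limits.
Context {T : Type} {F : set_system T} {FF : Filter F}.

Lemma cvg_Re (f : T -> C) (z : C) : f @ F --> z -> Re (f t) @[t --> F] --> Re z.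
Proof.
move=> fz; apply/cvgrPdist_lt => e e0.
have e0' : 0 < RC e by rewrite ltcR.
have /cvgrPdist_lt /(_ _ e0') := fz; apply: filterS => t.
move=> h; have := le_lt_trans (normc_ge_Re (z - f t)) h.
by rewrite ltcR ReD ReN.
Qed.

Lemma normc_ge_Im (z : C) : RC `|Im z| <= `|z|.
Proof.
have := normc_ge_Re (z * 'i%C); rewrite ReiNIm normrN normrM.
by rewrite [X in _ * X](_ : _ = 1) ?mulr1// normc_def/= expr0n add0r expr1n sqrtr1.
Qed.

Lemma cvg_Im (f : T -> C) (z : C) : f @ F --> z -> Im (f t) @[t --> F] --> Im z.
Proof.
move=> fz; apply/cvgrPdist_lt => e e0.
have e0' : 0 < RC e by rewrite ltcR.
have /cvgrPdist_lt /(_ _ e0') := fz; apply: filterS => t.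
move=> h; have := le_lt_trans (normc_ge_Im (z - f t)) h.
by rewrite ltcR ImD ImN.
Qed.

Lemma norm_Complex (x y : R) : `|Complex x y| <= RC (`|x| + `|y|).
Proof.
rewrite [Complex x y]complexE/=; apply: le_trans (ler_normD _ _) _.
rewrite rmorphD/=; apply: lerD; first by rewrite normc_def/= expr0n addr0 sqrtr_sqr.
rewrite normrM [X in X * _](_ : _ = 1); last first.
  by rewrite normc_def/= expr0n add0r expr1n sqrtr1.
by rewrite mul1r normc_def/= expr0n addr0 sqrtr_sqr.
Qed.

Lemma cvg_Complex (f g : T -> R) (x y : R) : f @ F --> x -> g @ F --> y ->
  Complex (f t) (g t) @[t --> F] --> Complex x y.
Proof.
move=> fx gy; apply/cvgrPdist_lt => e e0.
have [er ei] : 0 < complex.Re e /\ complex.Im e = 0.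
  by move: e0; rewrite ltcE => /andP[/eqP ? ?].
have e2 : 0 < complex.Re e / 2 by rewrite divr_gt0.
have /cvgrPdist_lt /(_ _ e2) := fx; have /cvgrPdist_lt /(_ _ e2) := gy.
apply: filterS2 => t gt ft; apply: le_lt_trans (norm_Complex (x - f t) (y - g t)) _.
by rewrite ltcE/= ei eqxx/= (splitr (complex.Re e)) ltrD.
Qed.

Lemma cvg_RC (f : T -> R) (x : R) : f @ F --> x -> RC (f t) @[t --> F] --> RC x.
Proof. by move=> fx; apply: cvg_Complex => //; exact: cvg_cst. Qed.

Lemma cvg_reify m n (f : T -> 'M[C]_(m, n)) (A : 'M[C]_(m, n)) :
  f @ F --> A -> reify (f t) @[t --> F] --> reify A.
Proof.
move=> fA; apply: cvg_row_mx; apply: mx_cvg => i k; rewrite mxE;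
  under eq_fun do rewrite mxE.
  by apply: cvg_Re; exact: cvg_coord.
by apply: cvg_Im; exact: cvg_coord.
Qed.

Lemma cvg_cplx m n (f : T -> 'M[R]_(m, n + n)) (A : 'M[R]_(m, n + n)) :
  f @ F --> A -> cplx (f t) @[t --> F] --> cplx A.
Proof.
move=> fA; apply: mx_cvg => i k; rewrite mxE; under eq_fun do rewrite mxE.
apply: cvg_Complex; rewrite mxE; under eq_fun do rewrite mxE; exact: cvg_coord.
Qed.
End limits.

End realification.

(** * Normalised linear relations among rows *)

Section row_relations.
Variable R : realType.
Local Notation C := R[i].
Local Notation RC x := (real_complex R x).
Local Notation Re := (@complex.Re R).
Local Notation Im := (@complex.Im R).

Definition sqn (z : C) : R := Re z ^+ 2 + Im z ^+ 2.

Lemma sqn_ge0 z : 0 <= sqn z. Proof. by rewrite addr_ge0 ?sqr_ge0. Qed.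

Lemma sqn_eq0 z : sqn z = 0 -> z = 0.
Proof.
case: z => a b /eqP; rewrite /sqn /= paddr_eq0 ?sqr_ge0// !sqrf_eq0.
by move=> /andP[/eqP -> /eqP ->].
Qed.

Lemma mul_conj (z : C) : Num.conj z * z = RC (sqn z).
Proof.
case: z => a b; apply/eqP; rewrite eq_complex /sqn /=; apply/andP; split; apply/eqP; ring.
Qed.

Lemma conjmxM m n p (A : 'M[C]_(m, n)) (B : 'M[C]_(n, p)) :
  conjmx (A *m B) = conjmx A *m conjmx B.
Proof. exact: map_mxM. Qed.

Lemma conjmxK m n : involutive (@conjmx R m n).
Proof. by move=> A; apply/matrixP => i k; rewrite !mxE conjCK. Qed.

Lemma conjmxD m n (A B : 'M[C]_(m, n)) : conjmx (A + B) = conjmx A + conjmx B.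
Proof. exact: map_mxD. Qed.

Lemma conjmxN m n (A : 'M[C]_(m, n)) : conjmx (- A) = - conjmx A.
Proof. exact: map_mxN. Qed.

Lemma conjmxZ m n a (A : 'M[C]_(m, n)) : conjmx (a *: A) = Num.conj a *: conjmx A.
Proof. exact: map_mxZ. Qed.

Lemma mul_row'E (a n : nat) (u : 'rV[C]_a) (A : 'M[C]_(a, n)) i :
  u *m A = u ord0 i *: row i A + col' i u *m row' i A.
Proof.
apply/rowP => k; rewrite !mxE (bigD1_ord i)//=; congr (_ + _).
by apply: eq_bigr => l _; rewrite !mxE.
Qed.

(* The left relation [x + y J] among the rows is multiplied by the inverse of its
   largest quaternionic coefficient. *)
Lemma normalize_relation (a n : nat) (A : 'M[C]_(a, n)) (q : 'M[C]_n)
    (x y : 'rV[C]_a) :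
  (y = 0 \/ conjmx q *m q = -1%:M) -> (x != 0) || (y != 0) ->
  x *m A + y *m (conjmx A *m q) = 0 ->
  exists i (X Y : 'rV[C]_a.-1),
    [/\ `|reify X| <= 1, `|reify Y| <= 1, y = 0 -> Y = 0
      & row i A = - (X *m row' i A + Y *m (conjmx (row' i A) *m q))].
Proof.
move=> yq xy0 rel.
pose N (i : 'I_a) := sqn (x ord0 i) + sqn (y ord0 i).
have N_ge0 i : 0 <= N i by rewrite addr_ge0 ?sqn_ge0.
have [i0 Ni0] : exists i, N i != 0.
  apply: contrapT => /forallNP h; move: xy0; apply/negP; rewrite negb_or !negbK.
  have hN i : sqn (x ord0 i) = 0 /\ sqn (y ord0 i) = 0.
    have /negP/negPn := h i; rewrite paddr_eq0 ?sqn_ge0// => /andP[/eqP ? /eqP ?].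
    by split.
  by apply/andP; split; apply/eqP/rowP => i; rewrite mxE; apply: sqn_eq0; case: (hN i).
have [i Ni Nmax] : exists2 i, 0 < N i & forall l, N l <= N i.
  case: (@Order.TotalTheory.arg_maxP _ _ _ i0 xpredT N) => // i _ imax.
  exists i; last by move=> l; exact: imax.
  by apply: lt_le_trans (imax i0 isT); rewrite lt_neqAle eq_sym Ni0 N_ge0.
(* The inverse of the quaternion [x_i + y_i J] is [conj x_i - y_i J] divided by [N i]; [X' + Y' J]
   is its product with [x + y J]. *)
pose X' := RC (N i)^-1 *: (Num.conj (x ord0 i) *: x + y ord0 i *: conjmx y).
pose Y' := RC (N i)^-1 *: (Num.conj (x ord0 i) *: y - y ord0 i *: conjmx x).
have NNi : RC (N i)^-1 * RC (N i) = 1 by rewrite -rmorphM mulVf ?gt_eqF.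
have X'i : X' ord0 i = 1.
  by rewrite !mxE mul_conj [y _ _ * _]mulrC mul_conj -rmorphD.
have Y'i : Y' ord0 i = 0.
  by rewrite !mxE [y _ _ * _]mulrC subrr mulr0.
(* The quaternionic norm is multiplicative: this is the four square identity, together with the
   maximality of [N i]. *)
have sq1 l : sqn (X' ord0 l) + sqn (Y' ord0 l) <= 1.
  have -> : sqn (X' ord0 l) + sqn (Y' ord0 l) = (N i)^-1 ^+ 2 * (N i * N l).
    rewrite !mxE /N; move: (_^-1); case: (x ord0 i) (y ord0 i) (x ord0 l) (y ord0 l).
    by move=> a1 a2 [b1 b2] [c1 c2] [e1 e2] r; rewrite /sqn /=; ring.
  by rewrite expr2 mulrACA mulVf ?gt_eqF// mul1r mulrC ler_pdivrMr// mul1r.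
have sqX l : sqn (X' ord0 l) <= 1.
  by apply: le_trans (sq1 l); rewrite lerDl sqn_ge0.
have sqY l : sqn (Y' ord0 l) <= 1.
  by apply: le_trans (sq1 l); rewrite lerDr sqn_ge0.
have sqnP (z : C) : sqn z <= 1 -> `|Re z| <= 1 /\ `|Im z| <= 1.
  move=> z1; have r := sqr_ge0 (Re z); have s := sqr_ge0 (Im z).
  rewrite /sqn in z1; split; rewrite ler_norml; apply/andP; split; nra.
exists i, (col' i X'), (col' i Y'); split.
- by apply: reify_le => // k l; rewrite !(ord1 k) mxE; apply: sqnP.
- by apply: reify_le => // k l; rewrite !(ord1 k) mxE; apply: sqnP.
- move=> y0; apply/rowP => l; rewrite /Y' y0 !mxE mulr0 mul0r.
  by rewrite subrr mulr0.
(* The relation multiplied by [J] from the left. *)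
have rel' : conjmx x *m (conjmx A *m q) - conjmx y *m A = 0.
  have : conjmx (x *m A + y *m (conjmx A *m q)) *m q = 0.
    by rewrite rel /conjmx map_mx0 mul0mx.
  rewrite conjmxD !conjmxM conjmxK mulmxDl -!mulmxA => <-; congr (_ + _).
  case: yq => [->|->]; first by rewrite /conjmx map_mx0 !mul0mx oppr0.
  by rewrite mulmxN mulmx1 mulmxN.
have : X' *m A + Y' *m (conjmx A *m q) = 0.
  rewrite /X' /Y' -!scalemxAl -scalerDr mulmxDl mulmxBl -!scalemxAl.
  have -> : conjmx y *m A = conjmx x *m (conjmx A *m q).
    by apply/esym/eqP; rewrite -subr_eq0 rel'.
  rewrite addrACA subrr addr0 -scalerDr rel !scaler0//.
rewrite (mul_row'E X' A i) (mul_row'E Y' _ i) X'i Y'i scale1r scale0r add0r.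
rewrite -addrA => /eqP; rewrite addr_eq0 => /eqP ->; congr (- (_ + _ *m _)).
by apply/matrixP => k l; rewrite !mxE; apply: eq_bigr => s _; rewrite !mxE.
Qed.

End row_relations.

(** * General position for injective complex and quaternionic matrices *)

Section injective_pencils.
Variable R : realType.
Local Notation C := R[i].
Local Notation RC x := (real_complex R x).

(* Injectivity along the segment from A to B if b, and at A alone if not. *)
Definition pencil (b : bool) m n (A B : 'M[C]_(m, n)) : Prop :=
  forall t : R, 0 <= t <= b%:R -> row_free (RC (1 - t) *: A + RC t *: B).

(** A right inverse of the limit is, near the limit, a right inverse up to an invertible factor. *)
Lemma row_free_cvg (T : Type) (F : set_system T) (FF : Filter F) m n
    (f : T -> 'M[C]_(m, n)) (A : 'M[C]_(m, n)) :
  f @ F --> A -> row_free A -> \forall t \near F, row_free (f t).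
Proof.
move=> fA /row_freeP[B AB].
have h : f t *m B @[t --> F] --> A *m B by apply: cvg_mulmx => //; exact: cvg_cst.
have hu : A *m B \in unitmx by rewrite AB unitmx1.
apply: filterS (cvg_unitmx h hu) => t ut.
apply/row_freeP; exists (B *m invmx (f t *m B)).
by rewrite mulmxA mulmxV.
Qed.

Section perturbable.
Variables (j a e n p : nat) (X Y : 'rV[R]_e -> 'rV[C]_a.-1) (q : 'M[C]_n).
Variable gen : 'M[C]_(a, n) -> 'M[C]_(p, n).
Hypothesis XB : forall z z', X (z - z') = X z - X z'.
Hypothesis YB : forall z z', Y (z - z') = Y z - Y z'.
Hypothesis X1 : forall z, `|reify (X z)| <= `|z|.
Hypothesis Y1 : forall z, `|reify (Y z)| <= `|z|.
Hypothesis gen_relation : forall A, ~~ row_free (gen A) ->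
  exists i z, `|z| <= 1 /\
    row i A = - (X z *m row' i A + Y z *m (conjmx (row' i A) *m q)).
Hypothesis gen_continuous : continuous gen.
Hypothesis genZ : forall (r : R) A, gen (RC r *: A) = RC r *: gen A.
Hypothesis genD : forall A B, gen (A + B) = gen A + gen B.

(** The complex and the quaternionic case are treated together: [gen A] is the full matrix generated
    by the freely chosen rows [A], and [z] encodes the coefficients [X z] and [Y z] of a normalised
    relation. The expression is real bilinear in [z] and [B], whence its Lipschitz bounds. *)
Let bil (i : 'I_a) z (B : 'M[R]_(a, n + n)) :=
  reify (X z *m row' i (cplx B) + Y z *m (conjmx (row' i (cplx B)) *m q)).

Let bilB i z z' B B' : bil i z B - bil i z' B' =
  bil i (z - z') B + bil i z' (B - B').
Proof.
rewrite /bil; apply: (etrans (esym (reifyB _ _))).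
apply: (etrans _ (reifyD _ _)); congr (reify _).
rewrite XB YB cplxB; set A := cplx B; set A' := cplx B'.
have -> : row' i (A - A') = row' i A - row' i A' by exact: linearB.
rewrite /conjmx map_mxB; set P := row' i A; set P' := row' i A'.
have h (V : zmodType) (a1 a2 a3 s1 s2 s3 : V) : (a1 + s1) - (a3 + s3) =
    (a1 - a2) + (s1 - s2) + ((a2 - a3) + (s2 - s3)).
  by rewrite [RHS]addrACA [a1 - a2 + _]addrA [s1 - s2 + _]addrA !subrK opprD addrACA.
by rewrite !mulmxBl !mulmxBr; exact: h.
Qed.

Let bil_le i z B : `|bil i z B| <=
  (2 * a.-1%:R + 2 * a.-1%:R * (2 * n%:R * `|reify q|)) * (`|z| * `|B|).
Proof.
rewrite /bil reifyD; apply: le_trans (ler_normD _ _) _; rewrite mulrDl.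
have Brow : `|reify (row' i (cplx B))| <= `|B|.
  by apply: le_trans (reify_row' _ _) _; rewrite cplxK.
apply: lerD; apply: le_trans (reify_mulmx _ _) _; rewrite -!mulrA !ler_wpM2l//.
  exact: ler_pM.
rewrite !mulrA [_ * `|z|]mulrC -!mulrA; apply: ler_pM => //.
apply: le_trans (reify_mulmx _ _) _; rewrite -!mulrA !ler_wpM2l//.
rewrite mulrC; apply: ler_wpM2l => //.
by apply: le_trans (reify_conj _) _.
Qed.

Lemma perturb_pencil (b : bool) (B1 : 'M[C]_(a, n)) (w : 'rV[R]_j -> 'M[C]_(a, n)) :
  (j + b + e < n + n)%N -> (b -> row_free (gen B1)) -> continuous w ->
  (forall v, sphere v -> pencil b (gen (w v)) (gen B1)) ->
  forall eps, 0 < eps ->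
  exists w' : 'rV[R]_j -> 'M[C]_(a, n),
    [/\ continuous w', forall v, sphere v -> w' v = w v
      & forall v, closed_disc v ->
          `|reify (w' v) - reify (w v)| <= eps /\ pencil b (gen (w' v)) (gen B1)].
Proof.
move=> jbe gB1 wc wS eps eps0.
pose good : set 'M[R]_(a, n + n) := [set B | row_free (gen (cplx B))].
have pencilE A : pencil b (gen A) (gen B1) <->
    segment_in good b (reify B1) (reify A).
  have h (t : R) : good ((1 - t) *: reify A + t *: reify B1) =
      row_free (RC (1 - t) *: gen A + RC t *: gen B1).
    by rewrite /good/= cplxD !cplxZ !reifyK genD !genZ.
  by split=> H t /H; rewrite h.
have combD i z B B' : (forall l, l != i -> row l B = row l B') ->
    - bil i z B = - bil i z B'.
  move=> BB'; rewrite /bil (_ : row' i (cplx B) = row' i (cplx B'))//.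
  apply/matrixP => k l; rewrite !mxE.
  have ki : lift i k != i by rewrite eq_sym neq_lift.
  by have /rowP h := BB' _ ki; have := h (lshift n l); have := h (rshift n l); rewrite !mxE => -> ->.
have combL M : exists2 L, 0 <= L & forall i z z' B B', `|z| <= 1 -> `|z'| <= 1 ->
     `|B| <= M -> `|B'| <= M ->
     `|- bil i z B - - bil i z' B'| <= L * (`|z - z'| + `|B - B'|).
  set K := 2 * a.-1%:R + 2 * a.-1%:R * (2 * n%:R * `|reify q|).
  have K0 : 0 <= K by rewrite addr_ge0// !mulr_ge0.
  exists (K * (`|M| + 1)); first by rewrite mulr_ge0// addr_ge0.
  move=> i z z' B B' z1 z1' BM BM'.
  have -> : - bil i z B - - bil i z' B' = - (bil i z B - bil i z' B').
    exact: (esym (opprD _ _)).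
  rewrite normrN bilB; apply: le_trans (ler_normD _ _) _.
  rewrite mulrDr; apply: lerD; apply: le_trans (bil_le _ _ _) _; rewrite -/K -[leRHS]mulrA.
    rewrite ler_wpM2l// mulrC ler_wpM2r//; apply: le_trans BM _.
    by apply: le_trans (ler_norm _) _; rewrite lerDl.
  rewrite ler_wpM2l// ler_wpM2r//; apply: le_trans z1' _; by rewrite lerDr.
have gn B : (forall i z, `|z| <= 1 -> row i B != - bil i z B) -> good B.
  move=> H; apply: contrapT => /negP /gen_relation[i [z [z1 zi]]].
  have /eqP := H i z z1; apply.
  by rewrite -[B in LHS]cplxK row_reify zi reifyN.
have go : open good.
  rewrite openE => B gB; rewrite /interior.
  apply: (@row_free_cvg _ (nbhs B) _ _ _ (fun B => gen (cplx B)) _ _ gB).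
  apply: (@cvg_comp _ _ _ (@cplx R a n) gen); last exact: gen_continuous.
  by apply: (@cvg_cplx _ _ (nbhs B)); exact: cvg_id.
have gs B r : 0 < r -> good B -> good (r *: B).
  move=> r0; rewrite /good/= cplxZ genZ /row_free mxrank_scale_nz//.
  by rewrite -(rmorph0 (real_complex R)) (inj_eq (@complexI _)) gt_eqF.
have rwc : continuous (fun v => reify (w v)).
  by move=> v; apply: (@cvg_reify _ _ (nbhs v)); exact: wc.
have gB1' : b -> good (reify B1) by move=> bT; rewrite /good/= reifyK; exact: gB1.
have wS' v : sphere v -> segment_in good b (reify B1) (reify (w v)).
  by move=> sv; apply/pencilE => //; exact: wS.
have [w' [w'c w'S w'D]] := perturb_rel_sphere combD combL gn go gs gB1' rwc wS' jbe eps0.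
exists (fun v => cplx (w' v)); split.
- by move=> v; apply: (@cvg_cplx _ _ (nbhs v)); exact: w'c.
- by move=> v sv; rewrite w'S// reifyK.
move=> v dv; have [h1 h2] := w'D v dv; rewrite cplxK; split=> //.
by apply/pencilE; rewrite cplxK.
Qed.
End perturbable.

Lemma not_row_free m n (A : 'M[C]_(m, n)) : ~~ row_free A ->
  exists2 u : 'rV[C]_m, u != 0 & u *m A = 0.
Proof.
rewrite -kermx_eq0 => /matrix0Pn[i [k ik]]; exists (row i (kermx A)).
  by apply/eqP => /rowP /(_ k); rewrite [LHS]mxE [RHS]mxE => h; rewrite h eqxx in ik.
by rewrite -row_mul mulmx_ker; apply/rowP => l; rewrite !mxE.
Qed.

(** A relation with one coefficient equal to 1 has [m - 1] further complex coefficients, of real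
    dimension [2 (m - 1)], while a row has real dimension [2 n]. *)
Lemma perturb_pencil_complex (j m n : nat) (b : bool) (B1 : 'M[C]_(m, n))
    (w : 'rV[R]_j -> 'M[C]_(m, n)) :
  (j + b + (m.-1 + m.-1) < n + n)%N -> (b -> row_free B1) -> continuous w ->
  (forall v, sphere v -> pencil b (w v) B1) ->
  forall eps, 0 < eps ->
  exists w' : 'rV[R]_j -> 'M[C]_(m, n),
    [/\ continuous w', forall v, sphere v -> w' v = w v
      & forall v, closed_disc v ->
          `|reify (w' v) - reify (w v)| <= eps /\ pencil b (w' v) B1].
Proof.
apply: (@perturb_pencil j m _ n m (@cplx R 1 m.-1) (fun=> 0) 0 id) => //.
- by move=> z z'; exact: cplxB.
- by move=> z z'; rewrite subrr.
- by move=> z; rewrite cplxK.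
- by move=> z; rewrite -(subrr 0) reifyB subrr normr0.
- move=> A /not_row_free[u u0 uA].
  have [|||i [X [Y [X1 _ Y0 iE]]]] := @normalize_relation R m n A 0 u 0.
  + by left.
  + by rewrite u0.
  + by rewrite mul0mx addr0.
  by exists i, (reify X); rewrite iE reifyK Y0// !mul0mx.
- by move=> A; exact: cvg_id.
Qed.

(** Only [a] rows are free, and a relation normalised over the quaternions has [a - 1] further
    coefficients, of real dimension [4 (a - 1)]. *)
Lemma perturb_pencil_quaternionic (j a n : nat) (b : bool) (q : 'M[C]_n)
    (B1 : 'M[C]_(a, n)) (w : 'rV[R]_j -> 'M[C]_(a, n)) :
  let gen A := col_mx A (conjmx A *m q) in
  conjmx q *m q = -1%:M ->
  (j + b + ((a.-1 + a.-1) + (a.-1 + a.-1)) < n + n)%N ->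
  (b -> row_free (gen B1)) -> continuous w ->
  (forall v, sphere v -> pencil b (gen (w v)) (gen B1)) ->
  forall eps, 0 < eps ->
  exists w' : 'rV[R]_j -> 'M[C]_(a, n),
    [/\ continuous w', forall v, sphere v -> w' v = w v
      & forall v, closed_disc v ->
          `|reify (w' v) - reify (w v)| <= eps /\ pencil b (gen (w' v)) (gen B1)].
Proof.
move=> gen qq.
apply: (@perturb_pencil j a _ n (a + a) (fun z => cplx (lsubmx z))
  (fun z => cplx (rsubmx z)) q gen).
- by move=> z z'; rewrite linearB cplxB.
- by move=> z z'; rewrite linearB cplxB.
- by move=> z; rewrite cplxK lsubmx_norm.
- by move=> z; rewrite cplxK rsubmx_norm.
- move=> A /not_row_free[u u0]; rewrite -[u]hsubmxK mul_row_col => uA.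
  have [||i [X [Y [X1 Y1 _ iE]]]] := @normalize_relation R a n A q _ _ _ _ uA.
  + by right.
  + apply: contraNT u0; rewrite negb_or !negbK => /andP[/eqP x0 /eqP y0].
    by rewrite -[u]hsubmxK x0 y0 row_mx0.
  exists i, (row_mx (reify X) (reify Y)); split; first exact: row_mx_norm.
  by rewrite iE row_mxKl row_mxKr !reifyK.
- move=> A; apply: (@cvg_col_mx _ _ (nbhs A)); first exact: cvg_id.
  apply: (@cvg_mulmx _ _ (nbhs A)); last exact: cvg_cst.
  by apply: (@cvg_conjmx _ _ (nbhs A)); exact: cvg_id.
- move=> r A; rewrite /gen conjmxZ -scalemxAl scale_col_mx; congr (col_mx _ (_ *: _)).
  by apply/eqP; rewrite eq_complex Re_conj Im_conj /= oppr0 !eqxx.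
- by move=> A B; rewrite /gen conjmxD mulmxDl add_col_mx.
Qed.
End injective_pencils.

(** * Extension of injective matrices from the sphere to the disc *)

Section radial_extension.
Variable R : realType.
Local Notation C := R[i].
Local Notation RC x := (real_complex R x).

(** The cone on [u] with apex [u0], linear along the radii. *)
Definition radial j m n (u : 'rV[R]_j -> 'M[C]_(m, n)) (u0 : 'M[C]_(m, n))
  (v : 'rV[R]_j) := RC (nrm v) *: (u (dirv v) - u0) + u0.

Lemma radial_sphere j m n (u : 'rV[R]_j -> 'M[C]_(m, n)) u0 v :
  sphere v -> radial u u0 v = u v.
Proof. by move=> sv; rewrite /radial dirv_id// (sphereE v).1// scale1r subrK. Qed.

Lemma continuous_radial j m n (u : 'rV[R]_j -> 'M[C]_(m, n)) u0 :
  {within @sphere R j, continuous u} -> continuous (radial u u0).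
Proof.
move=> uc; have ruc : {within @sphere R j, continuous (fun v => reify (u v))}.
  apply/subspace_continuousP => v sv.
  apply: (@cvg_reify _ _ (within (@sphere R j) (nbhs v))).
  by move/subspace_continuousP : uc => /(_ v sv).
have h := radial_continuous (w0 := reify u0) ruc.
move=> v; rewrite (_ : radial u u0 =
    fun v => cplx (nrm v *: (reify (u (dirv v)) - reify u0)) + u0); last first.
  by apply/funext => z; rewrite /radial cplxZ -reifyB reifyK.
apply: (@cvg_addmx _ _ (nbhs v)); last exact: cvg_cst.
by apply: (@cvg_cplx _ _ (nbhs v)); exact: h.
Qed.

Lemma pencil0 m n (A B : 'M[C]_(m, n)) : pencil false A B <-> row_free A.
Proof.
split=> [/(_ 0)|fA t]; first by rewrite lexx subr0 scale1r scale0r addr0; exact.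
by rewrite -eq_le => /eqP <-; rewrite subr0 scale1r scale0r addr0.
Qed.

(* Pencils of A *m P v that start at A = w v stay injective for A near w v,
   uniformly on the disc. *)
Lemma pencil_margin j m n k (w : 'rV[R]_j -> 'M[C]_(m, n))
    (P : 'rV[R]_j -> 'M[C]_(n, k)) (B : 'M[C]_(m, k)) :
  continuous w -> continuous P ->
  (forall v, closed_disc v -> pencil true (w v *m P v) B) ->
  exists2 d, 0 < d & forall v A, closed_disc v -> `|reify A - reify (w v)| < d ->
    pencil true (A *m P v) B.
Proof.
move=> wc Pc wP.
pose Xi (x : 'rV[R]_j * R * 'M[R]_(m, n + n)) :=
  RC (1 - x.1.2) *: ((w x.1.1 + cplx x.2) *m P x.1.1) + RC x.1.2 *: B.
have Xic : continuous Xi.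
  move=> x.
  have c1 : x0.1.1 @[x0 --> nbhs x] --> x.1.1.
    by apply: (@cvg_comp _ _ _ fst fst _ _ _ cvg_fst); exact: cvg_fst.
  have c2 : x0.1.2 @[x0 --> nbhs x] --> x.1.2.
    by apply: (@cvg_comp _ _ _ fst snd _ _ _ cvg_fst); exact: cvg_snd.
  apply: (@cvg_addmx _ _ (nbhs x)); apply: (@cvg_scalemx _ _ (nbhs x)).
  - by apply: (@cvg_RC _ _ (nbhs x)); apply: cvgB => //; exact: cvg_cst.
  - apply: (@cvg_mulmx _ _ (nbhs x)); last exact: cvg_comp c1 (Pc _).
    apply: (@cvg_addmx _ _ (nbhs x)); first exact: cvg_comp c1 (wc _).
    by apply: (@cvg_cplx _ _ (nbhs x)); exact: cvg_snd.
  - exact: (@cvg_RC _ _ (nbhs x)).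
  - exact: cvg_cst.
have cK : compact (@closed_disc R j `*` (`[0, 1]%classic : set R)).
  by apply: compact_setX; [exact: compact_disc|exact: segment_compact].
move/compact_near_coveringP : cK => /(_ R 0^'+ (fun d vt => forall A,
   `|reify A - reify (w vt.1)| < d ->
   row_free (RC (1 - vt.2) *: (A *m P vt.1) + RC vt.2 *: B))) [].
  move=> [v t] [/= dv]; rewrite in_itv/= => t01.
  have : nbhs (((v, t), 0) : 'rV[R]_j * R * 'M[R]_(m, n + n))
      (Xi @^-1` [set A | row_free A]).
    apply: Xic; apply: (@row_free_cvg _ _ (nbhs _) _ _ _ (fun A => A)); first exact: cvg_id.
    rewrite /Xi/= -(subrr (reify 0)) -reifyB reifyK subr0 addr0.
    by apply: wP => //.
  move=> /nbhs_ballP [e /= e0 eP].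
  exists (ball (v, t) e, [set d | d < e]).
    by split; [exact: nbhsx_ballx|exact: nbhs_right_lt].
  move=> [[v' t'] d] [/= vtb de] A Ad.
  have := eP ((v', t'), reify A - reify (w v')).
  rewrite /Xi/= cplxB !reifyK [w _ + _]addrC subrK; apply.
  split=> //=; rewrite -ball_normE/= sub0r normrN; exact: lt_trans Ad de.
move=> d1 /= d10 dP; exists (d1 / 2); first by rewrite divr_gt0.
move=> v A dv Av t t01; have dd1 : d1 / 2 < d1 by rewrite ltr_pdivrMr// ltr_pMr// ltr1n.
have d20 : 0 < d1 / 2 by rewrite divr_gt0.
have := dP (d1 / 2); rewrite /= sub0r normrN gtr0_norm// => /(_ dd1 d20 (v, t)) h.
by apply: (h _ A) => //=; split=> //=; rewrite in_itv.
Qed.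

(** [St] stands for the compatibility with Theta imposed over fixed cells; over free cells it is
    vacuous. *)
Definition perturbable j m n (St : 'M[C]_(m, n) -> Prop) (b : bool) B :=
  forall w : 'rV[R]_j -> 'M[C]_(m, n), continuous w -> (forall v, St (w v)) ->
  (forall v, sphere v -> pencil b (w v) B) ->
  forall eps, 0 < eps -> exists w' : 'rV[R]_j -> 'M[C]_(m, n),
    [/\ continuous w', forall v, St (w' v), forall v, sphere v -> w' v = w v
      & forall v, closed_disc v ->
          `|reify (w' v) - reify (w v)| <= eps /\ pencil b (w' v) B].

(** The cone with apex 0 extends [u] and keeps [St]. It may fail to be injective inside, but
    [perturbable] asks for injectivity on the sphere alone. *)
Lemma extend_row_free j m n (St : 'M[C]_(m, n) -> Prop) :
  perturbable j St false 0 -> St 0 ->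
  (forall (r : R) A, St A -> St (RC r *: A)) ->
  forall u : 'rV[R]_j -> 'M[C]_(m, n),
  {within @sphere R j, continuous u} ->
  (forall v, sphere v -> St (u v) /\ row_free (u v)) ->
  exists w, [/\ continuous w, forall v, sphere v -> w v = u v
    & forall v, closed_disc v -> St (w v) /\ row_free (w v)].
Proof.
move=> pert St0 StZ u uc uS.
have rc := continuous_radial (u0 := 0) uc.
have Str v : St (radial u 0 v).
  rewrite /radial subr0 addr0; have [->|v0] := eqVneq v 0.
    by rewrite nrm0 rmorph0 scale0r.
  by apply: StZ; case: (uS _ (dirv_sphere v0)).
have pS v : sphere v -> pencil false (radial u 0 v) 0.
  by move=> sv; apply/pencil0; rewrite radial_sphere//; case: (uS v sv).
have [w [wc Stw wS wD]] := pert _ rc Str pS 1 ltr01.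
exists w; split=> // v sv; first by rewrite wS// radial_sphere.
by split=> //; case: (wD v sv) => _ /pencil0.
Qed.

(** Two conditions from a single use of general position. After the change of coordinates by [P],
    the cone on [u *m P] with apex [B'] satisfies the second condition on the whole disc. A
    perturbation below the margin of this open condition then achieves the first. *)
Lemma extend_pencil j m n (St St' : 'M[C]_(m, n) -> Prop) (B B' : 'M[C]_(m, n))
    (P Q : 'rV[R]_j -> 'M[C]_n) :
  perturbable j St true B -> continuous P -> continuous Q ->
  (forall v, Q v *m P v = 1%:M) ->
  (forall v A, St A -> St' (A *m P v)) ->
  (forall v A, St' A -> St (A *m Q v)) ->
  (forall (r s : R) A A', St' A -> St' A' -> St' (RC r *: A + RC s *: A')) ->
  row_free B' -> St' B' ->
  forall u : 'rV[R]_j -> 'M[C]_(m, n),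
  {within @sphere R j, continuous u} ->
  (forall v, sphere v -> [/\ St (u v), pencil true (u v) B
    & pencil true (u v *m P v) B']) ->
  exists w, [/\ continuous w, forall v, sphere v -> w v = u v
    & forall v, closed_disc v -> [/\ St (w v), pencil true (w v) B
       & pencil true (w v *m P v) B']].
Proof.
move=> pert Pc Qc QP StP StQ StL fB' StB' u uc uS.
have PQ v : P v *m Q v = 1%:M by apply: mulmx1C.
pose w1 := radial (fun v => u v *m P v) B'.
have w1c : continuous w1.
  apply: continuous_radial; apply/subspace_continuousP => v sv.
  apply: (@cvg_mulmx _ _ (within (@sphere R j) (nbhs v))).
    by move/subspace_continuousP : uc => /(_ v sv).
  by apply: cvg_within_filter; exact: Pc.
have w1E v : w1 v = RC (nrm v) *: (u (dirv v) *m P (dirv v)) + RC (1 - nrm v) *: B'.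
  by rewrite /w1 /radial scalerBr rmorphB/= scalerBl scale1r -addrA [- _ + _]addrC.
have St'w1 v : St' (w1 v).
  rewrite w1E; have [->|v0] := eqVneq v 0.
    rewrite nrm0 subr0 (_ : _ + _ = RC 1 *: B' + RC 0 *: B'); first exact: StL.
    by rewrite rmorph0 rmorph1 !scale0r add0r addr0.
  by apply: StL => //; apply: StP; case: (uS _ (dirv_sphere v0)).
(* A point of the cone lies on the given segment from [u *m P] to [B'], so its own segment to [B']
   is a part of that one. *)
have w1p v : closed_disc v -> pencil true (w1 v) B'.
  move=> /closed_discE v1 t /andP[t0 t1].
  have -> : RC (1 - t) *: w1 v + RC t *: B' =
     RC (1 - (1 - (1 - t) * nrm v)) *: (u (dirv v) *m P (dirv v)) +
     RC (1 - (1 - t) * nrm v) *: B'.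
    rewrite w1E scalerDr !scalerA -addrA -scalerDl -!rmorphM -rmorphD/=.
    by congr (RC _ *: _ + RC _ *: _); ring.
  have [v0|v0] := eqVneq v 0.
    by rewrite v0 nrm0 mulr0 subr0 subrr rmorph0 scale0r add0r scale1r.
  case: (uS _ (dirv_sphere v0)) => _ _; apply; have := nrm_ge0 v => n0.
  have t1' : t <= 1 by [].
  have h1 : 0 <= (1 - t) * nrm v by rewrite mulr_ge0// subr_ge0.
  have h2 : (1 - t) * nrm v <= nrm v by rewrite ler_piMl// lerBlDr lerDl.
  apply/andP; split; first by lra.
  by rewrite /= lerBlDr lerDl.
pose w0 v := w1 v *m Q v.
have w0P v : w0 v *m P v = w1 v by rewrite /w0 -mulmxA QP mulmx1.
have w0c : continuous w0.
  by move=> v; apply: (@cvg_mulmx _ _ (nbhs v)); [exact: w1c|exact: Qc].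
have w0S v : sphere v -> w0 v = u v.
  by move=> sv; rewrite /w0 /w1 radial_sphere// -mulmxA PQ mulmx1.
have w0d v : closed_disc v -> pencil true (w0 v *m P v) B'.
  by move=> dv; rewrite w0P; exact: w1p.
have [d d0 dP] := pencil_margin w0c Pc w0d.
have Stw0 v : St (w0 v) by apply: StQ.
have w0p v : sphere v -> pencil true (w0 v) B.
  by move=> sv; rewrite w0S//; case: (uS v sv).
have d20 : 0 < d / 2 by rewrite divr_gt0.
have [w [wc Stw wS wD]] := pert _ w0c Stw0 w0p _ d20.
exists w; split=> // v dv; first by rewrite wS// w0S.
have [w1' w2] := wD v dv; split=> //; apply: dP => //; apply: le_lt_trans w1' _.
by rewrite ltr_pdivrMr// ltr_pMr// ltr1n.
Qed.

(** The standard quaternionic structure. The equation [conjmx A *m q = Jmx a *m A] determines the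
    lower half of [A] as [conjmx] of its upper half times [q]. *)
Definition Jmx a : 'M[C]_(a + a) := block_mx 0 1%:M (- 1%:M) 0.

Lemma perturbable_complex j m n (b : bool) (B : 'M[C]_(m, n)) :
  (j + b + (m.-1 + m.-1) < n + n)%N -> (b -> row_free B) ->
  @perturbable j m n (fun=> True) b B.
Proof.
move=> jb fB w wc _ wS eps eps0.
by have [w' [? ? ?]] := perturb_pencil_complex jb fB wc wS eps0; exists w'.
Qed.

Lemma perturbable_quaternionic j a n (b : bool) (q : 'M[C]_n) (B : 'M[C]_(a + a, n)) :
  (j + b + ((a.-1 + a.-1) + (a.-1 + a.-1)) < n + n)%N ->
  conjmx q *m q = - 1%:M -> (b -> row_free B) ->
  conjmx B *m q = Jmx a *m B ->
  perturbable j (fun A => conjmx A *m q = Jmx a *m A) b B.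
Proof.
move=> jb qq fB StB w wc Stw wS eps eps0.
have JE (A : 'M[C]_(a + a, n)) : Jmx a *m A = col_mx (dsubmx A) (- usubmx A).
  rewrite -[A in LHS]vsubmxK /Jmx mul_block_col !mul0mx !mul1mx mulNmx mul1mx.
  by rewrite addr0 add0r.
pose gen (A : 'M[C]_(a, n)) := col_mx A (conjmx A *m q).
have genE A : conjmx A *m q = Jmx a *m A -> gen (usubmx A) = A.
  rewrite JE -[A in conjmx A]vsubmxK /conjmx map_col_mx mul_col_mx.
  by move=> /eq_col_mx[h _]; rewrite /gen h vsubmxK.
have genSt A : conjmx (gen A) *m q = Jmx a *m gen A.
  rewrite JE /gen col_mxKu col_mxKd /conjmx map_col_mx mul_col_mx; congr col_mx.
  by rewrite -/(conjmx _) conjmxM conjmxK -mulmxA qq mulmxN mulmx1.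
have wc' : continuous (fun v => usubmx (w v)).
  by move=> v; apply: (@cvg_usubmx _ _ (nbhs v)); exact: wc.
have fB' : b -> row_free (gen (usubmx B)) by rewrite genE.
have wS' v : sphere v -> pencil b (gen (usubmx (w v))) (gen (usubmx B)).
  by move=> sv; rewrite !genE//; exact: wS.
(* Bounds the growth of a difference when its upper half is completed to the whole matrix. *)
pose K := 1 + 2 * n%:R * `|reify q|.
have K1 : 1 <= K by rewrite lerDl !mulr_ge0.
have K0 : 0 < K by apply: lt_le_trans K1.
have e20 : 0 < eps / K by rewrite divr_gt0.
have [w' [w'c w'S w'D]] := perturb_pencil_quaternionic qq jb fB' wc' wS' e20.
exists (fun v => gen (w' v)); split.
- move=> v; apply: (@cvg_col_mx _ _ (nbhs v)); first exact: w'c.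
  apply: (@cvg_mulmx _ _ (nbhs v)); last exact: cvg_cst.
  by apply: (@cvg_conjmx _ _ (nbhs v)); exact: w'c.
- by move=> v; exact: genSt.
- by move=> v sv; rewrite w'S// genE.
move=> v dv; have [h1 h2] := w'D v dv; have h3 : pencil b (gen (w' v)) (gen (usubmx B)) by [].
rewrite (genE B)// in h3; split=> //.
rewrite -reifyB -(genE (w v))// /gen opp_col_mx add_col_mx -mulmxBl.
rewrite (_ : conjmx _ - conjmx _ = conjmx (w' v - usubmx (w v))); last first.
  by rewrite conjmxD conjmxN.
set D := w' v - _ in h1 *; rewrite -reifyB in h1.
have D1 : K * `|reify D| <= eps by rewrite mulrC -ler_pdivlMr.
have D2 : `|reify D| <= eps by apply: le_trans D1; exact: ler_peMl.
have D3 : `|reify (conjmx D *m q)| <= eps.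
  apply: le_trans D1; apply: le_trans (reify_mulmx _ _) _.
  apply: le_trans (_ : 2 * n%:R * `|reify D| * `|reify q| <= _).
    by rewrite ler_wpM2r// ler_wpM2l ?mulr_ge0// reify_conj.
  by rewrite mulrAC ler_wpM2r// lerDr.
apply: reify_le => [|i k]; first exact: ltW.
rewrite mxE; case: (fintype.split i) => l; split.
- exact: le_trans (reify_geRe _ _ _) D2.
- exact: le_trans (reify_geIm _ _ _) D2.
- exact: le_trans (reify_geRe _ _ _) D3.
- exact: le_trans (reify_geIm _ _ _) D3.
Qed.

End radial_extension.

(** * Sections over a CW-complex *)

Section cw_sections.
Variables (R : realType) (X : involutive_space) (cw : Z2_CW R X) (Y : set X).
Variables (M : Type) (m0 : M) (OO : set (set (X * M))).
Variables (sg : X -> M -> M) (P : X -> M -> Prop).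

(* The sets in OO generate the topology of the space X * M of all values, which is
   not the product topology when M is a fibre in non-continuous coordinates. *)
Definition continuous_section (T : topologicalType) (A : set T) (c : T -> X)
    (d : T -> M) : Prop :=
  forall B, OO B -> open ([set z | B (c z, d z)] : set (subspace A)).

Definition cell n : Type := (free_cell cw n * bool + fixed_cell cw n)%type.

Hypothesis oY : open Y.
Hypothesis cY : closed Y.
Hypothesis tauY : forall x, Y x -> Y (tau x).

(** A characteristic map is continuous on its disc only; after the retraction it becomes continuous
    on the whole space, as [extends_over_disc] demands. *)
Lemma cell_retr_continuous n (e : cell n) :
  continuous (fun v => cw_map e (retr v)).
Proof.
move=> v; have ec := (subspace_continuousP _ _).1 (@cw_map_continuous _ _ cw n e).
apply: (cvg_comp (@retr R n) (cw_map e) _ (ec _ (retr_disc v))) => A; rewrite /within/= => nA.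
apply: (@filterS _ (nbhs v) _ _ _ _ (@retr_continuous R n v _ nA)) => z /=.
by apply; exact: retr_disc.
Qed.

(** A straight path in the disc cannot leave a subset that is open and closed. *)
Lemma cell_connected n (e : cell n) (v w : 'rV[R]_n) :
  closed_disc v -> closed_disc w -> Y (cw_map e v) -> Y (cw_map e w).
Proof.
move=> dv dw Yv; pose g (t : R) := cw_map e (retr (v + t *: (w - v))).
have gc : continuous g.
  move=> t; apply: (cvg_comp (fun t : R => v + t *: (w - v)) (fun z => cw_map e (retr z))).
    apply: cvgD; first exact: cvg_cst.
    by apply: cvgZr_tmp; exact: cvg_id.
  exact: cell_retr_continuous.
have h : `[0, 1]%classic `&` g @^-1` Y = `[0, 1]%classic.
  apply: (@segment_connected R 0 1).
  - exists 0; split; first by rewrite /= in_itv/= lexx ler01.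
    by rewrite /g/= scale0r addr0 retr_id.
  - exists (g @^-1` Y) => //; exact: open_comp.
  - exists (g @^-1` Y) => //; exact: closed_comp.
have : (`[0, 1]%classic `&` g @^-1` Y) 1 by rewrite h /= in_itv/= lexx ler01.
by move=> [_]; rewrite /g/= scale1r addrC subrK retr_id.
Qed.

Hypothesis sgP : forall x d, Y x -> P x d ->
  P (tau x) (sg x d) /\ sg (tau x) (sg x d) = d.
Hypothesis sgC : forall n (c : 'rV[R]_n -> X) d, continuous c ->
  (forall v, Y (c v)) ->
  continuous_section (@closed_disc R n) c d ->
  continuous_section (@closed_disc R n) (tau (i:=X) \o c) (fun v => sg (c v) (d v)).

(** [fx] marks a fixed cell: tau is the identity along [c], and the values have to be invariant
    under [sg]. *)
Definition extends_over_disc n (fx : bool) : Prop :=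
  forall (c : 'rV[R]_n -> X) d, continuous c -> (forall v, Y (c v)) ->
  (fx -> forall v, tau (c v) = c v) ->
  continuous_section (@sphere R n) c d ->
  (forall v, sphere v -> P (c v) (d v) /\ (fx -> sg (c v) (d v) = d v)) ->
  exists d', [/\ continuous_section (@closed_disc R n) c d',
    forall v, closed_disc v -> P (c v) (d' v) /\ (fx -> sg (c v) (d' v) = d' v)
    & forall v, sphere v -> d' v = d v].

Hypothesis ext_free : forall n, free_cell cw n -> extends_over_disc n false.
Hypothesis ext_fixed : forall n, fixed_cell cw n -> extends_over_disc n true.

Definition good_section (A : set X) (s : X -> M) : Prop :=
  (forall B, OO B -> open ([set x | Y x /\ B (x, s x)] : set (subspace A))) /\
  forall x, Y x -> A x -> P x (s x) /\ s (tau x) = sg x (s x).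

(** On a free cell the extension is chosen on the copy with index [false] and carried to the other
    copy by [sg]; [sgP] gives the way back. On a fixed cell the extension itself has to be
    invariant. *)
Lemma cell_extension n (s : X -> M) : good_section (cw_skel cw n) s ->
  exists D : cell n -> 'rV[R]_n -> M, forall e : cell n, Y (cw_map e 0) ->
    [/\ continuous_section (@closed_disc R n) (cw_map e) (D e),
      forall v, closed_disc v -> P (cw_map e v) (D e v),
      forall v, sphere v -> D e v = s (cw_map e v)
      & forall v, closed_disc v -> D (flip_cell e) v = sg (cw_map e v) (D e v)].
Proof.
move=> [so sP].
have d0 : closed_disc (0 : 'rV[R]_n) by apply/closed_discE; rewrite nrm0.
have cs_eq (T : topologicalType) (A : set T) (c c' : T -> X) (d d' : T -> M) :
    (forall z, A z -> c z = c' z /\ d z = d' z) ->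
    continuous_section A c d -> continuous_section A c' d'.
  move=> cc' cd B OB; have /open_subspaceP[V oV VA] := cd B OB.
  apply/open_subspaceP; exists V => //; rewrite VA.
  by apply/seteqP; split=> z /= [Bz Az]; have [E1 E2] := cc' z Az;
    rewrite ?E1 ?E2 in Bz *; split; rewrite // -?E1 -?E2.
have extD (e : cell n) (fx : bool) : Y (cw_map e 0) -> extends_over_disc n fx ->
    (fx -> flip_cell e = e) ->
    exists d, [/\ continuous_section (@closed_disc R n) (cw_map e) d,
      forall v, closed_disc v -> P (cw_map e v) (d v) /\
         (fx -> sg (cw_map e v) (d v) = d v)
      & forall v, sphere v -> d v = s (cw_map e v)].
  move=> Ye ext fe.
  have Ye' v : closed_disc v -> Y (cw_map e v) by move=> dv; exact: cell_connected Ye.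
  have [||fxT v|B OB|v sv|d' [d'c d'P d'S]] :=
      ext (fun v => cw_map e (retr v)) (fun v => s (cw_map e (retr v))).
  - exact: cell_retr_continuous.
  - by move=> v; apply: Ye'; exact: retr_disc.
  - by rewrite -cw_map_equivariant ?fe//; exact: retr_disc.
  - have /open_subspaceP[V oV VA] := so B OB.
    apply/open_subspaceP; exists ((fun v => cw_map e (retr v)) @^-1` V).
      by apply: open_comp => // v _; exact: cell_retr_continuous.
    apply/seteqP; split=> v /= [Vv sv]; split=> //.
      have : (V `&` cw_skel cw n) (cw_map e (retr v)).
        split=> //; rewrite retr_id; last exact: sphere_disc.
        exact: cw_map_sphere.
      by rewrite VA => -[[]].
    have : ([set x | Y x /\ B (x, s x)] `&` cw_skel cw n) (cw_map e (retr v)).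
      split; first by split=> //; apply: Ye'; exact: retr_disc.
      rewrite retr_id; last exact: sphere_disc.
      exact: cw_map_sphere.
    by rewrite -VA => -[].
  - have dv := sphere_disc sv; rewrite retr_id//.
    have [Psv sgs] := sP _ (Ye' _ dv) (cw_map_sphere e sv); split=> // fxT.
    by rewrite -sgs -cw_map_equivariant// fe.
  exists d'; split=> [|v dv|v sv].
  - by apply: cs_eq d'c => z dz; rewrite retr_id.
  - by have [] := d'P v dv; rewrite retr_id.
  by rewrite d'S// retr_id//; exact: sphere_disc.
have freeD (c : free_cell cw n) : exists d, Y (cw_map (inl (c, false) : cell n) 0) ->
    [/\ continuous_section (@closed_disc R n) (cw_map (inl (c, false) : cell n)) d,
      forall v, closed_disc v -> P (cw_map (inl (c, false) : cell n) v) (d v)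
      & forall v, sphere v -> d v = s (cw_map (inl (c, false) : cell n) v)].
  have [Yc|] := pselect (Y (cw_map (inl (c, false) : cell n) 0)); last by exists (fun=> m0).
  have [//|d [h1 h2 h3]] := extD _ false Yc (ext_free c).
  by exists d => _; split=> // v dv; case: (h2 v dv).
have fixD (c : fixed_cell cw n) : exists d, Y (cw_map (inr c : cell n) 0) ->
    [/\ continuous_section (@closed_disc R n) (cw_map (inr c : cell n)) d,
      forall v, closed_disc v -> P (cw_map (inr c : cell n) v) (d v) /\
         sg (cw_map (inr c : cell n) v) (d v) = d v
      & forall v, sphere v -> d v = s (cw_map (inr c : cell n) v)].
  have [Yc|] := pselect (Y (cw_map (inr c : cell n) 0)); last by exists (fun=> m0).
  have [//|d [h1 h2 h3]] := extD _ true Yc (ext_fixed c).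
  by exists d => _; split=> // v dv; have [? ?] := h2 v dv; split=> //; auto.
have [D1 D1P] := choice freeD; have [D2 D2P] := choice fixD.
pose D (e : cell n) v := match e with
  | inl (c, false) => D1 c v
  | inl (c, true) => sg (cw_map (inl (c, false) : cell n) v) (D1 c v)
  | inr c => D2 c v end.
exists D => -[[c b]|c] Ye; last first.
  have [h1 h2 h3] := D2P c Ye; split=> //=; first by move=> v /h2[].
  by move=> v /h2[].
case: b Ye => Ye; last first.
  have [h1 h2 h3] := D1P c Ye; split=> //=.
have eqv v : closed_disc v -> cw_map (inl (c, true) : cell n) v =
    tau (cw_map (inl (c, false) : cell n) v).
  by move=> dv; rewrite -cw_map_equivariant.
have Ye' : Y (cw_map (inl (c, false) : cell n) 0).
  by rewrite -[cw_map _ _]tau_involutive -eqv//; exact: tauY.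
have Yv v : closed_disc v -> Y (cw_map (inl (c, false) : cell n) v).
  by move=> dv; exact: cell_connected Ye'.
have [h1 h2 h3] := D1P c Ye'; split=> /=.
- apply: (@cs_eq _ _ (tau (i:=X) \o (fun v => cw_map (inl (c, false) : cell n) (retr v))) _
     (fun v => sg (cw_map (inl (c, false) : cell n) (retr v)) (D1 c v))).
    by move=> z dz /=; rewrite retr_id// eqv.
  apply: sgC => [|v|].
  + exact: cell_retr_continuous.
  + by apply: Yv; exact: retr_disc.
  by apply: cs_eq h1 => z dz; rewrite retr_id.
- by move=> v dv; rewrite eqv//; case: (sgP (Yv v dv) (h2 v dv)).
- move=> v sv; have dv := sphere_disc sv.
  by rewrite h3// eqv//; case: (sP _ (Yv v dv) (cw_map_sphere _ sv)) => _ ->.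
by move=> v dv; rewrite eqv//; case: (sgP (Yv v dv) (h2 v dv)) => _ ->.
Qed.

Lemma skel_tau n x : cw_skel cw n x -> cw_skel cw n (tau x).
Proof.
elim: n x => [|n IH] x; first by rewrite cw_skel0.
rewrite !cw_skelS => -[/IH|[e _ [v dv <-]]]; first by left.
by right; exists (flip_cell e) => //; exists v => //; rewrite cw_map_equivariant.
Qed.

Lemma skeleton_extension n s : good_section (cw_skel cw n) s ->
  exists s', good_section (cw_skel cw n.+1) s'.
Proof.
move=> gs; have [D DP] := cell_extension gs; have [so sP] := gs.
have d0 : closed_disc (0 : 'rV[R]_n) by apply/closed_discE; rewrite nrm0.
(* The old skeleton and the open cells are disjoint, so at most one prescription applies at each
   point. *)
have exm x : exists m, (cw_skel cw n x -> m = s x) /\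
    forall (e : cell n) v, open_disc v -> cw_map e v = x -> m = D e v.
  have [skx|skx] := pselect (cw_skel cw n x).
    by exists (s x); split=> // e v ov ex; case: (@cw_map_open_disc _ _ cw n e v ov); rewrite ex.
  have [[e [v [ov ex]]]|noex] := pselect (exists (e : cell n) v, open_disc v /\ cw_map e v = x).
    exists (D e v); split=> // e' v' ov' ex'.
    by have [-> ->] := cw_map_inj ov ov' (etrans ex (esym ex')).
  by exists (s x); split=> // e v ov ex; case: noex; exists e, v.
have [s' s'P] := choice exm.
have s'D (e : cell n) v : Y (cw_map e 0) -> closed_disc v -> s' (cw_map e v) = D e v.
  move=> Ye dv; have [_ _ DS _] := DP e Ye.
  move: (dv) => /closed_discE; rewrite le_eqVlt => /orP[/eqP v1|v1].
    have sv : sphere v by apply/sphereE.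
    by rewrite (s'P _).1 ?DS//; exact: cw_map_sphere.
  by apply: (s'P _).2 => //; exact/open_discE.
exists s'; split=> [B OB|x Yx].
  apply/cw_open_skelS; split.
    have /open_subspaceP[V oV VA] := so B OB.
    apply/open_subspaceP; exists V => //; rewrite VA.
    by apply/seteqP; split=> z /= [[Yz Bz] Az]; split=> //; split=> //;
      move: Bz; rewrite (s'P z).1.
  move=> e; have [Ye|Ye] := pselect (Y (cw_map e 0)).
    have [Dc _ _ _] := DP e Ye.
    have /open_subspaceP[V oV VA] := Dc B OB.
    apply/open_subspaceP; exists V => //; rewrite VA.
    apply/seteqP; split=> z /= [Bz dz]; split=> //; last first.
      by rewrite -s'D//; case: Bz.
    by split; [exact: cell_connected Ye|rewrite s'D].
  apply/open_subspaceP; exists set0; first exact: open0.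
  apply/seteqP; split=> z /= [] // [Yz _] dz; case: Ye.
  exact: cell_connected Yz.
rewrite cw_skelS => -[skx|[e _ [v dv ex]]].
  have [h1 h2] := sP x Yx skx; rewrite (s'P x).1//.
  have skt := skel_tau skx.
  by rewrite (s'P (tau x)).1.
subst x; have Ye : Y (cw_map e 0) by exact: cell_connected Yx.
have [_ DPe _ Df] := DP e Ye; rewrite s'D//; split; first exact: DPe.
rewrite -cw_map_equivariant// s'D ?Df//.
by rewrite cw_map_equivariant//; exact: tauY.
Qed.

(** The skeleta are constant from [N] on, so finitely many extension steps reach all of [X]. *)
Lemma cw_section N : (forall n, (N <= n)%N -> cell n -> False) ->
  exists s : X -> M, (forall B, OO B -> open [set x | Y x /\ B (x, s x)]) /\
    forall x, Y x -> P x (s x) /\ s (tau x) = sg x (s x).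
Proof.
move=> noC; have sk n : exists s, good_section (cw_skel cw n) s.
  elim: n => [|n [s gs]]; last exact: skeleton_extension gs.
  exists (fun=> m0); split=> [B OB|x _]; rewrite cw_skel0//.
  by apply/open_subspaceP; exists set0; [exact: open0|rewrite !setI0].
have skN : cw_skel cw N = setT.
  have skNn n : cw_skel cw n `<=` cw_skel cw N.
    have up k l : (k <= l)%N -> cw_skel cw k `<=` cw_skel cw l.
      move=> /subnK <-; elim: (l - k)%N => [|i IH] //= x skx.
      by rewrite addSn cw_skelS; left; exact: IH.
    case: (leqP n N) => [/up//|/ltnW/subnK <-].
    elim: (n - N)%N => [//|i IH] x; rewrite addSn cw_skelS => -[/IH//|[e _ _]].
    by case: (noC _ _ e); exact: leq_addl.
  apply/seteqP; split=> // x _.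
  have : (\bigcup_n cw_skel cw n) x by rewrite cw_skel_cover.
  by move=> [n _]; exact: skNn.
have [s []] := sk N; rewrite skN => so sP; exists s; split=> [B OB|x Yx]; last exact: sP.
have /open_subspaceP[V oV VT] := so B OB.
by rewrite !setIT in VT; rewrite -VT.
Qed.
End cw_sections.

(** * Bundles in fibrewise coordinates *)

Section matrix_bundles.
Variables (R : realType) (X : involutive_space).
Local Notation C := R[i].

Lemma open_subspace_within (T : topologicalType) (A U : set T) :
  open (U : set (subspace A)) <-> forall z, A z -> U z -> within A (nbhs z) U.
Proof.
rewrite openE; split=> [oU z Az Uz|h z Uz].
  by rewrite (nbhs_subspace_in Az); exact: oU.
suff : nbhs_subspace (A := A) z U by [].
have [Az|nAz] := pselect (A z); first by rewrite -nbhs_subspace_in//; exact: h.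
by rewrite -nbhs_subspace_out// => y ->.
Qed.

Lemma cvg_near_eq (T : Type) (F : set_system T) (FF : Filter F)
    (U : topologicalType) (f g : T -> U) (l : U) :
  (\forall z \near F, f z = g z) -> g @ F --> l -> f @ F --> l.
Proof.
move=> fg gl; apply: cvg_trans gl; apply: near_eq_cvg.
by apply: filterS fg => z ->.
Qed.

(* A "quaternionic" bundle of rank m over Y whose fibres have been identified
   with C^m one by one. The matrix gauge x y is the frame at y of a local
   trivialisation over nb x, and Theta maps v over y to (conj v) theta(y) over
   tau y. *)
Record mbundle (Y : set X) (m : nat) := MBundle {
  nb : X -> set X;
  gauge : X -> X -> 'M[C]_m;
  theta : X -> 'M[C]_m;
  nb_open : forall x, Y x -> open (nb x);
  nb_self : forall x, Y x -> nb x x;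
  nb_sub : forall x, Y x -> nb x `<=` Y;
  gauge_unit : forall x y, Y x -> nb x y -> gauge x y \in unitmx;
  gauge_cvg : forall x x' y, Y x -> Y x' -> nb x y -> nb x' y ->
    gauge x z *m invmx (gauge x' z) @[z --> y] --> gauge x y *m invmx (gauge x' y);
  theta_sq : forall x, Y x -> conjmx (theta x) *m theta (tau x) = - 1%:M;
  theta_cvg : forall x x' y, Y x -> Y x' -> nb x y -> nb x' (tau y) ->
    conjmx (gauge x z) *m theta z *m invmx (gauge x' (tau z)) @[z --> y] -->
      conjmx (gauge x y) *m theta y *m invmx (gauge x' (tau y)) }.

Lemma conjmx1 m : conjmx 1%:M = 1%:M :> 'M[C]_m.
Proof. exact: map_mx1. Qed.

Lemma conjmx_unit m (A : 'M[C]_m) : (conjmx A \in unitmx) = (A \in unitmx).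
Proof. exact: map_unitmx. Qed.

Lemma conjmxV m (A : 'M[C]_m) : conjmx (invmx A) = invmx (conjmx A).
Proof. exact: map_invmx. Qed.

Lemma invmxM m (A B : 'M[C]_m) : A \in unitmx -> B \in unitmx ->
  invmx (A *m B) = invmx B *m invmx A.
Proof.
move=> uA uB; have uAB : A *m B \in unitmx by rewrite unitmx_mul uA.
by rewrite -[RHS]mulmx1 -(mulmxV uAB) !mulmxA mulmxKV// mulVmx// mul1mx.
Qed.

(** The conjugate transpose, as opposed to the adjugate [\adj]. *)
Definition adj m n (A : 'M[C]_(m, n)) : 'M[C]_(n, m) := (conjmx A)^T.

Lemma adjM m n p (A : 'M[C]_(m, n)) (B : 'M[C]_(n, p)) :
  adj (A *m B) = adj B *m adj A.
Proof. by rewrite /adj conjmxM trmx_mul. Qed.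

Lemma adjK m n : cancel (@adj m n) (@adj n m).
Proof. by move=> A; rewrite /adj -[A in RHS]conjmxK /conjmx -map_trmx trmxK. Qed.

Lemma adj_unit m (A : 'M[C]_m) : (adj A \in unitmx) = (A \in unitmx).
Proof. by rewrite /adj unitmx_tr conjmx_unit. Qed.

Lemma adjV m (A : 'M[C]_m) : adj (invmx A) = invmx (adj A).
Proof. by rewrite /adj conjmxV trmx_inv. Qed.

Lemma conj_adj m n (A : 'M[C]_(m, n)) : conjmx (adj A) = adj (conjmx A).
Proof. by rewrite /adj /conjmx -!map_trmx. Qed.

Lemma adj1 m : adj 1%:M = 1%:M :> 'M[C]_m.
Proof. by rewrite /adj conjmx1 trmx1. Qed.

Lemma adjN m n (A : 'M[C]_(m, n)) : adj (- A) = - adj A.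
Proof. by rewrite /adj conjmxN linearN. Qed.

Lemma adjD m n (A B : 'M[C]_(m, n)) : adj (A + B) = adj A + adj B.
Proof. by rewrite /adj conjmxD linearD. Qed.

Lemma cvg_adjoint (T : Type) (F : set_system T) (FF : Filter F) m n
    (f : T -> 'M[C]_(m, n)) (A : 'M[C]_(m, n)) :
  f @ F --> A -> adj (f t) @[t --> F] --> adj A.
Proof. by move=> fA; apply: cvg_trmx; exact: cvg_conjmx. Qed.

Section theory.
Variables (Y : set X) (m : nat) (E : mbundle Y m).
Hypothesis tauY : forall x, Y x -> Y (tau x).

Lemma theta_unit x : Y x -> theta E x \in unitmx.
Proof.
move=> Yx; have /mulmx1_unit[] : conjmx (theta E x) *m (- theta E (tau x)) = 1%:M.
  by rewrite mulmxN theta_sq// opprK.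
by rewrite conjmx_unit.
Qed.

Lemma theta_inv x : Y x -> invmx (theta E x) = - conjmx (theta E (tau x)).
Proof.
move=> Yx; have := theta_sq E (tauY Yx); rewrite tau_involutive => h.
rewrite -[LHS]mul1mx -[1%:M]opprK -h mulNmx -mulmxA mulmxV ?mulmx1//.
exact: theta_unit.
Qed.

(** The expression is the inverse adjoint of the corresponding one for [E]. *)
Lemma mdual_subproof x x' y : Y x -> Y x' -> nb E x y -> nb E x' (tau y) ->
  conjmx (invmx (adj (gauge E x z))) *m invmx (adj (theta E z)) *m
    invmx (invmx (adj (gauge E x' (tau z)))) @[z --> y] -->
  conjmx (invmx (adj (gauge E x y))) *m invmx (adj (theta E y)) *m
    invmx (invmx (adj (gauge E x' (tau y)))).
Proof.
move=> Yx Yx' nxy nx'y.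
have H z : nb E x z -> nb E x' (tau z) ->
    conjmx (invmx (adj (gauge E x z))) *m invmx (adj (theta E z)) *m
    invmx (invmx (adj (gauge E x' (tau z)))) =
    invmx (adj (conjmx (gauge E x z) *m theta E z *m invmx (gauge E x' (tau z)))).
  move=> nxz nx'z; have Yz := nb_sub Yx nxz.
  have u1 := gauge_unit Yx nxz; have u2 := gauge_unit Yx' nx'z.
  have u3 := theta_unit Yz.
  rewrite !adjM adjV conjmxV conj_adj invmxK.
  rewrite invmxM ?unitmx_inv ?unitmx_mul ?adj_unit ?conjmx_unit ?u1 ?u3//.
  by rewrite invmxM ?adj_unit ?conjmx_unit// invmxK.
rewrite H//.
have n1 : nbhs y (nb E x) by apply: open_nbhs_nbhs; split=> //; exact: nb_open.
have n2 : nbhs y ((@tau X) @^-1` nb E x').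
  by apply: tau_continuous; apply: open_nbhs_nbhs; split=> //; exact: nb_open.
apply: (@cvg_near_eq _ (nbhs y)); first by apply: filterS2 n1 n2; exact: H.
apply: (@cvg_invmx _ _ (nbhs y)).
  by apply: (@cvg_adjoint _ (nbhs y)); exact: theta_cvg.
rewrite adj_unit !unitmx_mul conjmx_unit unitmx_inv.
by rewrite gauge_unit// theta_unit ?gauge_unit//; exact: nb_sub nxy.
Qed.

(* The conjugate dual bundle: a sesquilinear form on E is a homomorphism to it. *)
Definition mdual : mbundle Y m.
Proof.
apply: (@MBundle Y m (nb E) (fun x y => invmx (adj (gauge E x y)))
  (fun x => invmx (adj (theta E x)))).
- exact: nb_open.
- exact: nb_self.
- exact: nb_sub.
- by move=> x y Yx nxy; rewrite unitmx_inv adj_unit gauge_unit.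
- move=> x x' y Yx Yx' nxy nx'y.
  have n1 : nbhs y (nb E x) by apply: open_nbhs_nbhs; split=> //; exact: nb_open.
  have H z : nb E x z -> invmx (adj (gauge E x z)) *m invmx (invmx (adj (gauge E x' z))) =
      adj (gauge E x' z *m invmx (gauge E x z)).
    by move=> nxz; rewrite adjM invmxK adjV.
  rewrite H//; apply: (@cvg_near_eq _ (nbhs y)); first by apply: filterS n1; exact: H.
  by apply: (@cvg_adjoint _ (nbhs y)); exact: gauge_cvg.
- move=> x Yx; have Ytx := tauY Yx.
  rewrite conjmxV conj_adj -invmxM ?adj_unit ?conjmx_unit ?theta_unit//.
  rewrite -adjM theta_sq// adjN adj1.
  have hN : - 1%:M = (-1)%:M :> 'M[C]_m by apply/matrixP => i k; rewrite !mxE mulNrn.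
  by rewrite hN invmx_scalar invrN1.
- by move=> x x' y Yx Yx' h1 h2; apply: mdual_subproof.
Defined.
End theory.
End matrix_bundles.

Section coordinates.
Variables (R : realType) (m n : nat).
Local Notation C := R[i].
Implicit Types (gs ts : 'M[C]_m) (ge te : 'M[C]_n) (u : 'M[C]_(m, n)).

Lemma hom_tau_coords gs ts gs' ge te ge' u :
  gs \in unitmx -> ts \in unitmx -> gs' \in unitmx -> ge \in unitmx ->
  gs' *m (invmx ts *m conjmx u *m te) *m invmx ge' =
  invmx (conjmx gs *m ts *m invmx gs') *m conjmx (gs *m u *m invmx ge) *m
  (conjmx ge *m te *m invmx ge').
Proof.
move=> u1 u2 u3 u4; have c1 : conjmx gs \in unitmx by rewrite conjmx_unit.
have c4 : conjmx ge \in unitmx by rewrite conjmx_unit.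
have c12 : conjmx gs *m ts \in unitmx by rewrite unitmx_mul c1.
have c3 : invmx gs' \in unitmx by rewrite unitmx_inv.
rewrite !conjmxM conjmxV (invmxM c12 c3) (invmxM c1 u2) invmxK !mulmxA.
by rewrite (mulmxKV c1) (mulmxKV c4).
Qed.

Lemma change_coords gs gs' fs ge ge' fe u :
  gs \in unitmx -> fs \in unitmx -> ge \in unitmx -> fe \in unitmx ->
  gs' *m u *m invmx ge' =
  (gs' *m invmx gs) *m invmx (fs *m invmx gs) *m (fs *m u *m invmx fe) *m
  (fe *m invmx ge) *m (ge *m invmx ge').
Proof.
move=> u1 u2 u3 u4; have c1 : invmx gs \in unitmx by rewrite unitmx_inv.
rewrite (invmxM u2 c1) invmxK !mulmxA.
by rewrite (mulmxKV u1) (mulmxKV u2) (mulmxKV u4) (mulmxKV u3).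
Qed.
End coordinates.

(** * Homomorphisms of bundles in fibrewise coordinates *)

Section hom_sections.
Variables (R : realType) (X : involutive_space) (Y : set X) (m n : nat).
Local Notation C := R[i].
Hypothesis tauY : forall x, Y x -> Y (tau x).
Variables (S : mbundle R Y m) (E : mbundle R Y n).

Definition coords x y (u : 'M[C]_(m, n)) : 'M[C]_(m, n) :=
  gauge S x y *m u *m invmx (gauge E x y).

(** Generators of the topology on the total space of the bundle of homomorphisms from [S] to [E]. *)
Definition hom_opens : set (set (X * 'M[C]_(m, n))) :=
  [set B | exists x (O : set 'M[C]_(m, n)), [/\ Y x, open O &
    B = [set yu | [/\ nb S x yu.1, nb E x yu.1 & O (coords x yu.1 yu.2)]]]].

Definition hom_cont (T : topologicalType) (A : set T) (c : T -> X)
    (d : T -> 'M[C]_(m, n)) : Prop :=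
  forall z, A z -> forall x, Y x -> nb S x (c z) -> nb E x (c z) ->
    coords x (c w) (d w) @[w --> within A (nbhs z)] --> coords x (c z) (d z).

Lemma near_nb k (F : mbundle R Y k) (T : topologicalType) (c : T -> X) z x :
  continuous c -> Y x -> nb F x (c z) -> \forall w \near z, nb F x (c w).
Proof. by move=> cc Yx nx; apply: cc; apply: open_nbhs_nbhs; split=> //; exact: nb_open. Qed.

Lemma hom_sectionP (T : topologicalType) (A : set T) (c : T -> X) d :
  continuous c -> continuous_section hom_opens A c d <-> hom_cont A c d.
Proof.
move=> cc; split=> [cd z Az x Yx n1 n2 O|cd B [x [W [Yx oW ->]]]].
  move=> nO; pose W := interior O; have oW : open W by exact: open_interior.
  have subO : W `<=` O by exact: interior_subset.
  have Wz := nO : W _.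
  have OB : hom_opens [set yu | [/\ nb S x yu.1, nb E x yu.1 & W (coords x yu.1 yu.2)]].
    by exists x, W.
  have /open_subspace_within/(_ z Az) := cd _ OB; move=> /=.
  move=> h; have {}h := h (And3 n1 n2 Wz).
  by apply: filterS h => w [_ _ /subO].
apply/open_subspace_within => z Az /= [n1 n2 Oz].
have h : within A (nbhs z) [set w | W (coords x (c w) (d w))].
  by apply: (cd z Az x Yx n1 n2); apply: open_nbhs_nbhs.
have h1 := near_nb cc Yx n1; have h2 := near_nb cc Yx n2.
by near=> w; split; near: w => //; apply: cvg_within.
Unshelve. all: by end_near. Qed.

Lemma hom_opens_cont (s : X -> 'M[C]_(m, n)) : open Y ->
  (forall B, hom_opens B -> open [set x | Y x /\ B (x, s x)]) <->
  hom_cont setT id s.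
Proof.
move=> oY; split=> [so z _ x Yx n1 n2 O|cd B [x [W [Yx oW ->]]]].
  move=> nO; pose W := interior O; have oW : open W by exact: open_interior.
  have subO : W `<=` O by exact: interior_subset.
  have Wz := nO : W _.
  have OB : hom_opens [set yu | [/\ nb S x yu.1, nb E x yu.1 & W (coords x yu.1 yu.2)]].
    by exists x, W.
  have Yz := nb_sub Yx n1.
  have h : nbhs z [set x0 | Y x0 /\ [/\ nb S x x0, nb E x x0 & W (coords x x0 (s x0))]].
    by apply: open_nbhs_nbhs; split; [exact: so OB|].
  by apply: (@filterS _ (nbhs z) _ _ _ _ h) => w [_ [_ _ Ww]] _; exact: subO.
rewrite openE => z /= [Yz [n1 n2 Oz]]; rewrite /interior.
have h : nbhs z [set w | W (coords x w (s w))].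
  have h := cd z I x Yx n1 n2 W (open_nbhs_nbhs (conj oW Oz)).
  by apply: (@filterS _ (nbhs z) _ _ _ _ h) => w; apply.
have h1 : nbhs z (nb S x) by apply: open_nbhs_nbhs; split=> //; exact: nb_open.
have h2 : nbhs z (nb E x) by apply: open_nbhs_nbhs; split=> //; exact: nb_open.
apply: filterS3 h h1 h2 => w h h1 h2; split=> //; exact: nb_sub h1.
Qed.

(** Conjugation by Theta, from the homomorphisms over [x] to those over [tau x]; [u] is equivariant
    if [u (tau x) = hom_tau x (u x)]. *)
Definition hom_tau x (u : 'M[C]_(m, n)) : 'M[C]_(m, n) :=
  invmx (theta S x) *m conjmx u *m theta E x.

(** The signs of the squares of Theta on [S] and on [E] cancel. *)
Lemma hom_tauK x u : Y x -> hom_tau (tau x) (hom_tau x u) = u.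
Proof.
move=> Yx; have Ytx := tauY Yx; rewrite /hom_tau !conjmxM conjmxK conjmxV.
have -> : invmx (theta S (tau x)) = - conjmx (theta S x).
  by rewrite theta_inv// tau_involutive.
rewrite !mulNmx !mulmxA mulmxV ?conjmx_unit ?theta_unit// mul1mx.
by rewrite -mulmxA theta_sq// mulmxN mulmx1 opprK.
Qed.

Lemma hom_tau_cont (T : topologicalType) (A : set T) (c : T -> X) d :
  continuous c -> (forall z, Y (c z)) -> hom_cont A c d ->
  hom_cont A (tau (i:=X) \o c) (fun z => hom_tau (c z) (d z)).
Proof.
move=> cc Yc cd z Az x Yx n1 n2 /=.
have Yz := Yc z; set FF := within A (nbhs z).
have nS := nb_self S Yz; have nE := nb_self E Yz.
have cw : c @ FF --> c z by apply: cvg_within_filter; exact: cc.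
have cS := cvg_comp c _ cw (@theta_cvg _ _ _ _ S _ _ _ Yz Yx nS n1).
have cE := cvg_comp c _ cw (@theta_cvg _ _ _ _ E _ _ _ Yz Yx nE n2).
have nT : \forall w \near z, nb S x (tau (c w)).
  apply: (near_nb (c := fun w => tau (c w))) => //.
  by move=> w; apply: (cvg_comp c (@tau X)); [exact: cc|exact: tau_continuous].
have nSz := near_nb cc Yz nS; have nEz := near_nb cc Yz nE.
have H w : nb S (c z) (c w) -> nb E (c z) (c w) -> nb S x (tau (c w)) ->
  coords x (tau (c w)) (hom_tau (c w) (d w)) =
  invmx (conjmx (gauge S (c z) (c w)) *m theta S (c w) *m invmx (gauge S x (tau (c w)))) *m
  conjmx (coords (c z) (c w) (d w)) *m
  (conjmx (gauge E (c z) (c w)) *m theta E (c w) *m invmx (gauge E x (tau (c w)))).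
  move=> h1 h2 h3; apply: hom_tau_coords; rewrite ?(gauge_unit _ h1) ?(gauge_unit _ h2) ?(gauge_unit _ h3)//.
  by apply: theta_unit; exact: Yc.
rewrite H//; apply: (@cvg_near_eq _ FF).
  have g : \forall w \near FF, nb S (c z) (c w) /\ nb E (c z) (c w) /\ nb S x (tau (c w)).
    by apply: cvg_within; near=> w; split; [near: w|split; near: w].
  by apply: filterS g => w [h1 [h2 h3]]; exact: H.
apply: (@cvg_mulmx _ _ FF); last exact: cE.
apply: (@cvg_mulmx _ _ FF); last by apply: (@cvg_conjmx _ _ FF); exact: cd.
apply: (@cvg_invmx _ _ FF); first exact: cS.
rewrite !unitmx_mul conjmx_unit unitmx_inv.
by rewrite (gauge_unit Yz)// theta_unit ?(gauge_unit Yx).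
Unshelve. all: by end_near. Qed.

(* Continuity may be tested in one pair of local trivialisations at each point. *)
Lemma hom_cont_local (T : topologicalType) (A : set T) (c : T -> X) d :
  continuous c -> (forall z, Y (c z)) ->
  (forall z, A z -> exists (FS : T -> 'M[C]_m) (FE : T -> 'M[C]_n),
    [/\ FS z \in unitmx, FE z \in unitmx,
      FS w *m d w *m invmx (FE w) @[w --> within A (nbhs z)] -->
        FS z *m d z *m invmx (FE z),
      FS w *m invmx (gauge S (c z) (c w)) @[w --> within A (nbhs z)] -->
        FS z *m invmx (gauge S (c z) (c z)) &
      FE w *m invmx (gauge E (c z) (c w)) @[w --> within A (nbhs z)] -->
        FE z *m invmx (gauge E (c z) (c z))]) ->
  hom_cont A c d.
Proof.
move=> cc Yc loc z Az x Yx n1 n2; set FF := within A (nbhs z).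
have [FS [FE [uS uE cd cS cE]]] := loc z Az; have Yz := Yc z.
have nS := nb_self S Yz; have nE := nb_self E Yz.
have cw : c @ FF --> c z by apply: cvg_within_filter; exact: cc.
have tS := cvg_comp c _ cw (@gauge_cvg _ _ _ _ S _ _ _ Yx Yz n1 nS).
have tE := cvg_comp c _ cw (@gauge_cvg _ _ _ _ E _ _ _ Yz Yx nE n2).
have uS' := gauge_unit Yz nS; have uE' := gauge_unit Yz nE.
pose PS w := FS w *m invmx (gauge S (c z) (c w)).
pose PE w := FE w *m invmx (gauge E (c z) (c w)).
have uPS : PS z \in unitmx by rewrite unitmx_mul uS unitmx_inv.
have uPE : PE z \in unitmx by rewrite unitmx_mul uE unitmx_inv.
have H w : PS w \in unitmx -> PE w \in unitmx ->
    coords x (c w) (d w) =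
    (gauge S x (c w) *m invmx (gauge S (c z) (c w))) *m invmx (PS w) *m
    (FS w *m d w *m invmx (FE w)) *m PE w *m
    (gauge E (c z) (c w) *m invmx (gauge E x (c w))).
  by rewrite /PS /PE !unitmx_mul !unitmx_inv => /andP[u1 u2] /andP[u3 u4]; apply: change_coords.
rewrite (H z uPS uPE); apply: (@cvg_near_eq _ FF).
  by apply: filterS2 (cvg_unitmx cS uPS) (cvg_unitmx cE uPE) => w; exact: H.
apply: (@cvg_mulmx _ _ FF); last exact: tE.
apply: (@cvg_mulmx _ _ FF); last exact: cE.
apply: (@cvg_mulmx _ _ FF); last exact: cd.
apply: (@cvg_mulmx _ _ FF); last exact: (@cvg_invmx _ _ FF _ _ _ _ cS uPS).
exact: tS.
Qed.
End hom_sections.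

(** * Frames over cells *)

Section quaternionic_bases.
Variable R : realType.
Local Notation C := R[i].

(** The row space of [col_mx A (conjmx A *m q)] is a quaternionic subspace. A relation puts some
    [s v + t Jv] into it; multiplication by the conjugate quaternion puts [(|s|^2 + |t|^2) v] there,
    which forces [s = t = 0]. *)
Lemma quaternionic_step (m k : nat) (q : 'M[C]_m) (A : 'M[C]_(k, m)) (v : 'rV[C]_m) :
  conjmx q *m q = - 1%:M -> row_free (col_mx A (conjmx A *m q)) ->
  ~~ (v <= col_mx A (conjmx A *m q))%MS ->
  row_free (col_mx (col_mx v A) (conjmx (col_mx v A) *m q)).
Proof.
move=> qq fA vA; apply: contraT => /not_row_free[u u0 uE].
pose s := lsubmx (lsubmx u); pose x := rsubmx (lsubmx u).
pose t := lsubmx (rsubmx u); pose y := rsubmx (rsubmx u).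
have uS : u = row_mx (row_mx s x) (row_mx t y) by rewrite !hsubmxK.
have rel : s *m v + x *m A + (t *m (conjmx v *m q) + y *m (conjmx A *m q)) = 0.
  rewrite -uE {1}uS mul_row_col mul_row_col; congr (_ + _).
  have -> : conjmx (col_mx v A) = col_mx (conjmx v) (conjmx A) by exact: map_col_mx.
  by rewrite mul_col_mx mul_row_col.
pose L := col_mx A (conjmx A *m q).
have LP (a b : 'rV[C]_k) : ((a *m A + b *m (conjmx A *m q))%R <= L)%MS.
  by rewrite -mul_row_col; exact: submxMl.
have Lconj (w : 'rV[C]_m) : (w <= L)%MS -> (conjmx w *m q <= L)%MS.
  move=> /submxP[D ->]; rewrite -[D]hsubmxK mul_row_col conjmxD !conjmxM conjmxK.
  rewrite mulmxDl -!mulmxA qq mulmxN mulmx1 mulmxN addrC -mulNmx.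
  exact: LP.
have w1 : ((s *m v + t *m (conjmx v *m q))%R <= L)%MS.
  have -> : s *m v + t *m (conjmx v *m q) = (- x) *m A + (- y) *m (conjmx A *m q).
    apply/eqP; rewrite -subr_eq0 !mulNmx opprD !opprK addrACA; exact/eqP.
  exact: LP.
have w2 := Lconj _ w1.
have w2E : conjmx (s *m v + t *m (conjmx v *m q)) *m q =
    conjmx s *m (conjmx v *m q) - conjmx t *m v.
  rewrite conjmxD !conjmxM conjmxK mulmxDl -!mulmxA qq.
  by rewrite !mulmxN mulmx1.
rewrite w2E in w2.
pose s0 := s ord0 ord0; pose t0 := t ord0 ord0.
have sE (w : 'rV[C]_m) : s *m w = s0 *: w by rewrite [s]mx11_scalar mul_scalar_mx.
have tE (w : 'rV[C]_m) : t *m w = t0 *: w by rewrite [t]mx11_scalar mul_scalar_mx.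
have csE (w : 'rV[C]_m) : conjmx s *m w = Num.conj s0 *: w.
  by rewrite [conjmx s]mx11_scalar mul_scalar_mx mxE.
have ctE (w : 'rV[C]_m) : conjmx t *m w = Num.conj t0 *: w.
  by rewrite [conjmx t]mx11_scalar mul_scalar_mx mxE.
have w3 : (((sqn s0 + sqn t0)%:C%C *: v)%R <= L)%MS.
  have -> : (sqn s0 + sqn t0)%:C%C *: v =
     Num.conj s0 *: (s *m v + t *m (conjmx v *m q)) +
     (- t0) *: (conjmx s *m (conjmx v *m q) - conjmx t *m v).
    rewrite sE tE csE ctE scalerDr scalerBr !scalerA !mulNr !scaleNr opprK.
    rewrite [Num.conj s0 * t0]mulrC; set Z := (t0 * _) *: (conjmx v *m q).
    have h (V : zmodType) (a1 b1 z : V) : a1 + z + (- z + b1) = a1 + b1.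
      by rewrite addrA addrK.
    rewrite h -scalerDl mul_conj [t0 * _]mulrC mul_conj -rmorphD.
    exact: erefl.
  by apply: addmx_sub; apply: scalemx_sub.
have st0 : sqn s0 + sqn t0 = 0.
  apply/eqP; apply: contraNT vA => st; rewrite -(scale1r v).
  have st' : (sqn s0 + sqn t0)%:C%C != 0 :> C.
    by rewrite -(rmorph0 (real_complex R)) (inj_eq (@complexI _)).
  by rewrite -(mulVf st') -scalerA; apply: scalemx_sub.
have [/sqn_eq0 s00 /sqn_eq0 t00] : sqn s0 = 0 /\ sqn t0 = 0.
  by move/eqP: st0; rewrite paddr_eq0 ?sqn_ge0// => /andP[/eqP ? /eqP ?].
have xy : row_mx x y = 0.
  move/row_free_inj: fA => /(_ 1%N); apply; rewrite mul0mx mul_row_col.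
  by move: rel; rewrite sE tE s00 t00 !scale0r !add0r.
have s0' : s = 0 by rewrite [s]mx11_scalar -/s0 s00 raddf0.
have t0' : t = 0 by rewrite [t]mx11_scalar -/t0 t00 raddf0.
case/eqP: u0; rewrite uS s0' t0'.
have -> : x = 0 by rewrite -[x](row_mxKl x y) xy linear0.
have -> : y = 0 by rewrite -[y](row_mxKr x y) xy linear0.
by rewrite !row_mx0.
Qed.

Lemma quaternionic_even (m : nat) (q : 'M[C]_m) : conjmx q *m q = - 1%:M ->
  exists k (A : 'M[C]_(k, m)), (k + k)%N = m /\ row_free (col_mx A (conjmx A *m q)).
Proof.
(* Rows are added until they span. A family of [m + 1] rows would generate [2 (m + 1)] independent
   ones in dimension [m]. *)
move=> qq; suff H (k : nat) : (exists k' (A : 'M[C]_(k', m)), (k' + k')%N = m /\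
    row_free (col_mx A (conjmx A *m q))) \/
    exists A : 'M[C]_(k, m), row_free (col_mx A (conjmx A *m q)).
  have [//|[A fA]] := H m.+1; have := rank_leq_col (col_mx A (conjmx A *m q)).
  by rewrite (eqP fA); lia.
elim: k => [|k [|[A fA]]]; [|by left|].
  by right; exists 0; rewrite /row_free -leqn0 rank_leq_row.
have [full|nfull] := boolP (row_full (col_mx A (conjmx A *m q))).
  by left; exists k, A; split=> //; rewrite -(eqP fA) (eqP full).
right; have [i iA] : exists i, ~~ (row i 1%:M <= col_mx A (conjmx A *m q))%MS.
  apply: contrapT => /forallNP h; move/negP: nfull; apply.
  by rewrite -sub1mx; apply/row_subP => i; apply/negPn/negP; exact: h.
by exists (col_mx (row i 1%:M) A : 'M[C]_(1 + k, m)); exact: quaternionic_step.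
Qed.

Lemma quaternionic_basis (a : nat) (q : 'M[C]_(a + a)) :
  conjmx q *m q = - 1%:M ->
  exists2 F : 'M[C]_(a + a), F \in unitmx & conjmx F *m q = Jmx R a *m F.
Proof.
move=> qq; have [k [A [kk fA]]] := quaternionic_even qq.
have ka : k = a by lia.
move: A fA; rewrite ka => A fA; exists (col_mx A (conjmx A *m q)).
  by rewrite -row_free_unit.
rewrite /Jmx mul_block_col !mul0mx !mul1mx mulNmx mul1mx addr0 add0r.
have -> : conjmx (col_mx A (conjmx A *m q)) = col_mx (conjmx A) (conjmx (conjmx A *m q)).
  exact: map_col_mx.
by rewrite mul_col_mx conjmxM conjmxK -mulmxA qq mulmxN mulmx1.
Qed.
End quaternionic_bases.

(** * Local frames and their gluing *)

Section frames.
Variables (R : realType) (X : involutive_space) (Y : set X) (m j : nat).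
Local Notation C := R[i].
Variables (E : mbundle R Y m) (c : 'rV[R]_j -> X) (fx : bool) (K : 'M[C]_m).
Hypothesis tauY : forall x, Y x -> Y (tau x).
Hypothesis cc : continuous c.
Hypothesis Yc : forall v, Y (c v).
Hypothesis fxc : fx -> forall v, tau (c v) = c v.
Hypothesis KK : fx -> conjmx K *m K = - 1%:M.

(** Over a fixed cell Theta is to have the constant matrix [K] in the frame. *)
Definition compatible v (F : 'M[C]_m) : Prop :=
  F \in unitmx /\ (fx -> conjmx F *m theta E (c v) = K *m F).

Definition is_frame (B : set 'rV[R]_j) (F : 'rV[R]_j -> 'M[C]_m) : Prop :=
  forall v, B v -> compatible v (F v) /\
  forall x, Y x -> nb E x (c v) ->
    F w *m invmx (gauge E x (c w)) @[w --> within B (nbhs v)] -->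
      F v *m invmx (gauge E x (c v)).

Lemma is_frame_sub (B B' : set 'rV[R]_j) F : B `<=` B' -> is_frame B' F -> is_frame B F.
Proof.
move=> BB' fF v Bv; have [cF Fc] := fF v (BB' v Bv); split=> // x Yx nx A nA.
have h := Fc x Yx nx A nA.
by apply: (@filterS _ (nbhs v) _ _ _ _ h) => w {}h /BB'.
Qed.

Hypothesis pointwise : forall v, exists F, compatible v F.

(** As [conjmx K *m K] is minus the identity, compatibility says that [A] is fixed by the involution
    sending [A] to [- conjmx K *m conjmx A *m theta E (c v)]; this is the average of [A] and its
    image. *)
Definition symmetrize v (A : 'M[C]_m) : 'M[C]_m :=
  2^-1 *: (A - conjmx K *m conjmx A *m theta E (c v)).

Lemma symmetrize_compatible v A : fx ->
  conjmx (symmetrize v A) *m theta E (c v) = K *m symmetrize v A.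
Proof.
move=> fxT; have qq : conjmx (theta E (c v)) *m theta E (c v) = - 1%:M.
  by have := theta_sq E (Yc v); rewrite fxc.
have KK' : K *m conjmx K = - 1%:M.
  have := congr1 (@conjmx R m m) (KK fxT).
  by rewrite conjmxM conjmxK conjmxN conjmx1.
rewrite /symmetrize conjmxZ -scalemxAl -scalemxAr; congr (_ *: _).
  by rewrite fmorphV rmorph_nat.
rewrite conjmxD conjmxN !conjmxM !conjmxK mulmxBl mulmxBr -!mulmxA qq.
rewrite [K *m (conjmx K *m _)]mulmxA KK' mulNmx mul1mx opprK.
by rewrite !mulmxN mulmx1 opprK addrC.
Qed.

Lemma symmetrize_id v A : fx -> conjmx A *m theta E (c v) = K *m A -> symmetrize v A = A.
Proof.
move=> fxT h; rewrite /symmetrize -mulmxA h mulmxA KK// mulNmx mul1mx opprK.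
by rewrite -mulr2n -[A *+ 2]scaler_nat scalerA mulVf ?pnatr_eq0// scale1r.
Qed.

(** A compatible matrix at [v0] is carried along by a local trivialisation and, over a fixed cell,
    averaged; it stays invertible nearby. *)
Lemma local_frame v0 : exists F d, 0 < d /\ is_frame [set v | `|v0 - v| < d] F.
Proof.
have Y0 := Yc v0; have n0 := nb_self E Y0; have uG := gauge_unit Y0 n0.
have [F0 [uF0 cF0]] := pointwise v0.
pose F1 := F0 *m invmx (gauge E (c v0) (c v0)).
pose A w := F1 *m gauge E (c v0) (c w).
pose F w := if fx then symmetrize w (A w) else A w.
have A0 : A v0 = F0 by rewrite /A /F1 (mulmxKV uG).
have Fv0 : F v0 = F0.
  rewrite /F; case: (boolP fx) => // fxT; rewrite A0.
  by apply: symmetrize_id => //; exact: cF0.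
have Ac v x : Y x -> nb E (c v0) (c v) -> nb E x (c v) ->
    A w *m invmx (gauge E x (c w)) @[w --> v] --> A v *m invmx (gauge E x (c v)).
  move=> Yx n1 n2; have h := cvg_comp c _ (@cc v) (@gauge_cvg _ _ _ _ E _ _ _ Y0 Yx n1 n2).
  have h' : gauge E (c v0) (c w) *m invmx (gauge E x (c w)) @[w --> v] -->
    gauge E (c v0) (c v) *m invmx (gauge E x (c v)) by exact: h.
  rewrite /A -mulmxA; under eq_fun do rewrite -mulmxA.
  by apply: (@cvg_mulmx _ _ (nbhs v)); [exact: cvg_cst|exact: h'].
have Fc v x : Y x -> nb E (c v0) (c v) -> nb E x (c v) ->
    F w *m invmx (gauge E x (c w)) @[w --> v] --> F v *m invmx (gauge E x (c v)).
  move=> Yx n1 n2; rewrite /F; case: (boolP fx) => fxT; last exact: Ac.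
  have nt : nb E x (tau (c v)) by rewrite (fxc fxT).
  have h := cvg_comp c _ (@cc v) (@theta_cvg _ _ _ _ E _ _ _ Y0 Yx n1 nt).
  have h' : conjmx (gauge E (c v0) (c w)) *m theta E (c w) *m invmx (gauge E x (c w)) @[w --> v] -->
      conjmx (gauge E (c v0) (c v)) *m theta E (c v) *m invmx (gauge E x (c v)).
    move: h; rewrite /comp; under eq_fun do rewrite (fxc fxT).
    by rewrite (fxc fxT).
  pose s1 w := symmetrize w (A w) *m invmx (gauge E x (c w)).
  pose s2 w := 2^-1 *: (A w *m invmx (gauge E x (c w)) - conjmx K *m conjmx F1 *m
       (conjmx (gauge E (c v0) (c w)) *m theta E (c w) *m invmx (gauge E x (c w)))).
  have sE w : s1 w = s2 w.
    by rewrite /s1 /s2 /symmetrize -scalemxAl mulmxBl /A conjmxM !mulmxA.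
  suff : s2 @ v --> s2 v by rewrite -(funext sE).
  apply: (@cvg_scalemx _ _ (nbhs v)); first exact: cvg_cst.
  have hA := Ac v x Yx n1 n2.
  apply: (@cvgB _ _ _ (nbhs v)); first exact: hA.
  by apply: (@cvg_mulmx _ _ (nbhs v)); [exact: cvg_cst|exact: h'].
have nnb : \forall w \near v0, nb E (c v0) (c w) by apply: near_nb.
have nu : \forall w \near v0, F w \in unitmx.
  have u0 : F v0 *m invmx (gauge E (c v0) (c v0)) \in unitmx.
    by rewrite unitmx_mul Fv0 uF0 unitmx_inv.
  apply: filterS (cvg_unitmx (Fc v0 (c v0) Y0 n0 n0) u0) => w.
  by rewrite unitmx_mul => /andP[].
have /nbhs_normP[d /= d0 dP] : nbhs v0 [set w | nb E (c v0) (c w) /\ F w \in unitmx].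
  exact: filterI.
exists F, d; split=> // v /dP[nv uv]; split.
  by split=> // fxT; rewrite /F fxT; exact: symmetrize_compatible.
by move=> x Yx nx; apply: cvg_within_filter; exact: Fc.
Qed.

Lemma within_union_cvg (T U : topologicalType) (A B : set T) (f : T -> U) (z : T) (l : U) :
  f @ within A (nbhs z) --> l -> f @ within B (nbhs z) --> l ->
  f @ within (A `|` B) (nbhs z) --> l.
Proof.
move=> fA fB W nW; have hA := fA W nW; have hB := fB W nW.
by apply: (@filterS2 _ (nbhs z) _ _ _ _ _ hA hB) => w {}hA {}hB [/hA|/hB].
Qed.

Definition halfcut (B : set 'rV[R]_j) (i : 'I_j) (t : R) (lower : bool) : set 'rV[R]_j :=
  [set v | B v /\ if lower then v ord0 i <= t else t <= v ord0 i].

Definition wall (i : 'I_j) (t : R) (v : 'rV[R]_j) : 'rV[R]_j :=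
  \row_l (if l == i then t else v ord0 l).

Lemma wall_continuous i t : continuous (wall i t).
Proof.
move=> v; apply: (@mx_cvg _ _ (nbhs v)) => k l; rewrite mxE.
under eq_fun do rewrite mxE; case: eqP => _; first exact: cvg_cst.
exact: coord_continuous.
Qed.

(* The frame on the upper part is corrected by the transition matrix on the wall. *)
Lemma glue_frames (B : set 'rV[R]_j) i t F1 F2 :
  (forall v, B v -> t <= v ord0 i -> B (wall i t v)) ->
  is_frame (halfcut B i t true) F1 -> is_frame (halfcut B i t false) F2 ->
  exists F, is_frame B F.
Proof.
move=> Bwall f1 f2; set B1 := halfcut B i t true; set B2 := halfcut B i t false.
pose p := wall i t : 'rV[R]_j -> 'rV[R]_j.
have pi (v : 'rV[R]_j) : p v ord0 i = t by rewrite mxE eqxx.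
have p1 (v : 'rV[R]_j) : B2 v -> B1 (p v) by move=> [Bv tv]; split; [exact: Bwall|rewrite pi].
have p2 (v : 'rV[R]_j) : B2 v -> B2 (p v) by move=> [Bv tv]; split; [exact: Bwall|rewrite pi].
pose F' (v : 'rV[R]_j) := F1 (p v) *m invmx (F2 (p v)) *m F2 v.
pose F (v : 'rV[R]_j) := if v ord0 i <= t then F1 v else F' v.
have F'F v : B2 v -> F v = F' v.
  move=> Bv; rewrite /F; case: ifPn => // vt.
  have tv : v ord0 i = t by apply/eqP; rewrite eq_le vt; case: Bv.
  have pv : p v = v.
    by apply/rowP => l; rewrite mxE; case: eqP => // ->; rewrite tv.
  have [[u2 _] _] := f2 v Bv.
  by rewrite /F' pv (mulmxKV u2).
have F1F v : B1 v -> F v = F1 v by move=> [Bv vt]; rewrite /F vt.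
have ff : is_frame B2 F'.
  move=> v Bv; have [[u1 s1] c1] := f1 _ (p1 _ Bv); have [[u2 s2] c2] := f2 _ (p2 _ Bv).
  have [[u3 s3] c3] := f2 _ Bv; split.
    split=> [|fxT]; first by rewrite !unitmx_mul u1 unitmx_inv u2.
    have e1 := s1 fxT; have e2 := s2 fxT; have e3 := s3 fxT.
    have u2' : conjmx (F2 (p v)) \in unitmx by rewrite conjmx_unit.
    have uK : theta E (c (p v)) \in unitmx by apply: theta_unit; exact: Yc.
    have h1 : conjmx (F1 (p v)) = K *m F1 (p v) *m invmx (theta E (c (p v))).
      by rewrite -e1 (mulmxK uK).
    have h2 : invmx (conjmx (F2 (p v))) *m K = theta E (c (p v)) *m invmx (F2 (p v)).
      rewrite -[LHS](mulmxK u2) -[_ *m K *m _]mulmxA -e2 mulmxA (mulVmx u2') mul1mx.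
      exact: erefl.
    rewrite /F' !conjmxM conjmxV -[LHS]mulmxA e3.
    rewrite (_ : conjmx (F1 (p v)) *m invmx (conjmx (F2 (p v))) *m (K *m F2 v) =
       conjmx (F1 (p v)) *m (invmx (conjmx (F2 (p v))) *m K) *m F2 v); last by rewrite !mulmxA.
    by rewrite h2 h1 !mulmxA (mulmxKV uK).
  move=> x Yx nx; set FF := within B2 (nbhs v).
  have Yp := Yc (p v); have np := nb_self E Yp.
  have pw1 : p @ FF --> within B1 (nbhs (p v)).
    move=> W nW; have := @wall_continuous i t v _ nW; rewrite /FF /within/=.
    by move=> h; apply: (@filterS _ (nbhs v) _ _ _ _ h) => w {}h Bw; apply: h; exact: p1.
  have pw2 : p @ FF --> within B2 (nbhs (p v)).
    move=> W nW; have := @wall_continuous i t v _ nW; rewrite /FF /within/=.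
    by move=> h; apply: (@filterS _ (nbhs v) _ _ _ _ h) => w {}h Bw; apply: h; exact: p2.
  have d1 : F1 (p w) *m invmx (gauge E (c (p v)) (c (p w))) @[w --> FF] -->
     F1 (p v) *m invmx (gauge E (c (p v)) (c (p v))) := cvg_comp p _ pw1 (c1 _ Yp np).
  have d2 : F2 (p w) *m invmx (gauge E (c (p v)) (c (p w))) @[w --> FF] -->
     F2 (p v) *m invmx (gauge E (c (p v)) (c (p v))) := cvg_comp p _ pw2 (c2 _ Yp np).
  have d3 := c3 x Yx nx.
  have uG := gauge_unit Yp np.
  have alg w : gauge E (c (p v)) (c (p w)) \in unitmx -> F2 (p w) \in unitmx ->
      F' w *m invmx (gauge E x (c w)) =
      (F1 (p w) *m invmx (gauge E (c (p v)) (c (p w)))) *m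
      invmx (F2 (p w) *m invmx (gauge E (c (p v)) (c (p w)))) *m
      (F2 w *m invmx (gauge E x (c w))).
    move=> uw u2w; have uw' : invmx (gauge E (c (p v)) (c (p w))) \in unitmx by rewrite unitmx_inv.
    by rewrite (invmxM u2w uw') invmxK !mulmxA (mulmxKV uw).
  have u2p : F2 (p v) *m invmx (gauge E (c (p v)) (c (p v))) \in unitmx.
    by rewrite unitmx_mul u2 unitmx_inv.
  rewrite (alg v uG u2); apply: (@cvg_near_eq _ FF).
    have g1 : \forall w \near FF, nb E (c (p v)) (c (p w)).
      have h := near_nb cc Yp np.
      by apply: (pw1 [set z | nb E (c (p v)) (c z)]); exact: cvg_within h.
    have g2 : \forall w \near FF, F2 (p w) \in unitmx.
      by apply: (@filterS _ (nbhs v) _ setT) => [w _ Bw|];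
        [have [[]] := f2 _ (p2 _ Bw)|exact: filterT].
    by apply: filterS2 g1 g2 => w n1 n2; apply: alg => //; exact: gauge_unit n1.
  apply: (@cvg_mulmx _ _ FF); last exact: d3.
  apply: (@cvg_mulmx _ _ FF); first exact: d1.
  exact: (@cvg_invmx _ _ FF _ _ _ _ d2 u2p).
(* At points outside a closed half, limits within that half hold vacuously. *)
have closedcut lower (v : 'rV[R]_j) : ~ (if lower then v ord0 i <= t else t <= v ord0 i) ->
    forall W, within (halfcut B i t lower) (nbhs v) W.
  move=> nv W; rewrite /within/=.
  have : nbhs v [set w : 'rV[R]_j | ~ if lower then w ord0 i <= t else t <= w ord0 i].
    have vc : w ord0 i @[w --> v] --> v ord0 i by exact: coord_continuous.
    case: lower nv => /negP; rewrite -ltNge => nv.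
      by apply: (@filterS _ (nbhs v) _ _ _ _ (cvgr_gt _ vc _ nv)) => w; rewrite ltNge => /negP.
    by apply: (@filterS _ (nbhs v) _ _ _ _ (cvgr_lt _ vc _ nv)) => w; rewrite ltNge => /negP.
  by move=> h; apply: (@filterS _ (nbhs v) _ _ _ _ h) => w nw [_ /nw].
have BU : B = B1 `|` B2.
  apply/seteqP; split=> [v Bv|v [[]|[]]//].
  by have [vt|/ltW vt] := leP (v ord0 i) t; [left|right].
exists F => v Bv; split.
  have [vt|/ltW vt] := leP (v ord0 i) t.
    by rewrite F1F; [have [] := f1 v (conj Bv vt)|].
  by rewrite F'F; [have [] := ff v (conj Bv vt)|].
move=> x Yx nx; rewrite [in X in within X _]BU; apply: within_union_cvg.
  have [vt|vt] := pselect (v ord0 i <= t); last by move=> W _; exact: (closedcut true).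
  have b1 : B1 v by [].
  have [_ h] := f1 v b1; rewrite (F1F v b1); apply: cvg_near_eq (h x Yx nx).
  by apply: (@filterS _ (nbhs v) _ setT) => [w _ Bw|]; [rewrite F1F|exact: filterT].
have [vt|vt] := pselect (t <= v ord0 i); last by move=> W _; exact: (closedcut false).
have b2 : B2 v by [].
have [_ h] := ff v b2; rewrite (F'F v b2); apply: cvg_near_eq (h x Yx nx).
by apply: (@filterS _ (nbhs v) _ setT) => [w _ Bw|]; [rewrite F'F|exact: filterT].
Qed.
End frames.

(** * Frames over the whole cube by subdivision *)

Section frames_on_cubes.
Variables (R : realType) (X : involutive_space) (Y : set X) (m j : nat).
Local Notation C := R[i].
Variables (E : mbundle R Y m) (c : 'rV[R]_j -> X) (fx : bool) (K : 'M[C]_m).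
Hypothesis tauY : forall x, Y x -> Y (tau x).
Hypothesis cc : continuous c.
Hypothesis Yc : forall v, Y (c v).
Hypothesis fxc : fx -> forall v, tau (c v) = c v.
Hypothesis KK : fx -> conjmx K *m K = - 1%:M.
Hypothesis pointwise : forall v, exists F, compatible E c fx K v F.

Definition box (a b : 'I_j -> R) : set 'rV[R]_j :=
  [set v | forall l, a l <= v ord0 l <= b l].

(** A Lebesgue number for the cover of the cube by domains of local frames. *)
Lemma small_frames : exists2 d, 0 < d & forall v, cube v ->
  exists F, is_frame E c fx K [set w | `|v - w| < d] F.
Proof.
have /compact_near_coveringP := @compact_cube R j.
move=> /(_ R 0^'+ (fun d v => exists F, is_frame E c fx K [set w | `|v - w| < d] F)) [].
  move=> v _; have [F [d [d0 fF]]] := local_frame cc Yc fxc KK pointwise v.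
  have d20 : 0 < d / 2 by rewrite divr_gt0.
  exists (ball v (d / 2), [set e | e < d / 2]).
    by split; [exact: nbhsx_ballx|exact: nbhs_right_lt].
  move=> [v' e] [/= vv' ee]; exists F; apply: is_frame_sub fF => w /= v'w.
  have -> : v - w = (v - v') + (v' - w) by rewrite addrA subrK.
  apply: le_lt_trans (ler_normD _ _) _; rewrite (splitr d).
  by apply: ltrD; [move: vv'; rewrite -ball_normE|exact: lt_trans v'w ee].
move=> d /= d0 dP; exists (d / 2); first by rewrite divr_gt0.
move=> v cv; have d20 : 0 < d / 2 by rewrite divr_gt0.
have d2d : d / 2 < d by rewrite ltr_pdivrMr// ltr_pMr// ltr1n.
have := dP (d / 2); rewrite /= sub0r normrN (gtr0_norm d20).
by move=> /(_ d2d d20 v cv).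
Qed.

Lemma frame_cube : exists F, is_frame E c fx K (@cube R j) F.
Proof.
have [d d0 dP] := small_frames; pose e := d / 2.
have e0 : 0 < e by rewrite divr_gt0.
have ed : e < d by rewrite ltr_pdivrMr// ltr_pMr// ltr1n.
(* Induction on the number [i] of leading directions in which the box may be long. An inner
   induction on [N] cuts off slabs of width [e] in the last of these directions, and [glue_frames]
   joins them. *)
have H (i : nat) : (i <= j)%N -> forall a b : 'I_j -> R, (forall l, a l <= b l) ->
    box a b `<=` @cube R j -> (forall l : 'I_j, (i <= l)%N -> b l - a l <= e) ->
    exists F, is_frame E c fx K (box a b) F.
  elim: i => [|i IH] ij a b ab bc small.
    pose v0 : 'rV[R]_j := \row_l a l.
    have [F fF] : exists F, is_frame E c fx K [set w | `|v0 - w| < d] F.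
      by apply: dP; apply: bc => l; rewrite mxE lexx ab.
    exists F; apply: is_frame_sub fF => w wB /=; apply: le_lt_trans ed.
    apply: mx_norm_le => [|k l]; first exact: ltW.
    have := small l isT; have /andP[] := wB l; rewrite !mxE (ord1 k) => h1 h2 h3.
    by rewrite ler_norml; apply/andP; split; lra.
  pose i0 : 'I_j := Ordinal ij.
  have [N Nb] : exists N : nat, b i0 - a i0 <= N%:R * e.
    exists (Num.truncn ((b i0 - a i0) / e)).+1.
    by rewrite -ler_pdivrMr// ltW// truncnS_gt.
  elim: N a b ab bc small Nb => [|N IHN] a b ab bc small Nb.
    apply: IH => //; first exact: ltnW.
    move=> l; rewrite leq_eqVlt => /orP[/eqP il|/small//].
    have -> : l = i0 by apply: val_inj.
    by apply: le_trans Nb _; rewrite mul0r ltW.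
  pose t := Num.min (b i0) (a i0 + e).
  have at0 : a i0 <= t by rewrite le_min ab lerDl ltW.
  have tb : t <= b i0 by rewrite ge_min lexx.
  pose b1 l := if l == i0 then t else b l.
  pose a2 l := if l == i0 then t else a l.
  have c1 : halfcut (box a b) i0 t true = box a b1.
    apply/seteqP; split=> v /=.
      move=> [vB vt] l; rewrite /b1; case: eqP => [->|_]; last exact: vB.
      by rewrite vt andbT; case/andP: (vB i0).
    move=> vB; split; last by have := vB i0; rewrite /b1 eqxx => /andP[].
    move=> l; have := vB l; rewrite /b1; case: eqP => [->|//] /andP[-> /= h].
    exact: le_trans h tb.
  have c2 : halfcut (box a b) i0 t false = box a2 b.
    apply/seteqP; split=> v /=.
      move=> [vB vt] l; rewrite /a2; case: eqP => [->|_]; last exact: vB.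
      by rewrite vt /=; case/andP: (vB i0).
    move=> vB; split; last by have := vB i0; rewrite /a2 eqxx => /andP[].
    move=> l; have := vB l; rewrite /a2; case: eqP => [->|//] /andP[h ->].
    by rewrite andbT; exact: le_trans at0 h.
  have s1 : box a b1 `<=` box a b by rewrite -c1 => v [].
  have s2 : box a2 b `<=` box a b by rewrite -c2 => v [].
  have [F1 f1] : exists F, is_frame E c fx K (box a b1) F.
    apply: IH => [|l||l]; first exact: ltnW.
    - by rewrite /b1; case: eqP => [->|].
    - exact: subset_trans s1 bc.
    rewrite leq_eqVlt => /orP[/eqP il|il].
      have -> : l = i0 by apply: val_inj.
      by rewrite /b1 eqxx lerBlDl ge_min lexx orbT.
    rewrite /b1; case: eqP => [li|_]; last exact: small.
    by move: il; rewrite li /= ltnn.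
  have [F2 f2] : exists F, is_frame E c fx K (box a2 b) F.
    apply: IHN => [l||l il|].
    - by rewrite /a2; case: eqP => [->|].
    - exact: subset_trans s2 bc.
    - rewrite /a2; case: eqP => [li|_]; last exact: small.
      by move: il; rewrite li /= ltnn.
    rewrite /a2 eqxx /t; have [h|h] := leP (b i0) (a i0 + e).
      by rewrite subrr mulr_ge0// ltW.
    by move: Nb; rewrite -natr1 mulrDl mul1r; lra.
  rewrite -c1 in f1; rewrite -c2 in f2.
  apply: (glue_frames cc Yc _ f1 f2) => v vB tv l; rewrite mxE.
  by case: eqP => [->|_]; [rewrite at0 tb|exact: vB].
have cE : @cube R j = box (fun=> -1) (fun=> 1).
  apply/seteqP; split=> v /= h.
    by move=> l; rewrite -ler_norml; apply: le_trans h; exact: mx_norm_ge.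
  by apply: mx_norm_le => // k l; rewrite (ord1 k) ler_norml; exact: h.
rewrite cE; apply: (H j) => //; first by rewrite -cE.
by move=> l; rewrite leqNgt ltn_ord.
Qed.
End frames_on_cubes.

(** * Reduction of extension problems over cells to matrix functions on discs *)

Section frames_and_extensions.
Variables (R : realType) (X : involutive_space) (Y : set X) (j : nat).
Local Notation C := R[i].
Hypothesis tauY : forall x, Y x -> Y (tau x).
Variable c : 'rV[R]_j -> X.
Hypothesis cc : continuous c.
Hypothesis Yc : forall v, Y (c v).

Lemma frame_free m (E : mbundle R Y m) K : exists F, is_frame E c false K (@cube R j) F.
Proof.
apply: frame_cube => // v; exists 1%:M; split=> //; exact: unitmx1.
Qed.

Lemma Jmx_conj a : conjmx (Jmx R a) = Jmx R a.
Proof.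
rewrite /conjmx /Jmx map_block_mx !map_mx0 map_mxN.
by rewrite -[map_mx _ 1%:M]/(conjmx 1%:M) conjmx1.
Qed.

Lemma Jmx_sq a : Jmx R a *m Jmx R a = - 1%:M.
Proof.
rewrite /Jmx mulmx_block !mul0mx !mulmx0 !mul1mx !mulmx1 !addr0 !add0r.
by rewrite [in RHS](@scalar_mx_block _ a a 1) opp_block_mx !oppr0.
Qed.

Lemma Jmx_unitary a : Jmx R a *m adj (Jmx R a) = 1%:M.
Proof.
have -> : adj (Jmx R a) = - Jmx R a.
  rewrite /adj Jmx_conj /Jmx tr_block_mx opp_block_mx !trmx0 !oppr0 trmx1.
  by rewrite linearN /= trmx1 opprK.
by rewrite mulmxN Jmx_sq opprK.
Qed.

Lemma mbundle_even m (E : mbundle R Y m) x : Y x -> tau x = x -> exists a, m = (a + a)%N.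
Proof.
move=> Yx tx; have qq : conjmx (theta E x) *m theta E x = - 1%:M.
  by have := theta_sq E Yx; rewrite tx.
by have [k [A [kk _]]] := quaternionic_even qq; exists k.
Qed.

Lemma frame_fixed a (E : mbundle R Y (a + a)) : (forall v, tau (c v) = c v) ->
  exists F, is_frame E c true (Jmx R a) (@cube R j) F.
Proof.
move=> fxc; apply: frame_cube => // [_|v].
  by rewrite Jmx_conj Jmx_sq.
have qq : conjmx (theta E (c v)) *m theta E (c v) = - 1%:M.
  by have := theta_sq E (Yc v); rewrite fxc.
by have [F uF cF] := quaternionic_basis qq; exists F.
Qed.

Lemma dual_frame m (E : mbundle R Y m) fx K B F : K \in unitmx ->
  is_frame E c fx K B F ->
  is_frame (mdual E tauY) c fx (invmx (adj K)) B (fun v => invmx (adj (F v))).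
Proof.
move=> uK fF v Bv; have [[uF cF] Fc] := fF v Bv; have ut := theta_unit E (Yc v).
split; [split|].
- by rewrite unitmx_inv adj_unit.
- move=> fxT; rewrite /= conjmxV conj_adj.
  have u1 : adj (conjmx (F v)) \in unitmx by rewrite adj_unit conjmx_unit.
  have u2 : adj (theta E (c v)) \in unitmx by rewrite adj_unit.
  have u3 : adj K \in unitmx by rewrite adj_unit.
  have u4 : adj (F v) \in unitmx by rewrite adj_unit.
  rewrite -(invmxM u2 u1) -(invmxM u4 u3) -!adjM.
  by rewrite (cF fxT).
move=> x Yx nx /=; set FF := within B (nbhs v).
have alg w : F w \in unitmx -> gauge E x (c w) \in unitmx ->
    invmx (adj (F w)) *m invmx (invmx (adj (gauge E x (c w)))) =
    adj (invmx (F w *m invmx (gauge E x (c w)))).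
  move=> u1 u2; have u3 : invmx (gauge E x (c w)) \in unitmx by rewrite unitmx_inv.
  by rewrite (invmxM u1 u3) !invmxK adjM adjV.
have {}nx : nb E x (c v) := nx.
have ug := gauge_unit Yx nx.
rewrite (alg v uF ug); apply: (@cvg_near_eq _ FF).
  have h := near_nb cc Yx nx; apply: (@filterS _ (nbhs v) _ _ _ _ h) => w nw Bw.
  by apply: alg; [have [[]] := fF w Bw|exact: gauge_unit nw].
apply: (@cvg_adjoint _ _ FF); apply: (@cvg_invmx _ _ FF); first exact: Fc.
by rewrite unitmx_mul uF unitmx_inv.
Qed.

Lemma within_sub_cvg (T U : topologicalType) (A B : set T) (f : T -> U) (z : T) (l : U) :
  A `<=` B -> f @ within B (nbhs z) --> l -> f @ within A (nbhs z) --> l.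
Proof.
move=> AB fl W nW; have h := fl W nW.
by apply: (@filterS _ (nbhs z) _ _ _ _ h) => w {}h /AB.
Qed.

Lemma sphere_cube : @sphere R j `<=` @cube R j.
Proof. by move=> v /sphere_disc /disc_cube. Qed.

Lemma closed_disc_cube : @closed_disc R j `<=` @cube R j.
Proof. by move=> v /disc_cube. Qed.

Section extension.
Variables (m n : nat) (S : mbundle R Y m) (E : mbundle R Y n).
Variables (fx : bool) (KS : 'M[C]_m) (KE : 'M[C]_n).
Variables (FS : 'rV[R]_j -> 'M[C]_m) (FE : 'rV[R]_j -> 'M[C]_n).
Hypothesis frS : is_frame S c fx KS (@cube R j) FS.
Hypothesis frE : is_frame E c fx KE (@cube R j) FE.

Lemma frame_coords_continuous (A : set 'rV[R]_j) (d : 'rV[R]_j -> 'M[C]_(m, n)) :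
  A `<=` @cube R j -> hom_cont S E A c d ->
  {within A, continuous (fun v => FS v *m d v *m invmx (FE v))}.
Proof.
move=> Ac dc; apply/subspace_continuousP => v Av; set FF := within A (nbhs v).
have Yv := Yc v; have nS := nb_self S Yv; have nE := nb_self E Yv.
have [[uS _] cS] := frS (Ac v Av); have [[uE _] cE] := frE (Ac v Av).
have cS' := within_sub_cvg Ac (cS _ Yv nS); have cE' := within_sub_cvg Ac (cE _ Yv nE).
have dv := dc v Av _ Yv nS nE.
have alg w : nb S (c v) (c w) -> nb E (c v) (c w) -> FE w \in unitmx ->
    FS w *m d w *m invmx (FE w) =
    (FS w *m invmx (gauge S (c v) (c w))) *m coords S E (c v) (c w) (d w) *m
    invmx (FE w *m invmx (gauge E (c v) (c w))).
  move=> n1 n2 u2; have u1 := gauge_unit Yv n1.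
  have u3 : invmx (gauge E (c v) (c w)) \in unitmx by rewrite unitmx_inv (gauge_unit Yv n2).
  rewrite (invmxM u2 u3) invmxK /coords !mulmxA (mulmxKV u1).
  by rewrite (mulmxKV (gauge_unit Yv n2)).
suff : FS w *m d w *m invmx (FE w) @[w --> FF] --> FS v *m d v *m invmx (FE v) by [].
rewrite (alg v nS nE uE); apply: (@cvg_near_eq _ FF).
  have h1 := near_nb cc Yv nS; have h2 := near_nb cc Yv nE.
  apply: (@filterS2 _ (nbhs v) _ _ _ _ _ h1 h2) => w n1 n2 Aw; apply: alg => //.
  by have [[]] := frE (Ac w Aw).
apply: (@cvg_mulmx _ _ FF); last first.
  apply: (@cvg_invmx _ _ FF); first exact: cE'.
  by rewrite unitmx_mul uE unitmx_inv (gauge_unit Yv nE).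
by apply: (@cvg_mulmx _ _ FF); [exact: cS'|exact: dv].
Qed.

Lemma frame_tau_fixed v (d : 'M[C]_(m, n)) : cube v -> fx ->
  conjmx (FS v *m d *m invmx (FE v)) *m KE = KS *m (FS v *m d *m invmx (FE v)) <->
  hom_tau S E (c v) d = d.
Proof.
move=> cv fxT; have [[uS cS] _] := frS cv; have [[uE cE] _] := frE cv.
have tS := theta_unit S (Yc v); have tE := theta_unit E (Yc v).
have uS' : conjmx (FS v) \in unitmx by rewrite conjmx_unit.
have uE' : conjmx (FE v) \in unitmx by rewrite conjmx_unit.
have e1 : invmx (conjmx (FE v)) *m KE = theta E (c v) *m invmx (FE v).
  rewrite -[LHS](mulmxK uE) -[_ *m KE *m _]mulmxA -(cE fxT) mulmxA (mulVmx uE') mul1mx.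
  exact: erefl.
have lhs : conjmx (FS v *m d *m invmx (FE v)) *m KE =
    conjmx (FS v) *m (conjmx d *m theta E (c v)) *m invmx (FE v).
  by rewrite !conjmxM conjmxV -[LHS]mulmxA e1 !mulmxA.
have rhs : KS *m (FS v *m d *m invmx (FE v)) =
    conjmx (FS v) *m (theta S (c v) *m d) *m invmx (FE v).
  by rewrite !mulmxA -(cS fxT).
rewrite lhs rhs /hom_tau; split=> [h|h].
  have h1 : conjmx d *m theta E (c v) = theta S (c v) *m d.
    have := congr1 (fun A => invmx (conjmx (FS v)) *m (A *m FE v)) h.
    by rewrite !(mulmxKV uE) !(mulKmx uS').
  by rewrite -mulmxA h1 (mulKmx tS).
congr (_ *m _ *m _); rewrite -{2}h !mulmxA (mulmxV tS) mul1mx.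
exact: erefl.
Qed.

(** In frames over the cube a section along a cell becomes a continuous matrix function, and
    invariance under Theta becomes the condition [conjmx w *m KE = KS *m w] with constant
    matrices. *)
Lemma extension_by_frames (P : X -> 'M[C]_(m, n) -> Prop) (d : 'rV[R]_j -> 'M[C]_(m, n)) :
  (fx -> forall v, tau (c v) = c v) ->
  (forall u : 'rV[R]_j -> 'M[C]_(m, n), {within @sphere R j, continuous u} ->
    (forall v, sphere v -> P (c v) (invmx (FS v) *m u v *m FE v) /\
      (fx -> conjmx (u v) *m KE = KS *m u v)) ->
    exists w : 'rV[R]_j -> 'M[C]_(m, n),
    [/\ continuous w, forall v, sphere v -> w v = u v
      & forall v, closed_disc v -> P (c v) (invmx (FS v) *m w v *m FE v) /\
        (fx -> conjmx (w v) *m KE = KS *m w v)]) ->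
  continuous_section (hom_opens S E) (@sphere R j) c d ->
  (forall v, sphere v -> P (c v) (d v) /\ (fx -> hom_tau S E (c v) (d v) = d v)) ->
  exists d', [/\ continuous_section (hom_opens S E) (@closed_disc R j) c d',
    forall v, closed_disc v -> P (c v) (d' v) /\
      (fx -> hom_tau S E (c v) (d' v) = d' v)
    & forall v, sphere v -> d' v = d v].
Proof.
move=> fxc ext dc dP.
have dc' := (hom_sectionP S E (@sphere R j) d cc).1 dc.
pose u v := FS v *m d v *m invmx (FE v).
have uK v : cube v -> invmx (FS v) *m u v *m FE v = d v.
  move=> cv; have [[uS _] _] := frS cv; have [[uE _] _] := frE cv.
  by rewrite /u !mulmxA (mulVmx uS) mul1mx (mulmxKV uE).
have [|v sv|w [wc wu wD]] := ext u.
- by apply: frame_coords_continuous => //; exact: sphere_cube.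
- have cv := sphere_cube sv; have [Pd sd] := dP v sv.
  rewrite (uK v cv); split=> // fxT; apply/(frame_tau_fixed _ cv fxT); exact: sd.
pose d' v := invmx (FS v) *m w v *m FE v.
have d'K v : cube v -> FS v *m d' v *m invmx (FE v) = w v.
  move=> cv; have [[uS _] _] := frS cv; have [[uE _] _] := frE cv.
  by rewrite /d' !mulmxA (mulmxV uS) mul1mx (mulmxK uE).
exists d'; split; last first.
- by move=> v sv; rewrite /d' wu// uK//; exact: sphere_cube.
- move=> v dv; have [h1 h2] := wD v dv; split=> // fxT; have cv := disc_cube dv.
  by apply/(frame_tau_fixed _ cv fxT); rewrite (d'K v cv); exact: h2.
apply/(hom_sectionP S E (@closed_disc R j) d' cc).
apply: hom_cont_local => // v dv; have cv := disc_cube dv.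
have [[uS _] cS] := frS cv; have [[uE _] cE] := frE cv; have Yv := Yc v.
exists FS, FE; split=> //.
- have wc' : w @ within (@closed_disc R j) (nbhs v) --> FS v *m d' v *m invmx (FE v).
    by rewrite (d'K v cv); apply: cvg_within_filter; exact: wc.
  apply: (@cvg_near_eq _ (within (@closed_disc R j) (nbhs v)) _ _
    (fun v => FS v *m d' v *m invmx (FE v)) w).
    by apply: (@filterS _ (nbhs v) _ setT) => [z _ dz|]; [rewrite d'K//; exact: disc_cube|exact: filterT].
  exact: wc'.
- by apply: within_sub_cvg (cS _ Yv (nb_self S Yv)); exact: closed_disc_cube.
- by apply: within_sub_cvg (cE _ Yv (nb_self E Yv)); exact: closed_disc_cube.
Qed.
End extension.
End frames_and_extensions.

(** * Metrics *)

Section positive_definite.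
Variable R : realType.
Local Notation C := R[i].
Local Notation RC x := (real_complex R x).

Definition posdef n (g : 'M[C]_n) : Prop :=
  adj g = g /\ forall v : 'rV[C]_n, v != 0 -> 0 < (v *m g *m adj v) ord0 ord0.

Lemma posdef1 n : posdef (1%:M : 'M[C]_n).
Proof.
split=> [|v v0]; first exact: adj1.
rewrite mulmx1 mxE; have [i vi] : exists i, v ord0 i != 0.
  by move/matrix0Pn : v0 => [k [l]]; rewrite (ord1 k) => h; exists l.
have e l : v ord0 l * adj v l ord0 = RC (sqn (v ord0 l)).
  by rewrite !mxE mulrC mul_conj.
under eq_bigr do rewrite e.
rewrite -rmorph_sum ltcR (bigD1 i)//= ltr_wpDr//.
  by apply: sumr_ge0 => l _; exact: sqn_ge0.
rewrite lt_neqAle sqn_ge0 andbT eq_sym; apply: contra vi => /eqP h.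
by rewrite (sqn_eq0 h).
Qed.

Lemma posdef_congr n (g F : 'M[C]_n) : F \in unitmx -> posdef g -> posdef (F *m g *m adj F).
Proof.
move=> uF [gg gp]; split=> [|v v0]; first by rewrite !adjM adjK gg !mulmxA.
have e : v *m (F *m g *m adj F) *m adj v = (v *m F) *m g *m adj (v *m F).
  by rewrite adjM !mulmxA.
rewrite e; apply: gp; apply: contra v0 => /eqP h.
by rewrite -(mulmxK uF v) h mul0mx.
Qed.

Lemma posdef_conj n (g : 'M[C]_n) : posdef g -> posdef (conjmx g).
Proof.
move=> [gg gp]; split=> [|v v0]; first by rewrite -conj_adj gg.
have e : v *m conjmx g *m adj v = conjmx (conjmx v *m g *m adj (conjmx v)).
  by rewrite !conjmxM conjmxK conj_adj conjmxK.
rewrite e mxE; have p : 0 < (conjmx v *m g *m adj (conjmx v)) ord0 ord0.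
  by apply: gp; apply: contra v0 => /eqP h; rewrite -(conjmxK v) h /conjmx map_mx0.
by rewrite conj_Creal// gtr0_real.
Qed.

Lemma posdef_convex n (g h : 'M[C]_n) (t : R) : 0 <= t <= 1 -> posdef g -> posdef h ->
  posdef (RC t *: g + RC (1 - t) *: h).
Proof.
move=> /andP[t0 t1] [gg gp] [hh hp]; split=> [|v v0].
  rewrite adjD; have adjZ (r : R) (A : 'M[C]_n) : adj (RC r *: A) = RC r *: adj A.
    rewrite /adj conjmxZ linearZ /=; congr (_ *: _).
    by apply/eqP; rewrite eq_complex Re_conj Im_conj /= oppr0 !eqxx.
  by rewrite !adjZ gg hh.
rewrite mulmxDr mulmxDl -!scalemxAr -!scalemxAl mxE [X in X + _]mxE [X in _ + X]mxE.
have p1 := gp v v0; have p2 := hp v v0.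
have [t_0|t_0] := eqVneq t 0.
  by rewrite t_0 rmorph0 mul0r add0r subr0 rmorph1 mul1r.
have tp : 0 < RC t :> C by rewrite ltcR lt_neqAle eq_sym t_0.
apply: ltr_wpDr; last exact: mulr_gt0.
by apply: mulr_ge0; [rewrite lecR subr_ge0|exact: ltW].
Qed.
End positive_definite.

(** * Existence of equivariant sections and of equivariant metrics *)

Section existence.
Variables (R : realType) (X : involutive_space) (cw : Z2_CW R X) (d1 d0 : nat).
Hypothesis hfree : forall n : nat, free_cell cw n -> (n <= d1)%N.
Hypothesis hfixed : forall n : nat, fixed_cell cw n -> (n <= d0)%N.
Local Notation C := R[i].
Local Notation RC x := (real_complex R x).
Variable Y : set X.
Hypothesis oY : open Y.
Hypothesis cY : closed Y.
Hypothesis tauY : forall x, Y x -> Y (tau x).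

Lemma hom_section_exists m n (S : mbundle R Y m) (E : mbundle R Y n)
    (P : X -> 'M[C]_(m, n) -> Prop) :
  (forall x u, Y x -> P x u -> P (tau x) (hom_tau S E x u)) ->
  (forall j, (j <= d1)%N ->
     extends_over_disc R Y (hom_opens S E) (hom_tau S E) P j false) ->
  (forall j, (j <= d0)%N ->
     extends_over_disc R Y (hom_opens S E) (hom_tau S E) P j true) ->
  exists s : X -> 'M[C]_(m, n), hom_cont S E setT id s /\
    forall x, Y x -> P x (s x) /\ s (tau x) = hom_tau S E x (s x).
Proof.
move=> Pt ext1 ext0.
have sgP x u : Y x -> P x u ->
    P (tau x) (hom_tau S E x u) /\ hom_tau S E (tau x) (hom_tau S E x u) = u.
  by move=> Yx Pu; split; [exact: Pt|exact: hom_tauK].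
have sgC (j : nat) (c : 'rV[R]_j -> X) d : continuous c -> (forall v, Y (c v)) ->
    continuous_section (hom_opens S E) (@closed_disc R j) c d ->
    continuous_section (hom_opens S E) (@closed_disc R j) (tau (i:=X) \o c)
      (fun v => hom_tau S E (c v) (d v)).
  move=> cc Yc /(hom_sectionP S E _ _ cc) dc; apply/hom_sectionP.
    by move=> v; apply: (cvg_comp c (@tau X)); [exact: cc|exact: tau_continuous].
  exact: hom_tau_cont.
have noC (j : nat) : ((maxn d1 d0).+1 <= j)%N -> cell cw j -> False.
  by move=> jd [[/hfree e _]|/hfixed e]; lia.
have ef (j : nat) : free_cell cw j ->
    extends_over_disc R Y (hom_opens S E) (hom_tau S E) P j false.
  by move=> /hfree; exact: ext1.
have ex (j : nat) : fixed_cell cw j ->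
    extends_over_disc R Y (hom_opens S E) (hom_tau S E) P j true.
  by move=> /hfixed; exact: ext0.
have [s [sO sP]] := cw_section 0 oY cY tauY sgP sgC ef ex noC.
by exists s; split=> //; apply/hom_opens_cont.
Qed.

(** Positive definite forms are a convex set, so the cone with apex the identity extends a metric
    over a cell of any dimension. *)
Lemma metric_extends n (E : mbundle R Y n) j fx :
  extends_over_disc R Y (hom_opens E (mdual E tauY)) (hom_tau E (mdual E tauY))
    (fun _ g => posdef g) j fx.
Proof.
move=> c d cc Yc fxc dc dP.
(* [K] is unitary, so that the identity matrix is an equivariant form in this frame. *)
have [K [F [uK KK frE]]] : exists K F, [/\ K \in unitmx, invmx (adj K) = K
    & is_frame E c fx K (@cube R j) F].
  case: fx fxc {dP} => fxc; last first.
    have [F frE] := frame_free cc Yc E 1%:M; exists 1%:M, F.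
    by split=> //; [exact: unitmx1|rewrite adj1 invmx1].
  have [a na] := mbundle_even E (Yc 0) (fxc isT 0); subst n.
  have [F frE] := frame_fixed cc Yc E (fxc isT); exists (Jmx R a), F.
  have JJ := Jmx_unitary R a; have [u1 u2] := mulmx1_unit JJ.
  split=> //; apply: (can_inj (mulmxK u2)).
  by rewrite (mulVmx u2) JJ.
have frE' := dual_frame tauY cc Yc uK frE.
apply: (extension_by_frames cc Yc frE frE' (P := fun _ g => posdef g) fxc _ dc dP) => u uc uP.
have pdu v (A : 'M[C]_n) : cube v ->
    posdef (invmx (F v) *m A *m invmx (adj (F v))) <-> posdef A.
  move=> cv; have [[uF _] _] := frE v cv; rewrite -adjV; split=> [h|].
    have := posdef_congr uF h; rewrite !mulmxA (mulmxV uF) mul1mx -mulmxA -adjM.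
    by rewrite (mulmxV uF) adj1 mulmx1.
  by apply: posdef_congr; rewrite unitmx_inv.
have rE v : radial u 1%:M v = RC (nrm v) *: u (dirv v) + RC (1 - nrm v) *: 1%:M.
  by rewrite /radial scalerBr rmorphB/= scalerBl scale1r -addrA [- _ + _]addrC.
exists (radial u 1%:M); split.
- exact: continuous_radial.
- by move=> v sv; rewrite radial_sphere.
move=> v dv; have cv := disc_cube dv.
have v01 : 0 <= nrm v <= 1 by rewrite nrm_ge0; exact/closed_discE.
have [v0|v0] := eqVneq v 0.
  rewrite rE v0 nrm0 rmorph0 scale0r add0r subr0 rmorph1 scale1r; split.
    by apply/pdu; [rewrite -v0|exact: posdef1].
  by move=> fxT; rewrite KK conjmx1 mul1mx mulmx1.
have sd := dirv_sphere v0; have [h1 h2] := uP _ sd; split.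
  apply/(pdu _ _ cv); rewrite rE.
  exact: (posdef_convex v01 ((pdu _ _ (sphere_cube sd)).1 h1) (@posdef1 R n)).
move=> fxT; have {}h2 := h2 fxT; rewrite KK in h2 *.
have cr (r : R) : Num.conj (RC r) = RC r.
  by apply/eqP; rewrite eq_complex Re_conj Im_conj /= oppr0 !eqxx.
rewrite rE conjmxD !conjmxZ !cr conjmx1 mulmxDl -!scalemxAl h2 mul1mx mulmxDr.
by rewrite -!scalemxAr mulmx1.
Qed.

Lemma metric_exists n (E : mbundle R Y n) :
  exists g : X -> 'M[C]_n, hom_cont E (mdual E tauY) setT id g /\
    forall x, Y x -> posdef (g x) /\ g (tau x) = hom_tau E (mdual E tauY) x (g x).
Proof.
apply: (hom_section_exists (P := fun _ g => posdef g)) => [x u Yx pu|j _|j _]; [|exact: metric_extends..].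
have ut := theta_unit E Yx; rewrite /hom_tau /= -adjV.
by apply: posdef_congr; [rewrite unitmx_inv|exact: posdef_conj].
Qed.
End existence.

(** * Injective homomorphisms *)

Section direct_sums.
Variables (R : realType).
Local Notation C := R[i].
Local Notation RC x := (real_complex R x).

Definition bdiag m n (A : 'M[C]_m) (B : 'M[C]_n) : 'M[C]_(m + n) := block_mx A 0 0 B.

Lemma bdiagM m n (A A' : 'M[C]_m) (B B' : 'M[C]_n) :
  bdiag A B *m bdiag A' B' = bdiag (A *m A') (B *m B').
Proof. by rewrite /bdiag mulmx_block !mul0mx !mulmx0 !addr0 !add0r. Qed.

Lemma bdiag1 m n : bdiag 1%:M 1%:M = 1%:M :> 'M[C]_(m + n).
Proof. by rewrite /bdiag -scalar_mx_block. Qed.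

Lemma bdiagN m n (A : 'M[C]_m) (B : 'M[C]_n) : bdiag (- A) (- B) = - bdiag A B.
Proof. by rewrite /bdiag opp_block_mx !oppr0. Qed.

Lemma conj_bdiag m n (A : 'M[C]_m) (B : 'M[C]_n) :
  conjmx (bdiag A B) = bdiag (conjmx A) (conjmx B).
Proof. by rewrite /bdiag /conjmx map_block_mx !map_mx0. Qed.

Lemma bdiagVM m n (A : 'M[C]_m) (B : 'M[C]_n) : A \in unitmx -> B \in unitmx ->
  bdiag (invmx A) (invmx B) *m bdiag A B = 1%:M.
Proof. by move=> uA uB; rewrite bdiagM (mulVmx uA) (mulVmx uB) bdiag1. Qed.

Lemma bdiag_unit m n (A : 'M[C]_m) (B : 'M[C]_n) : A \in unitmx -> B \in unitmx ->
  bdiag A B \in unitmx.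
Proof. by move=> uA uB; have [] := mulmx1_unit (bdiagVM uA uB). Qed.

Lemma bdiagV m n (A : 'M[C]_m) (B : 'M[C]_n) : A \in unitmx -> B \in unitmx ->
  invmx (bdiag A B) = bdiag (invmx A) (invmx B).
Proof.
move=> uA uB; have u := bdiag_unit uA uB.
by apply: (can_inj (mulmxK u)); rewrite (mulVmx u) (bdiagVM uA uB).
Qed.

Lemma cvg_bdiag (T : Type) (F : set_system T) (FF : Filter F) m n
    (f : T -> 'M[C]_m) (g : T -> 'M[C]_n) (A : 'M[C]_m) (B : 'M[C]_n) :
  f @ F --> A -> g @ F --> B -> bdiag (f t) (g t) @[t --> F] --> bdiag A B.
Proof.
by move=> fA gB; apply: cvg_col_mx; apply: cvg_row_mx => //; exact: cvg_cst.
Qed.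

Lemma row_free_transform m n (U : 'M[C]_m) (A : 'M[C]_(m, n)) (V : 'M[C]_n) :
  U \in unitmx -> V \in unitmx -> row_free A -> row_free (U *m A *m V).
Proof.
move=> uU uV /row_freeP[B AB]; apply/row_freeP; exists (invmx V *m B *m invmx U).
by rewrite !mulmxA (mulmxK uV) -[U *m A *m B]mulmxA AB mulmx1 (mulmxV uU).
Qed.

Lemma row_free_conj m n (A : 'M[C]_(m, n)) : row_free A -> row_free (conjmx A).
Proof.
move=> /row_freeP[B AB]; apply/row_freeP; exists (conjmx B).
by rewrite -conjmxM AB conjmx1.
Qed.

Lemma pencil_transform b m n (U : 'M[C]_m) (A B : 'M[C]_(m, n)) (V : 'M[C]_n) :
  U \in unitmx -> V \in unitmx -> pencil b A B -> pencil b (U *m A *m V) (U *m B *m V).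
Proof.
move=> uU uV AB t t01; have := row_free_transform uU uV (AB t t01).
by rewrite mulmxDr mulmxDl -!scalemxAr -!scalemxAl.
Qed.

Lemma conj_RC (r : R) : Num.conj (RC r) = RC r.
Proof. by apply/eqP; rewrite eq_complex Re_conj Im_conj /= oppr0 !eqxx. Qed.

Lemma pencil_conj b m n (A B : 'M[C]_(m, n)) : pencil b A B -> pencil b (conjmx A) (conjmx B).
Proof.
move=> AB t t01; have := row_free_conj (AB t t01).
by rewrite conjmxD !conjmxZ !conj_RC.
Qed.

Variables (X : involutive_space) (Y : set X).

Section msum.
Variables (m n : nat) (E1 : mbundle R Y m) (E2 : mbundle R Y n).

Definition msum : mbundle R Y (m + n).
Proof.
apply: (@MBundle R X Y (m + n) (fun x => nb E1 x `&` nb E2 x)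
  (fun x y => bdiag (gauge E1 x y) (gauge E2 x y))
  (fun x => bdiag (theta E1 x) (theta E2 x))).
- by move=> x Yx; apply: openI; exact: nb_open.
- by move=> x Yx; split; exact: nb_self.
- by move=> x Yx y [/(nb_sub Yx)].
- by move=> x y Yx [n1 n2]; apply: bdiag_unit; apply: gauge_unit.
- move=> x x' y Yx Yx' [n1 n2] [n1' n2'].
  have alg z : nb E1 x' z -> nb E2 x' z ->
      bdiag (gauge E1 x z) (gauge E2 x z) *m invmx (bdiag (gauge E1 x' z) (gauge E2 x' z)) =
      bdiag (gauge E1 x z *m invmx (gauge E1 x' z)) (gauge E2 x z *m invmx (gauge E2 x' z)).
    by move=> h1 h2; rewrite (bdiagV (gauge_unit Yx' h1) (gauge_unit Yx' h2)) bdiagM.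
  rewrite (alg y n1' n2'); apply: (@cvg_near_eq _ (nbhs y)).
    have h1 : nbhs y (nb E1 x') by apply: open_nbhs_nbhs; split=> //; exact: nb_open.
    have h2 : nbhs y (nb E2 x') by apply: open_nbhs_nbhs; split=> //; exact: nb_open.
    exact: (@filterS2 _ (nbhs y) _ _ _ _ alg h1 h2).
  by apply: (@cvg_bdiag _ (nbhs y)); exact: gauge_cvg.
- by move=> x Yx; rewrite conj_bdiag bdiagM !theta_sq// bdiagN bdiag1.
- move=> x x' y Yx Yx' [n1 n2] [n1' n2'].
  have alg z : nb E1 x' (tau z) -> nb E2 x' (tau z) ->
      conjmx (bdiag (gauge E1 x z) (gauge E2 x z)) *m bdiag (theta E1 z) (theta E2 z) *m
        invmx (bdiag (gauge E1 x' (tau z)) (gauge E2 x' (tau z))) =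
      bdiag (conjmx (gauge E1 x z) *m theta E1 z *m invmx (gauge E1 x' (tau z)))
        (conjmx (gauge E2 x z) *m theta E2 z *m invmx (gauge E2 x' (tau z))).
    move=> h1 h2; rewrite (bdiagV (gauge_unit Yx' h1) (gauge_unit Yx' h2)) conj_bdiag.
    by rewrite !bdiagM.
  rewrite (alg y n1' n2'); apply: (@cvg_near_eq _ (nbhs y)).
    have h k (E : mbundle R Y k) : nb E x' (tau y) -> nbhs y ((@tau X) @^-1` nb E x').
      move=> nE; apply: tau_continuous; apply: open_nbhs_nbhs.
      by split=> //; exact: nb_open.
    exact: (@filterS2 _ (nbhs y) _ _ _ _ alg (h _ _ n1') (h _ _ n2')).
  by apply: (@cvg_bdiag _ (nbhs y)); exact: theta_cvg.
Defined.

Lemma msum_frame j (c : 'rV[R]_j -> X) fx K1 K2 B F1 F2 :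
  continuous c -> is_frame E1 c fx K1 B F1 -> is_frame E2 c fx K2 B F2 ->
  is_frame msum c fx (bdiag K1 K2) B (fun v => bdiag (F1 v) (F2 v)).
Proof.
move=> cc f1 f2 v Bv; have [[u1 e1] c1] := f1 v Bv; have [[u2 e2] c2] := f2 v Bv.
split; [split|].
- exact: bdiag_unit.
- by move=> fxT; rewrite conj_bdiag /= !bdiagM (e1 fxT) (e2 fxT).
move=> x Yx [n1 n2] /=; set FF := within B (nbhs v).
have alg w : nb E1 x (c w) -> nb E2 x (c w) ->
   bdiag (F1 w) (F2 w) *m invmx (bdiag (gauge E1 x (c w)) (gauge E2 x (c w))) =
   bdiag (F1 w *m invmx (gauge E1 x (c w))) (F2 w *m invmx (gauge E2 x (c w))).
  by move=> h1 h2; rewrite (bdiagV (gauge_unit Yx h1) (gauge_unit Yx h2)) bdiagM.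
rewrite (alg v n1 n2); apply: (@cvg_near_eq _ FF).
  have h1 := near_nb cc Yx n1; have h2 := near_nb cc Yx n2.
  by apply: cvg_within; exact: (@filterS2 _ (nbhs v) _ _ _ _ alg h1 h2).
by apply: (@cvg_bdiag _ FF); [exact: c1|exact: c2].
Qed.
End msum.
End direct_sums.

(** * Injective homomorphisms from general position over all cells *)

Section injective_homs.
Variables (R : realType) (X : involutive_space) (cw : Z2_CW R X) (d1 d0 : nat).
Hypothesis hfree : forall n : nat, free_cell cw n -> (n <= d1)%N.
Hypothesis hfixed : forall n : nat, fixed_cell cw n -> (n <= d0)%N.
Local Notation C := R[i].
Local Notation RC x := (real_complex R x).
Variable Y : set X.
Hypothesis oY : open Y.
Hypothesis cY : closed Y.
Hypothesis tauY : forall x, Y x -> Y (tau x).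

Lemma hom_cont0 m n (S : mbundle R Y m) (E : mbundle R Y n) (T : topologicalType)
  (A : set T) (c : T -> X) : hom_cont S E A c (fun=> 0).
Proof.
move=> z Az x Yx n1 n2; rewrite /coords mulmx0 mul0mx.
under eq_fun do rewrite mulmx0 mul0mx; exact: cvg_cst.
Qed.

Lemma tau0_row_free m n (S : mbundle R Y m) (E : mbundle R Y n) x u :
  Y x -> row_free u -> row_free (hom_tau S E x u).
Proof.
move=> Yx fu; have tS := theta_unit S Yx; have tE := theta_unit E Yx.
by apply: row_free_transform; [rewrite unitmx_inv|exact: tE|exact: row_free_conj].
Qed.

(** Over a fixed cell the rank is even. The statement keeps [m] and hides its half, so that it
    serves bundles of several ranks at once without a change of types. *)
Lemma quaternionic_frame j m (E : mbundle R Y m) (c : 'rV[R]_j -> X) :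
  continuous c -> (forall v, Y (c v)) -> (forall v, tau (c v) = c v) ->
  exists K F, [/\ is_frame E c true K (@cube R j) F, conjmx K = K, K *m K = - 1%:M
    & forall (b : bool) n (q : 'M[C]_n) (B : 'M[C]_(m, n)),
      (forall a, m = (a + a)%N -> (j + b + ((a.-1 + a.-1) + (a.-1 + a.-1)) < n + n)%N) ->
      conjmx q *m q = - 1%:M -> (b -> row_free B) -> conjmx B *m q = K *m B ->
      perturbable j (fun A => conjmx A *m q = K *m A) b B].
Proof.
move=> cc Yc fxc; have [a am] := mbundle_even E (Yc 0) (fxc 0); subst m.
have [F frE] := frame_fixed cc Yc E fxc; exists (Jmx R a), F; split=> //.
- exact: Jmx_conj.
- exact: Jmx_sq.
move=> b n q B dim qq fB qB; apply: perturbable_quaternionic => //.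
exact: dim.
Qed.

(** For [m = 0] the truncated [m.-1] does not express the codimension; this case is separate, and
    there the zero map is injective. *)
Lemma row_free_hom_exists m n (S : mbundle R Y m) (E : mbundle R Y n) :
  (m = 0%N \/ (d1 + (m.-1 + m.-1) < n + n)%N) ->
  (forall a, m = (a + a)%N ->
     m = 0%N \/ (d0 + ((a.-1 + a.-1) + (a.-1 + a.-1)) < n + n)%N) ->
  exists u : X -> 'M[C]_(m, n), hom_cont S E setT id u /\
    forall x, Y x -> row_free (u x) /\ u (tau x) = hom_tau S E x (u x).
Proof.
move=> dim1 dim0; have [m0|m0] := eqVneq m 0%N.
  exists (fun=> 0); split; first exact: hom_cont0.
  move=> x Yx; rewrite /hom_tau /conjmx map_mx0 mulmx0 mul0mx; split=> //.
  by rewrite /row_free mxrank0 m0.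
apply: (hom_section_exists hfree hfixed oY cY tauY (P := fun _ u => row_free u)) => [x u|j jd|j jd].
- exact: tau0_row_free.
- move=> c d cc Yc fxc dc dP.
  have [FS frS] := frame_free cc Yc S 1%:M; have [FE frE] := frame_free cc Yc E 1%:M.
  apply: (extension_by_frames cc Yc frS frE (P := fun _ u => row_free u) fxc _ dc dP) => u uc uP.
  have pert : perturbable j (fun _ : 'M[C]_(m, n) => True) false 0.
    by apply: perturbable_complex => //; case: dim1 => [m00|]; [rewrite m00 in m0|lia].
  have uS v : sphere v -> True /\ row_free (u v).
    move=> sv; have [h _] := uP v sv; split=> //.
    have [[u1 _] _] := frS v (sphere_cube sv); have [[u2 _] _] := frE v (sphere_cube sv).
    have u2' : invmx (FE v) \in unitmx by rewrite unitmx_inv.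
    have := row_free_transform u1 u2' h.
    by rewrite !mulmxA (mulmxV u1) mul1mx (mulmxK u2).
  have [w [wc wS wD]] := extend_row_free pert I (fun _ _ _ => I) uc uS.
  exists w; split=> // v dv; split=> //; have [_ fw] := wD v dv.
  have cv := disc_cube dv; have [[u1 _] _] := frS v cv; have [[u2 _] _] := frE v cv.
  by apply: row_free_transform; rewrite ?unitmx_inv.
move=> c d cc Yc fxc dc dP.
have [KS [FS [frS KSc KS2 pertS]]] := quaternionic_frame S cc Yc (fxc isT).
have [KE [FE [frE KEc KE2 _]]] := quaternionic_frame E cc Yc (fxc isT).
apply: (extension_by_frames cc Yc frS frE (P := fun _ u => row_free u) fxc _ dc dP) => u uc uP.
pose St (A : 'M[C]_(m, n)) := conjmx A *m KE = KS *m A.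
have pert : perturbable j St false 0.
  apply: pertS => //; last by rewrite /conjmx map_mx0 mul0mx mulmx0.
    by move=> a /dim0[m00|]; [rewrite m00 in m0|lia].
  by rewrite KEc.
have uS v : sphere v -> St (u v) /\ row_free (u v).
  move=> sv; have [h h2] := uP v sv; split; first exact: h2.
  have [[u1 _] _] := frS v (sphere_cube sv); have [[u2 _] _] := frE v (sphere_cube sv).
  have u2' : invmx (FE v) \in unitmx by rewrite unitmx_inv.
  have := row_free_transform u1 u2' h.
  by rewrite !mulmxA (mulmxV u1) mul1mx (mulmxK u2).
have St0 : St 0 by rewrite /St /conjmx map_mx0 mul0mx mulmx0.
have StZ (r : R) A : St A -> St (RC r *: A).
  by rewrite /St conjmxZ conj_RC -scalemxAl -scalemxAr => ->.
have [w [wc wS wD]] := extend_row_free pert St0 StZ uc uS.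
exists w; split=> // v dv; have [Sw fw] := wD v dv; split=> //.
have cv := disc_cube dv; have [[u1 _] _] := frS v cv; have [[u2 _] _] := frE v cv.
by apply: row_free_transform; rewrite ?unitmx_inv.
Qed.

Definition incl k m : 'M[C]_(m, k + m) := row_mx 0 1%:M.

Lemma incl_bdiag k m (A : 'M[C]_k) (B : 'M[C]_m) : incl k m *m bdiag A B = B *m incl k m.
Proof.
rewrite /incl /bdiag mul_row_block mul_mx_row !mul0mx !mul1mx !mulmx0 mulmx1.
by rewrite !add0r.
Qed.

Lemma incl_row_free k m : row_free (incl k m).
Proof.
apply/row_freeP; exists (incl k m)^T.
by rewrite /incl tr_row_mx trmx0 trmx1 mul_row_col mulmx0 mulmx1 add0r.
Qed.

Lemma conj_incl k m : conjmx (incl k m) = incl k m.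
Proof. by rewrite /incl /conjmx map_row_mx map_mx0 map_mx1. Qed.

Lemma incl_tau k m (F : mbundle R Y k) (S : mbundle R Y m) x : Y x ->
  invmx (theta S x) *m incl k m *m theta (msum F S) x = incl k m.
Proof.
move=> Yx; rewrite -mulmxA incl_bdiag mulmxA (mulVmx (theta_unit S Yx)).
exact: mul1mx.
Qed.

Lemma incl_frame k m (A : 'M[C]_k) (B : 'M[C]_m) : A \in unitmx -> B \in unitmx ->
  B *m incl k m *m invmx (bdiag A B) = incl k m.
Proof.
move=> uA uB; rewrite (bdiagV uA uB) -mulmxA incl_bdiag mulmxA (mulmxV uB).
exact: mul1mx.
Qed.

Lemma incl_frameV k m (A : 'M[C]_k) (B : 'M[C]_m) : A \in unitmx -> B \in unitmx ->
  invmx B *m incl k m *m bdiag A B = incl k m.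
Proof.
move=> uA uB; rewrite -mulmxA incl_bdiag mulmxA (mulVmx uB).
exact: mul1mx.
Qed.

Section cancellation.
Variables (k m : nat) (F1 F2 : mbundle R Y k) (S : mbundle R Y m).
Let E1 := msum F1 S.
Let E2 := msum F2 S.
Variable Phi : X -> 'M[C]_(k + m).
Hypothesis Phi_cont : hom_cont E1 E2 setT id Phi.
Hypothesis Phi_unit : forall x, Y x -> Phi x \in unitmx.
Hypothesis Phi_tau : forall x, Y x -> Phi (tau x) = hom_tau E1 E2 x (Phi x).

Let P x (u : 'M[C]_(m, k + m)) : Prop :=
  pencil true u (incl k m) /\ pencil true (u *m invmx (Phi x)) (incl k m).

Let P_tau x u : Y x -> P x u -> P (tau x) (hom_tau S E2 x u).
Proof.
move=> Yx [p1 p2]; have tS := theta_unit S Yx.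
have t1 := theta_unit E1 Yx; have t2 := theta_unit E2 Yx.
have tS' : invmx (theta S x) \in unitmx by rewrite unitmx_inv.
split.
  have := pencil_transform tS' t2 (pencil_conj p1).
  by rewrite conj_incl incl_tau.
have := pencil_transform tS' t1 (pencil_conj p2); rewrite conj_incl (incl_tau F1 S Yx).
suff -> : hom_tau S E2 x u *m invmx (Phi (tau x)) =
    invmx (theta S x) *m conjmx (u *m invmx (Phi x)) *m theta E1 x by [].
have uP : conjmx (Phi x) \in unitmx by rewrite conjmx_unit Phi_unit.
have t1' : invmx (theta E1 x) \in unitmx by rewrite unitmx_inv; exact: t1.
have uu : invmx (theta E1 x) *m conjmx (Phi x) \in unitmx by rewrite unitmx_mul t1'.
rewrite (Phi_tau Yx) /hom_tau (invmxM uu t2) (invmxM t1' uP) invmxK.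
by rewrite conjmxM conjmxV !mulmxA (mulmxK t2).
Qed.

Let comp_cont j (c : 'rV[R]_j -> X) : continuous c -> hom_cont E1 E2 (@cube R j) c (fun v => Phi (c v)).
Proof.
move=> cc z _ x Yx n1 n2; have h := Phi_cont I Yx n1 n2.
apply: (cvg_comp c (fun y => coords E1 E2 x y (Phi y)) (G := nbhs (c z))).
  by apply: cvg_within_filter; exact: cc.
move=> W nW; have h' := h W nW.
by apply: (@filterS _ (nbhs (c z)) _ _ _ _ h') => y; apply.
Qed.

(** In frames [Phi] becomes a matrix function [Q], extended to the whole space by the retraction,
    and [extend_pencil] applies with the inverse of [Q] as change of coordinates. Both targets are
    the inclusion, whose matrix is the same in all block diagonal frames. *)
Let local_extension j (fx : bool) (c : 'rV[R]_j -> X) (d : 'rV[R]_j -> 'M[C]_(m, k + m))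
    (K1 K2 : 'M[C]_k) (KS : 'M[C]_m) G1 G2 FS :
  continuous c -> (forall v, Y (c v)) -> (fx -> forall v, tau (c v) = c v) ->
  is_frame F1 c fx K1 (@cube R j) G1 -> is_frame F2 c fx K2 (@cube R j) G2 ->
  is_frame S c fx KS (@cube R j) FS ->
  (fx -> conjmx KS = KS) ->
  perturbable j (fun A : 'M[C]_(m, k + m) => fx -> conjmx A *m bdiag K2 KS = KS *m A)
    true (incl k m) ->
  continuous_section (hom_opens S E2) (@sphere R j) c d ->
  (forall v, sphere v -> P (c v) (d v) /\ (fx -> hom_tau S E2 (c v) (d v) = d v)) ->
  exists d', [/\ continuous_section (hom_opens S E2) (@closed_disc R j) c d',
    forall v, closed_disc v -> P (c v) (d' v) /\
      (fx -> hom_tau S E2 (c v) (d' v) = d' v)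
    & forall v, sphere v -> d' v = d v].
Proof.
move=> cc Yc fxc f1 f2 fS KSc pert dc dP.
have fr1 := msum_frame cc f1 fS; have fr2 := msum_frame cc f2 fS.
apply: (extension_by_frames cc Yc fS fr2 (P := P) fxc _ dc dP) => u uc uP.
pose D1 v := bdiag (G1 v) (FS v); pose D2 v := bdiag (G2 v) (FS v).
pose Q0 v := D1 v *m Phi (c v) *m invmx (D2 v).
have uD1 v : cube v -> D1 v \in unitmx by move=> cv; have [[]] := fr1 v cv.
have uD2 v : cube v -> D2 v \in unitmx by move=> cv; have [[]] := fr2 v cv.
have uG1 v : cube v -> G1 v \in unitmx by move=> cv; have [[]] := f1 v cv.
have uG2 v : cube v -> G2 v \in unitmx by move=> cv; have [[]] := f2 v cv.
have uFS v : cube v -> FS v \in unitmx by move=> cv; have [[]] := fS v cv.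
have uPhi v : Phi (c v) \in unitmx by apply: Phi_unit; exact: Yc.
have uQ0 v : cube v -> Q0 v \in unitmx.
  by move=> cv; rewrite /Q0 !unitmx_mul unitmx_inv uD1// uD2// uPhi.
have Q0c := frame_coords_continuous cc Yc fr1 fr2 (fun _ h => h) (comp_cont cc).
have rcube v : cube (@retr R j v) by apply: disc_cube; exact: retr_disc.
pose Q v := Q0 (retr v).
have Qc : continuous Q.
  move=> v; have h := (subspace_continuousP _ _).1 Q0c _ (rcube v).
  apply: (cvg_comp (@retr R j) Q0 _ h) => W nW.
  apply: (@filterS _ (nbhs v) _ _ _ _ (@retr_continuous R j v _ nW)) => z h1.
  exact: h1 (rcube z).
pose PP v := invmx (Q v).
have uQ v : Q v \in unitmx by apply: uQ0.
have PPc : continuous PP.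
  by move=> v; apply: (@cvg_invmx _ _ (nbhs v)); [exact: Qc|exact: uQ].
have QP v : Q v *m PP v = 1%:M by exact: mulmxV.
have Qst v : fx -> conjmx (Q v) *m bdiag K2 KS = bdiag K1 KS *m Q v.
  move=> fxT; apply/(frame_tau_fixed Yc fr1 fr2 _ (rcube v) fxT).
  by rewrite -Phi_tau ?(fxc fxT).
have Pst v : fx -> conjmx (PP v) *m bdiag K1 KS = bdiag K2 KS *m PP v.
  move=> fxT; have uQc : conjmx (Q v) \in unitmx by rewrite conjmx_unit.
  rewrite /PP conjmxV -[LHS](mulmxK (uQ v)) -[_ *m bdiag K1 KS *m _]mulmxA -(Qst v fxT).
  by rewrite mulmxA (mulVmx uQc) mul1mx.
pose St (A : 'M[C]_(m, k + m)) := fx -> conjmx A *m bdiag K2 KS = KS *m A.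
pose St' (A : 'M[C]_(m, k + m)) := fx -> conjmx A *m bdiag K1 KS = KS *m A.
have StP v A : St A -> St' (A *m PP v).
  move=> h fxT; rewrite conjmxM -mulmxA (Pst v fxT) mulmxA (h fxT) mulmxA.
  exact: erefl.
have StQ v A : St' A -> St (A *m Q v).
  move=> h fxT; rewrite conjmxM -mulmxA (Qst v fxT) mulmxA (h fxT) mulmxA.
  exact: erefl.
have StL (r s : R) A A' : St' A -> St' A' -> St' (RC r *: A + RC s *: A').
  move=> h h' fxT; rewrite conjmxD !conjmxZ !conj_RC mulmxDl -!scalemxAl (h fxT) (h' fxT).
  by rewrite mulmxDr -!scalemxAr.
have St'i : St' (incl k m).
  by move=> fxT; rewrite conj_incl incl_bdiag.
have link v : cube v -> invmx (FS v) *m u v *m D2 v *m invmx (Phi (c v)) =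
    invmx (FS v) *m (u v *m (D2 v *m invmx (Phi (c v)) *m invmx (D1 v))) *m D1 v.
  move=> cv; rewrite !mulmxA (mulmxKV (uD1 v cv)).
  exact: erefl.
have Q0V v : cube v -> D2 v *m invmx (Phi (c v)) *m invmx (D1 v) = invmx (Q0 v).
  move=> cv; have u1 : D1 v *m Phi (c v) \in unitmx by rewrite unitmx_mul uD1// uPhi.
  have u2 : invmx (D2 v) \in unitmx by rewrite unitmx_inv uD2.
  by rewrite /Q0 (invmxM u1 u2) (invmxM (uD1 v cv) (uPhi v)) invmxK !mulmxA.
have PE v (A : 'M[C]_(m, k + m)) : cube v ->
    P (c v) (invmx (FS v) *m A *m D2 v) <->
    pencil true A (incl k m) /\ pencil true (A *m invmx (Q0 v)) (incl k m).
  move=> cv; have i1 := incl_frame (uG1 v cv) (uFS v cv).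
  have i2 := incl_frame (uG2 v cv) (uFS v cv).
  have j1 := incl_frameV (uG1 v cv) (uFS v cv).
  have j2 := incl_frameV (uG2 v cv) (uFS v cv).
  have uFS' : invmx (FS v) \in unitmx by rewrite unitmx_inv uFS.
  have uD1' : invmx (D1 v) \in unitmx by rewrite unitmx_inv uD1.
  have uD2' : invmx (D2 v) \in unitmx by rewrite unitmx_inv uD2.
  have lk : invmx (FS v) *m A *m D2 v *m invmx (Phi (c v)) =
      invmx (FS v) *m (A *m invmx (Q0 v)) *m D1 v.
    by rewrite -(Q0V v cv) !mulmxA (mulmxKV (uD1 v cv)).
  have back (D : 'M[C]_(k + m)) (A' : 'M[C]_(m, k + m)) : D \in unitmx ->
      FS v *m (invmx (FS v) *m A' *m D) *m invmx D = A'.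
    by move=> uD; rewrite !mulmxA (mulmxV (uFS v cv)) mul1mx (mulmxK uD).
  rewrite /P lk; split=> -[p1 p2]; split.
  - by have := pencil_transform (uFS v cv) uD2' p1; rewrite (back _ _ (uD2 v cv)) i2.
  - by have := pencil_transform (uFS v cv) uD1' p2; rewrite (back _ _ (uD1 v cv)) i1.
  - by rewrite -j2; exact: pencil_transform uFS' (uD2 v cv) p1.
  - by rewrite -j1; exact: pencil_transform uFS' (uD1 v cv) p2.
have uS v : sphere v -> [/\ St (u v), pencil true (u v) (incl k m)
    & pencil true (u v *m PP v) (incl k m)].
  move=> sv; have cv := sphere_cube sv; have [h1 h2] := uP v sv.
  have [p1 p2] := (PE v (u v) cv).1 h1.
  have PPE : PP v = invmx (Q0 v) by rewrite /PP /Q (retr_id (sphere_disc sv)).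
  by split; [exact: h2|exact: p1|rewrite PPE; exact: p2].
have [w [wc wS wD]] := extend_pencil pert PPc Qc QP StP StQ StL (incl_row_free k m) St'i uc uS.
exists w; split; [exact: wc|exact: wS|move=> v dv].
have cv := disc_cube dv; have [h1 h2 h3] := wD v dv.
split; last exact: h1.
have PPE : PP v = invmx (Q0 v) by rewrite /PP /Q (retr_id dv).
by apply/(PE v (w v) cv); split; [exact: h2|rewrite -PPE; exact: h3].
Qed.

Lemma pencil_hom_exists :
  (m = 0%N \/ (d1 + 1 + (m.-1 + m.-1) < (k + m) + (k + m))%N) ->
  (forall a, m = (a + a)%N ->
     m = 0%N \/ (d0 + 1 + ((a.-1 + a.-1) + (a.-1 + a.-1)) < (k + m) + (k + m))%N) ->
  exists u : X -> 'M[C]_(m, k + m), hom_cont S E2 setT id u /\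
    forall x, Y x -> [/\ pencil true (u x) (incl k m),
      pencil true (u x *m invmx (Phi x)) (incl k m)
      & u (tau x) = hom_tau S E2 x (u x)].
Proof.
move=> dim1 dim0; have [m0|m0] := eqVneq m 0%N.
  exists (fun=> 0); split; first exact: hom_cont0.
  have rf (A : 'M[C]_(m, k + m)) : row_free A.
    by rewrite /row_free eqn_leq rank_leq_row [X in (X <= _)%N]m0.
  move=> x Yx; rewrite /hom_tau /conjmx map_mx0 mulmx0 mul0mx.
  by split=> // t _; exact: rf.
suff [u [uc uP]] : exists u : X -> 'M[C]_(m, k + m), hom_cont S E2 setT id u /\
    forall x, Y x -> P x (u x) /\ u (tau x) = hom_tau S E2 x (u x).
  by exists u; split=> // x Yx; have [[? ?] ?] := uP x Yx.
apply: (hom_section_exists hfree hfixed oY cY tauY (P := P)) => [x u|j jd|j jd].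
- exact: P_tau.
- move=> c d cc Yc fxc dc dP.
  have [G1 f1] := frame_free cc Yc F1 1%:M; have [G2 f2] := frame_free cc Yc F2 1%:M.
  have [FS fS] := frame_free cc Yc S 1%:M.
  apply: (local_extension cc Yc fxc f1 f2 fS _ _ dc dP) => //.
  move=> w wc _ wS eps eps0.
  have jb : (j + true + (m.-1 + m.-1) < (k + m) + (k + m))%N.
    by case: dim1 => [m00|]; [rewrite m00 in m0|lia].
  have [w' [h1 _ h2 h3]] := perturbable_complex jb (fun=> incl_row_free k m) wc (fun=> I) wS eps0.
  by exists w'; split.
move=> c d cc Yc fxc dc dP.
have [K1 [G1 [f1 K1c K12 _]]] := quaternionic_frame F1 cc Yc (fxc isT).
have [K2 [G2 [f2 K2c K22 _]]] := quaternionic_frame F2 cc Yc (fxc isT).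
have [KS [FS [fS KSc KS2 pertS]]] := quaternionic_frame S cc Yc (fxc isT).
apply: (local_extension cc Yc fxc f1 f2 fS _ _ dc dP) => //.
have pert : perturbable j (fun A => conjmx A *m bdiag K2 KS = KS *m A) true (incl k m).
  apply: pertS.
  - by move=> a /dim0[m00|]; [rewrite m00 in m0|lia].
  - by rewrite conj_bdiag K2c KSc bdiagM K22 KS2 bdiagN bdiag1.
  - by move=> _; exact: incl_row_free.
  - by rewrite conj_incl incl_bdiag.
move=> w wc Stw wS eps eps0.
have [w' [h1 h2 h3 h4]] := pert w wc (fun v => Stw v isT) wS eps eps0.
by exists w'; split=> // v _; exact: h2.
Qed.
End cancellation.
End injective_homs.

(** * Transport along injective segments *)

Section compact_infimum.
Variables (R : realType) (T : topologicalType) (K : set T) (t0 : T).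
Hypothesis cK : compact K.
Hypothesis K0 : K t0.

Lemma inf_compact_gt0 (f : T -> R) :
  (forall t, K t -> 0 < f t) -> (forall t, K t -> f s @[s --> t] --> f t) ->
  0 < inf (f @` K).
Proof.
move=> fp fc; have /compact_near_coveringP cov := cK.
have near_gt t : K t -> \forall s \near t & e \near (0 : R)^'+, e < f s.
  move=> Kt; have ft := fp t Kt.
  exists ([set s | f t / 2 < f s], [set e | e < f t / 2]) => /=.
    split=> /=; last by apply: nbhs_right_lt; lra.
    by apply: cvgr_gt (fc t Kt) _ _; lra.
  by move=> [s e] [/= h1 h2]; exact: lt_trans h2 h1.
have [e [e0 he]] : exists e : R, 0 < e /\ K `<=` [set s | e < f s].
  have h := cov R (0 : R)^'+ (fun e s => e < f s) _ near_gt.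
  near (0 : R)^'+ => e; exists e; split; last by near: e; exact: h.
  by near: e; exact: nbhs_right_gt.
apply: lt_le_trans e0 _; apply: lb_le_inf; first by exists (f t0), t0.
by move=> _ [s Ks <-]; exact/ltW/he.
Unshelve. all: by end_near. Qed.

(** By compactness of [K], the functions [f y] are uniformly close to [f x] on [K] for [y] near
    [x]. *)
Lemma inf_compact_cvg (X : topologicalType) (f : X -> T -> R) (x : X) :
  (forall y t, 0 <= f y t) ->
  (forall t, K t -> f p.1 p.2 @[p --> (x, t)] --> f x t) ->
  inf (f y @` K) @[y --> x] --> inf (f x @` K).
Proof.
move=> f0 fc; have /compact_near_coveringP cov := cK.
have hi y : has_inf (f y @` K).
  by split; [exists (f y t0), t0|exists 0 => _ [s _ <-]].
apply/cvgrPdist_le => e e0.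
have near_le t : K t -> \forall s \near t & y \near x, `|f x s - f y s| <= e.
  move=> Kt; have e20 : 0 < e / 2 by lra.
  have /cvgrPdist_le/(_ _ e20)[[A B] [/= nA nB] AB] := fc t Kt.
  exists (B, A) => //= -[s y] [/= Bs Ay].
  have h1 := AB (x, s) (conj (nbhs_singleton nA) Bs); have h2 := AB (y, s) (conj Ay Bs).
  move: h1 h2 => /=; rewrite !ler_norml => /andP[? ?] /andP[? ?]; apply/andP; split; lra.
have h := cov X (nbhs x) (fun y s => `|f x s - f y s| <= e) (nbhs_filter x) near_le.
apply: (@filterS _ (nbhs x) _ _ _ _ h) => y {}h.
have half (a b : X) : (forall s, K s -> f a s - e <= f b s) ->
    inf (f a @` K) - e <= inf (f b @` K).
  move=> ab; apply: lb_le_inf; first by exists (f b t0), t0.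
  move=> _ [s Ks <-]; apply: le_trans (ab s Ks); rewrite lerD2r.
  by apply: ge_inf; [exact: (hi a).2|exists s].
have h1 : inf (f x @` K) - e <= inf (f y @` K).
  by apply: half => s Ks; have := h s Ks; rewrite ler_norml => /andP[_]; lra.
have h2 : inf (f y @` K) - e <= inf (f x @` K).
  by apply: half => s Ks; have := h s Ks; rewrite ler_norml => /andP[+ _]; lra.
by rewrite ler_norml; apply/andP; split; lra.
Qed.
End compact_infimum.

(** * Automorphisms along short pieces of a segment *)

Section transport.
Variables (R : realType) (m n : nat).
Local Notation C := R[i].
Local Notation RC x := (real_complex R x).
Implicit Types (U V W : 'M[C]_(m, n)) (g F : 'M[C]_n).

Definition segment U V (t : R) := RC (1 - t) *: U + RC t *: V.

(* The right inverse of W with image orthogonal to ker W for the metric g. *)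
Definition orth_inv g W : 'M[C]_(n, m) := g *m adj W *m invmx (W *m g *m adj W).

(** A nonzero [v] in the kernel would make the nonzero vector [v *m W] isotropic for [g]. *)
Lemma gram_unit g W : posdef g -> row_free W -> W *m g *m adj W \in unitmx.
Proof.
move=> [gg gp] fW; rewrite -row_free_unit; apply: contraT => /not_row_free[v v0 vW].
have vW0 : v *m W != 0 by apply: contra v0 => /eqP h; apply/eqP/(row_free_inj fW); rewrite h mul0mx.
by have := gp _ vW0; rewrite adjM !mulmxA -[v *m W *m g *m adj W]mulmxA -mulmxA !mulmxA;
  rewrite -(mulmxA v) -(mulmxA v) vW mul0mx mxE ltxx.
Qed.

Lemma orth_invP g W : posdef g -> row_free W -> W *m orth_inv g W = 1%:M.
Proof. by move=> pg fW; rewrite /orth_inv !mulmxA (mulmxV (gram_unit pg fW)). Qed.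

Lemma orth_inv_frame g W (FS : 'M[C]_m) F : FS \in unitmx -> F \in unitmx ->
  W *m g *m adj W \in unitmx ->
  orth_inv (F *m g *m adj F) (FS *m W *m invmx F) = F *m orth_inv g W *m invmx FS.
Proof.
move=> uS uF uW; have uA : adj F \in unitmx by rewrite adj_unit.
have uA' : adj FS \in unitmx by rewrite adj_unit.
rewrite /orth_inv !adjM adjV !mulmxA (mulmxKV uF) !(mulmxK uA).
have u1 : FS *m W *m g *m adj W \in unitmx.
  by rewrite -!mulmxA unitmx_mul uS !mulmxA.
rewrite (invmxM u1 uA'); have -> : invmx (FS *m W *m g *m adj W) =
    invmx (W *m g *m adj W) *m invmx FS.
  by rewrite -(invmxM uS uW) !mulmxA.
by rewrite !mulmxA (mulmxK uA').
Qed.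

Lemma conj_orth_inv g W : conjmx (orth_inv g W) = orth_inv (conjmx g) (conjmx W).
Proof. by rewrite /orth_inv !conjmxM conjmxV !conjmxM !conj_adj. Qed.

Lemma segment_frame U V t (FS : 'M[C]_m) F :
  segment (FS *m U *m F) (FS *m V *m F) t = FS *m segment U V t *m F.
Proof. by rewrite /segment mulmxDr mulmxDl -!scalemxAr -!scalemxAl. Qed.

Lemma conj_segment U V t : conjmx (segment U V t) = segment (conjmx U) (conjmx V) t.
Proof. by rewrite /segment conjmxD !conjmxZ !conj_RC. Qed.

Definition stepmx g U V (t t' : R) : 'M[C]_n :=
  1%:M + orth_inv g (segment U V t) *m (segment U V t' - segment U V t).

Lemma stepmxP g U V t t' : posdef g -> row_free (segment U V t) ->
  segment U V t *m stepmx g U V t t' = segment U V t'.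
Proof.
move=> pg fW; rewrite /stepmx mulmxDr mulmx1 mulmxA (orth_invP pg fW) mul1mx.
by rewrite addrC subrK.
Qed.

Lemma stepmx_id g U V t : stepmx g U V t t = 1%:M.
Proof. by rewrite /stepmx subrr mulmx0 addr0. Qed.

Lemma stepmx_frame g U V t t' (FS : 'M[C]_m) F : FS \in unitmx -> F \in unitmx ->
  segment U V t *m g *m adj (segment U V t) \in unitmx ->
  stepmx (F *m g *m adj F) (FS *m U *m invmx F) (FS *m V *m invmx F) t t' =
  F *m stepmx g U V t t' *m invmx F.
Proof.
move=> uS uF uW; rewrite /stepmx !segment_frame (orth_inv_frame uS uF uW).
rewrite -mulmxBl -mulmxBr [in RHS]mulmxDr mulmx1 [RHS]mulmxDl (mulmxV uF).
by rewrite !mulmxA (mulmxKV uS).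
Qed.

Lemma conj_stepmx g U V t t' :
  conjmx (stepmx g U V t t') = stepmx (conjmx g) (conjmx U) (conjmx V) t t'.
Proof.
by rewrite /stepmx conjmxD conjmx1 conjmxM conj_orth_inv [conjmx (_ - _)]conjmxD conjmxN !conj_segment.
Qed.

Lemma cvg_segment (T : Type) (F : set_system T) (FF : Filter F)
    (fU fV : T -> 'M[C]_(m, n)) (ft : T -> R) U V t :
  fU @ F --> U -> fV @ F --> V -> ft @ F --> t ->
  segment (fU z) (fV z) (ft z) @[z --> F] --> segment U V t.
Proof.
move=> cU cV ct; apply: (@cvg_addmx _ _ F).
  apply: (@cvg_scalemx _ _ F); last exact: cU.
  by apply: (@cvg_RC _ _ F); apply: cvgB; [exact: cvg_cst|exact: ct].
by apply: (@cvg_scalemx _ _ F); [apply: (@cvg_RC _ _ F); exact: ct|exact: cV].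
Qed.

Lemma cvg_orth_inv (T : Type) (F : set_system T) (FF : Filter F)
    (fg : T -> 'M[C]_n) (fW : T -> 'M[C]_(m, n)) g W :
  fg @ F --> g -> fW @ F --> W -> W *m g *m adj W \in unitmx ->
  orth_inv (fg z) (fW z) @[z --> F] --> orth_inv g W.
Proof.
move=> cg cW uW; have cA := @cvg_adjoint _ _ F FF _ _ _ _ cW.
have cgA := @cvg_mulmx _ _ F FF _ _ _ _ _ _ _ cg cA.
apply: (@cvg_mulmx _ _ F); first exact: cgA.
apply: (@cvg_invmx _ _ F); last exact: uW.
apply: (@cvg_mulmx _ _ F); last exact: cA.
by apply: (@cvg_mulmx _ _ F); [exact: cW|exact: cg].
Qed.

Lemma cvg_stepmx (T : Type) (F : set_system T) (FF : Filter F)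
    (fg : T -> 'M[C]_n) (fU fV : T -> 'M[C]_(m, n)) (ft ft' : T -> R) g U V t t' :
  fg @ F --> g -> fU @ F --> U -> fV @ F --> V -> ft @ F --> t -> ft' @ F --> t' ->
  segment U V t *m g *m adj (segment U V t) \in unitmx ->
  stepmx (fg z) (fU z) (fV z) (ft z) (ft' z) @[z --> F] --> stepmx g U V t t'.
Proof.
move=> cg cU cV ct ct' u; have cW := cvg_segment FF cU cV ct.
have cW' := cvg_segment FF cU cV ct'.
apply: (@cvg_addmx _ _ F); first exact: cvg_cst.
apply: (@cvg_mulmx _ _ F); first exact: (cvg_orth_inv FF cg cW u).
apply: (@cvg_addmx _ _ F); first exact: cW'.
by apply: (@cvg_oppmx _ _ F); exact: cW.
Qed.

Lemma cvg_sqn (T : Type) (F : set_system T) (FF : Filter F) (f : T -> C) (z : C) :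
  f @ F --> z -> sqn (f t) @[t --> F] --> sqn z.
Proof.
move=> fz; rewrite /sqn; apply: cvgD; rewrite -?expr2.
  by under eq_fun do rewrite expr2; rewrite expr2; apply: cvgM; exact: cvg_Re.
by under eq_fun do rewrite expr2; rewrite expr2; apply: cvgM; exact: cvg_Im.
Qed.
End transport.

(** * The canonical step length and the product of the steps *)

Section transport_product.
Variables (R : realType) (m n : nat).
Local Notation C := R[i].
Local Notation RC x := (real_complex R x).
Implicit Types (U V W : 'M[C]_(m, n)) (g F : 'M[C]_n).

Lemma pencil_segment U V t : pencil true U V -> 0 <= t <= 1 -> row_free (segment U V t).
Proof. by move=> UV t01; exact: UV. Qed.

Lemma pencil_gram g U V t : posdef g -> pencil true U V -> 0 <= t <= 1 ->
  segment U V t *m g *m adj (segment U V t) \in unitmx.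
Proof. by move=> pg UV t01; apply: gram_unit => //; exact: pencil_segment. Qed.

(** Stopping at 1 makes all later steps trivial. *)
Definition node (h : R) (i : nat) : R := Num.min 1 (i%:R * h).

Lemma node01 h i : 0 <= h -> 0 <= node h i <= 1.
Proof.
move=> h0; rewrite /node ge_min lexx /= andbT le_min ler01 /=.
by rewrite mulr_ge0.
Qed.

Lemma node_step h i : 0 <= h -> `|node h i - node h i.+1| <= h.
Proof.
move=> h0; have p : 0 <= i%:R * h by rewrite mulr_ge0.
rewrite /node -natr1 mulrDl mul1r /Order.min ler_norml.
by case: ltP => h1; case: ltP => h2; apply/andP; split; lra.
Qed.

Lemma node1 h i : 1 <= i%:R * h -> node h i = 1.
Proof. by move=> h1; rewrite /node min_l. Qed.

Fixpoint prodmx g U V (h : R) (N : nat) : 'M[C]_n :=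
  if N is N'.+1 then prodmx g U V h N' *m stepmx g U V (node h N') (node h N)
  else 1%:M.

Lemma prodmxP g U V h N : 0 <= h -> posdef g -> pencil true U V ->
  U *m prodmx g U V h N = segment U V (node h N).
Proof.
move=> h0 pg UV; elim: N => [|N IH] /=.
  rewrite mulmx1 /node mul0r min_r ?ler01// /segment subr0 rmorph1 rmorph0.
  by rewrite scale1r scale0r addr0.
rewrite mulmxA IH; apply: stepmxP => //; apply: pencil_segment => //.
exact: node01.
Qed.

Lemma prodmx_addn g U V h N k : 1 <= N%:R * h -> 0 <= h ->
  prodmx g U V h (N + k) = prodmx g U V h N.
Proof.
move=> h1 h0; elim: k => [|k IH]; first by rewrite addn0.
have e i : (N <= i)%N -> node h i = 1.
  by move=> Ni; apply: node1; apply: le_trans h1 _; apply: ler_wpM2r; rewrite ?ler_nat.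
rewrite addnS /= IH (e (N + k)%N) ?leq_addr// (e (N + k).+1) ?leqW ?leq_addr//.
by rewrite stepmx_id mulmx1.
Qed.

Lemma prodmx_stable g U V h N N' : 1 <= N%:R * h -> 1 <= N'%:R * h -> 0 <= h ->
  prodmx g U V h N = prodmx g U V h N'.
Proof.
move=> h1 h2 h0; have [NN|/ltnW NN] := leqP N N'.
  by rewrite -(subnKC NN) prodmx_addn.
by rewrite -(subnKC NN) prodmx_addn.
Qed.

Lemma prodmx_frame g U V h N (FS : 'M[C]_m) F : FS \in unitmx -> F \in unitmx ->
  0 <= h -> posdef g -> pencil true U V ->
  prodmx (F *m g *m adj F) (FS *m U *m invmx F) (FS *m V *m invmx F) h N =
  F *m prodmx g U V h N *m invmx F.
Proof.
move=> uS uF h0 pg UV; elim: N => [|N IH] /=; first by rewrite mulmx1 (mulmxV uF).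
rewrite IH (stepmx_frame _ uS uF (pencil_gram pg UV (node01 N h0))) !mulmxA.
by rewrite (mulmxKV uF).
Qed.

Lemma conj_prodmx g U V h N :
  conjmx (prodmx g U V h N) = prodmx (conjmx g) (conjmx U) (conjmx V) h N.
Proof. by elim: N => [|N IH] /=; rewrite ?conjmx1// conjmxM IH conj_stepmx. Qed.

Lemma cvg_node (T : Type) (F : set_system T) (FF : Filter F) (fh : T -> R) h i :
  fh @ F --> h -> node (fh z) i @[z --> F] --> node h i.
Proof.
move=> ch; have ci : i%:R * fh z @[z --> F] --> i%:R * h.
  by apply: cvgM; [exact: cvg_cst|exact: ch].
apply/cvgrPdist_le => e e0; have /cvgrPdist_le/(_ e e0) hF := ci.
apply: filterS hF => z; rewrite /node !ler_norml => /andP[a1 a2].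
rewrite /Order.min; case: ltP => b1; case: ltP => b2; apply/andP; split; lra.
Qed.

Lemma cvg_prodmx (T : Type) (F : set_system T) (FF : Filter F)
    (fg : T -> 'M[C]_n) (fU fV : T -> 'M[C]_(m, n)) (fh : T -> R) g U V h N :
  fg @ F --> g -> fU @ F --> U -> fV @ F --> V -> fh @ F --> h ->
  0 <= h -> posdef g -> pencil true U V ->
  prodmx (fg z) (fU z) (fV z) (fh z) N @[z --> F] --> prodmx g U V h N.
Proof.
move=> cg cU cV ch h0 pg UV; elim: N => [|N IH]; first exact: cvg_cst.
have u := pencil_gram pg UV (node01 N h0).
have step := cvg_stepmx FF cg cU cV (cvg_node (i := N) FF ch) (cvg_node (i := N.+1) FF ch) u.
exact: (@cvg_mulmx _ _ F FF _ _ _ _ _ _ _ IH step).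
Qed.

Definition square : set (R * R) := `[0, 1]%classic `*` `[0, 1]%classic.

Lemma compact_square : compact square.
Proof. by apply: compact_setX; exact: segment_compact. Qed.

Lemma square0 : square (0, 0).
Proof. by split; rewrite /= in_itv /= lexx ler01. Qed.

(** Positive on the square: the step from [t] to [t] is the identity, and off the diagonal the
    distance is positive. *)
Definition defect g U V (p : R * R) : R :=
  sqn (\det (stepmx g U V p.1 p.2)) + `|p.1 - p.2|.

(** If [|t - t'|] is at most half the infimum of the defect, the determinant of the step cannot
    vanish. *)
Definition mesh g U V : R := inf (defect g U V @` square) / 2.

Lemma defect_ge0 g U V p : 0 <= defect g U V p.
Proof. by rewrite addr_ge0 ?sqn_ge0. Qed.

Lemma cvg_defect (T : Type) (F : set_system T) (FF : Filter F)
    (fg : T -> 'M[C]_n) (fU fV : T -> 'M[C]_(m, n)) (fp : T -> R * R) g U V p :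
  fg @ F --> g -> fU @ F --> U -> fV @ F --> V -> fp @ F --> p -> square p ->
  posdef g -> pencil true U V ->
  defect (fg z) (fU z) (fV z) (fp z) @[z --> F] --> defect g U V p.
Proof.
move=> cg cU cV cp [p1 _] pg UV.
have c1 : (fp z).1 @[z --> F] --> p.1 by apply: (cvg_comp fp fst cp); exact: cvg_fst.
have c2 : (fp z).2 @[z --> F] --> p.2 by apply: (cvg_comp fp snd cp); exact: cvg_snd.
apply: cvgD; last by apply: cvg_norm; apply: cvgB; [exact: c1|exact: c2].
apply: (cvg_sqn FF); apply: (@cvg_det _ _ F); apply: (cvg_stepmx FF cg cU cV c1 c2).
by apply: pencil_gram => //; move: p1; rewrite /= in_itv.
Qed.

Lemma mesh_gt0 g U V : posdef g -> pencil true U V -> 0 < mesh g U V.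
Proof.
move=> pg UV; apply: divr_gt0 => //; apply: (inf_compact_gt0 compact_square square0).
  move=> [t t'] _; rewrite /defect /=; have [->|tt'] := eqVneq t t'.
    rewrite stepmx_id det1 subrr normr0 addr0 lt_neqAle sqn_ge0 andbT eq_sym.
    by apply/eqP => /sqn_eq0/eqP; rewrite oner_eq0.
  by rewrite ltr_wpDl ?sqn_ge0// normr_gt0 subr_eq0.
move=> p sp; have ci : id @ nbhs p --> p by move=> W.
exact: (cvg_defect _ (cvg_cst g) (cvg_cst U) (cvg_cst V) ci sp pg UV).
Qed.

Lemma mesh_step g U V t t' : posdef g -> pencil true U V -> 0 <= t <= 1 -> 0 <= t' <= 1 ->
  `|t - t'| <= mesh g U V -> stepmx g U V t t' \in unitmx.
Proof.
move=> pg UV t01 t01' tt; have m0 := mesh_gt0 pg UV.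
have : inf (defect g U V @` square) <= defect g U V (t, t').
  apply: ge_inf; first by exists 0 => _ [p _ <-]; exact: defect_ge0.
  by exists (t, t') => //; split; rewrite /= in_itv.
have -> : inf (defect g U V @` square) = 2 * mesh g U V.
  by rewrite /mesh mulrC divfK.
rewrite /defect /= unitmxE unitfE => h; apply/eqP => d0.
have s0 : sqn (0 : C) = 0 by rewrite /sqn /= expr0n /= addr0.
by rewrite d0 s0 in h; lra.
Qed.

Lemma eq_mesh g U V g' U' V' :
  (forall p, square p -> defect g U V p = defect g' U' V' p) -> mesh g U V = mesh g' U' V'.
Proof. by move=> e; exact: (congr1 (fun A => inf A / 2) (eq_imagel e)). Qed.

Lemma mesh_frame g U V (FS : 'M[C]_m) F : FS \in unitmx -> F \in unitmx ->
  posdef g -> pencil true U V ->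
  mesh (F *m g *m adj F) (FS *m U *m invmx F) (FS *m V *m invmx F) = mesh g U V.
Proof.
move=> uS uF pg UV; apply: eq_mesh => -[t t'] [/= t01 _].
rewrite in_itv in t01; rewrite /defect /= (stepmx_frame _ uS uF (pencil_gram pg UV t01)).
rewrite !det_mulmx det_inv mulrAC mulfV ?mul1r//.
Qed.

Lemma conj_mesh g U V : mesh (conjmx g) (conjmx U) (conjmx V) = mesh g U V.
Proof.
apply: eq_mesh => -[t t'] _; rewrite /defect /= -conj_stepmx.
by rewrite /conjmx det_map_mx /sqn Re_conj Im_conj sqrrN.
Qed.

Lemma cvg_mesh (X : topologicalType) (fg : X -> 'M[C]_n) (fU fV : X -> 'M[C]_(m, n)) (x : X) :
  fg @ x --> fg x -> fU @ x --> fU x -> fV @ x --> fV x ->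
  posdef (fg x) -> pencil true (fU x) (fV x) ->
  mesh (fg y) (fU y) (fV y) @[y --> x] --> mesh (fg x) (fU x) (fV x).
Proof.
move=> cg cU cV pg UV; apply: cvgM; last exact: cvg_cst.
apply: (inf_compact_cvg compact_square square0 (f := fun y => defect (fg y) (fU y) (fV y))).
  by move=> y t; exact: defect_ge0.
move=> p sp; have c1 : fst @ (x, p) --> x by exact: cvg_fst.
have c2 : snd @ (x, p) --> p by exact: cvg_snd.
exact: (cvg_defect _ (cvg_comp fst fg c1 cg) (cvg_comp fst fU c1 cU)
  (cvg_comp fst fV c1 cV) c2 sp pg UV).
Qed.

Definition transport g U V : 'M[C]_n :=
  prodmx g U V (mesh g U V) (Num.bound (mesh g U V)^-1).

Lemma bound_mesh (h h' : R) : 0 < h -> h <= h' -> 1 <= (Num.bound h^-1)%:R * h'.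
Proof.
move=> h0 hh; have h1 : h^-1 < (Num.bound h^-1)%:R by apply: archi_boundP; rewrite invr_ge0 ltW.
have h2 : 1 <= (Num.bound h^-1)%:R * h by rewrite -ler_pdivrMr// div1r ltW.
by apply: le_trans h2 _; rewrite ler_wpM2l.
Qed.

Lemma transportP g U V : posdef g -> pencil true U V -> U *m transport g U V = V.
Proof.
move=> pg UV; have m0 := mesh_gt0 pg UV.
rewrite /transport prodmxP ?ltW// node1 ?bound_mesh// /segment subrr rmorph0 rmorph1.
by rewrite scale0r add0r scale1r.
Qed.

Lemma transport_unit g U V : posdef g -> pencil true U V -> transport g U V \in unitmx.
Proof.
move=> pg UV; have m0 := ltW (mesh_gt0 pg UV); rewrite /transport.
elim: (Num.bound _) => [|N IH] /=; first exact: unitmx1.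
rewrite unitmx_mul IH; apply: mesh_step => //; by [exact: node01|exact: node_step].
Qed.

Lemma transport_frame g U V (FS : 'M[C]_m) F : FS \in unitmx -> F \in unitmx ->
  posdef g -> pencil true U V ->
  transport (F *m g *m adj F) (FS *m U *m invmx F) (FS *m V *m invmx F) =
  F *m transport g U V *m invmx F.
Proof.
move=> uS uF pg UV; rewrite /transport (mesh_frame uS uF pg UV).
by apply: prodmx_frame => //; exact/ltW/mesh_gt0.
Qed.

Lemma conj_transport g U V :
  conjmx (transport g U V) = transport (conjmx g) (conjmx U) (conjmx V).
Proof. by rewrite /transport conj_mesh conj_prodmx. Qed.

(** The number of steps may jump with the mesh. Near [x] the mesh exceeds half its value at [x], and
    the common number [N] of steps computes the same products. *)
Lemma cvg_transport (X : topologicalType) (fg : X -> 'M[C]_n)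
    (fU fV : X -> 'M[C]_(m, n)) (x : X) :
  fg @ x --> fg x -> fU @ x --> fU x -> fV @ x --> fV x ->
  posdef (fg x) -> pencil true (fU x) (fV x) ->
  transport (fg y) (fU y) (fV y) @[y --> x] --> transport (fg x) (fU x) (fV x).
Proof.
move=> cg cU cV pg UV; have m0 := mesh_gt0 pg UV; have cm := cvg_mesh cg cU cV pg UV.
set h := mesh (fg x) (fU x) (fV x) in m0 cm; have h20 : 0 < h / 2 by lra.
pose N := Num.bound (h / 2)^-1.
have stable y : h / 2 <= mesh (fg y) (fU y) (fV y) ->
    transport (fg y) (fU y) (fV y) = prodmx (fg y) (fU y) (fV y) (mesh (fg y) (fU y) (fV y)) N.
  move=> hy; have my0 := lt_le_trans h20 hy.
  exact: (prodmx_stable _ _ _ (bound_mesh my0 (lexx _)) (bound_mesh h20 hy) (ltW my0)).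
rewrite stable -/h; last by lra.
apply: (@cvg_near_eq _ (nbhs x)).
  have near_h : \forall y \near x, h / 2 < mesh (fg y) (fU y) (fV y).
    by apply: cvgr_gt cm _ _; lra.
  by apply: (@filterS _ (nbhs x) _ _ _ _ near_h) => y /ltW; exact: stable.
exact: (cvg_prodmx (N := N) _ cg cU cV cm (ltW m0) pg UV).
Qed.
End transport_product.

(** * Transport as an equivariant automorphism of a bundle *)

Section transport_bundles.
Variables (R : realType) (X : involutive_space).
Local Notation C := R[i].
Variable Y : set X.
Hypothesis tauY : forall x, Y x -> Y (tau x).

Lemma hom_contP m n (S : mbundle R Y m) (E : mbundle R Y n) (d : X -> 'M[C]_(m, n)) :
  hom_cont S E setT id d <->
  forall z, Y z -> coords S E z y (d y) @[y --> z] --> coords S E z z (d z).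
Proof.
split=> [cd z Yz W nW|cd z _ x Yx n1 n2].
  have h := cd z I z Yz (nb_self S Yz) (nb_self E Yz) W nW.
  by apply: (@filterS _ (nbhs z) _ _ _ _ h) => y; apply.
have Yz := nb_sub Yx n1; have nS := nb_self S Yz; have nE := nb_self E Yz.
have tS := @gauge_cvg _ _ _ _ S _ _ _ Yx Yz n1 nS.
have tE := @gauge_cvg _ _ _ _ E _ _ _ Yz Yx nE n2.
have H y : nb S z y -> nb E z y -> coords S E x y (d y) =
    (gauge S x y *m invmx (gauge S z y)) *m coords S E z y (d y) *m
    (gauge E z y *m invmx (gauge E x y)).
  move=> h1 h2; rewrite /coords !mulmxA (mulmxKV (gauge_unit Yz h1)).
  by rewrite (mulmxKV (gauge_unit Yz h2)).
suff h : coords S E x y (d y) @[y --> z] --> coords S E x z (d z).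
  move=> W nW; apply: (@filterS _ (nbhs z) _ _ _ _ (h W nW)) => y Wy _; exact: Wy.
rewrite (H z nS nE); apply: (@cvg_near_eq _ (nbhs z)).
  have h1 : nbhs z (nb S z) by apply: open_nbhs_nbhs; split=> //; exact: nb_open.
  have h2 : nbhs z (nb E z) by apply: open_nbhs_nbhs; split=> //; exact: nb_open.
  exact: (@filterS2 _ (nbhs z) _ _ _ _ H h1 h2).
apply: (@cvg_mulmx _ _ (nbhs z)); last exact: tE.
by apply: (@cvg_mulmx _ _ (nbhs z)); [exact: tS|exact: cd].
Qed.

(** [transport] involves no choice: its behaviour under changes of frame gives continuity in local
    trivialisations and, with conjugation, equivariance. *)
Lemma hom_transport m n (S : mbundle R Y m) (E : mbundle R Y n) (g : X -> 'M[C]_n)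
    (U V : X -> 'M[C]_(m, n)) :
  hom_cont E (mdual E tauY) setT id g ->
  (forall x, Y x -> posdef (g x) /\ g (tau x) = hom_tau E (mdual E tauY) x (g x)) ->
  hom_cont S E setT id U -> hom_cont S E setT id V ->
  (forall x, Y x -> [/\ pencil true (U x) (V x), U (tau x) = hom_tau S E x (U x)
    & V (tau x) = hom_tau S E x (V x)]) ->
  exists T : X -> 'M[C]_n, hom_cont E E setT id T /\
    forall x, Y x -> [/\ T x \in unitmx, U x *m T x = V x & T (tau x) = hom_tau E E x (T x)].
Proof.
move=> cg pg cU cV UV; exists (fun x => transport (g x) (U x) (V x)); split; last first.
  move=> x Yx; have [pgx gt] := pg x Yx; have [UVx Ut Vt] := UV x Yx.
  split; [exact: transport_unit|exact: transportP|].
  have uS : invmx (theta S x) \in unitmx by rewrite unitmx_inv theta_unit.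
  have uE : invmx (theta E x) \in unitmx by rewrite unitmx_inv theta_unit.
  have := transport_frame uS uE (posdef_conj pgx) (pencil_conj UVx).
  rewrite invmxK -conj_transport Ut Vt gt /hom_tau /= -adjV => <-.
  exact: erefl.
apply/hom_contP => z Yz; have [pgz _] := pg z Yz; have [UVz _ _] := UV z Yz.
have nS := nb_self S Yz; have nE := nb_self E Yz.
have cg' := (hom_contP _ _ _).1 cg z Yz; have cU' := (hom_contP _ _ _).1 cU z Yz.
have cV' := (hom_contP _ _ _).1 cV z Yz.
have gE y : coords E (mdual E tauY) z y (g y) = gauge E z y *m g y *m adj (gauge E z y).
  by rewrite /coords /= invmxK.
have H y : nb S z y -> nb E z y -> coords E E z y (transport (g y) (U y) (V y)) =
    transport (coords E (mdual E tauY) z y (g y)) (coords S E z y (U y)) (coords S E z y (V y)).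
  move=> h1 h2; have Yy := nb_sub Yz h1; have [pgy _] := pg y Yy; have [UVy _ _] := UV y Yy.
  by rewrite gE /coords (transport_frame (gauge_unit Yz h1) (gauge_unit Yz h2)).
rewrite (H z nS nE); apply: (@cvg_near_eq _ (nbhs z)).
  have h1 : nbhs z (nb S z) by apply: open_nbhs_nbhs; split=> //; exact: nb_open.
  have h2 : nbhs z (nb E z) by apply: open_nbhs_nbhs; split=> //; exact: nb_open.
  exact: (@filterS2 _ (nbhs z) _ _ _ _ H h1 h2).
apply: (cvg_transport cg' cU' cV').
  by rewrite gE; apply: posdef_congr => //; exact: gauge_unit.
by apply: pencil_transform => //; rewrite ?unitmx_inv; exact: gauge_unit.
Qed.
End transport_bundles.

(** * From vector bundles to matrices *)

Section linear_maps.
Variable R : realType.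
Local Notation C := R[i].

Definition to_linear (U V : lmodType C) (f : U -> V) (fl : linear f) : {linear U -> V} :=
  HB.pack f (GRing.isLinear.Build C U V *:%R f fl).

Lemma linear_matrix m n (f : 'rV[C]_m -> 'rV[C]_n) : linear f ->
  forall v, f v = v *m lin1_mx f.
Proof. by move=> fl v; rewrite (mul_rV_lin1 (to_linear fl)). Qed.

Definition frame_iso (V : lmodType C) m (f : 'rV[C]_m -> V) (g : V -> 'rV[C]_m) : Prop :=
  [/\ linear f, cancel f g & cancel g f].

Lemma frame_iso_exists (V : lmodType C) m :
  (exists f : {linear 'rV[C]_m -> V}, bijective f) -> exists f g, @frame_iso V m f g.
Proof. by move=> [f [g fK gK]]; exists f, g; split=> //; exact: linearP. Qed.

Lemma frame_iso_linear (V : lmodType C) m (f : 'rV[C]_m -> V) g : frame_iso f g -> linear g.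
Proof.
move=> [fl fK gK] a v w; rewrite -{1}(gK v) -{1}(gK w) -fl fK.
exact: erefl.
Qed.

Lemma frame_iso_rank (V : lmodType C) m n (f : 'rV[C]_m -> V) g (f' : 'rV[C]_n -> V) g' :
  frame_iso f g -> frame_iso f' g' -> (m <= n)%N.
Proof.
move=> fg fg'; have gl := frame_iso_linear fg; have gl' := frame_iso_linear fg'.
have [fl fK gK] := fg; have [fl' fK' gK'] := fg'.
have l1 : linear (fun v => g' (f v)) by move=> a v w; rewrite fl gl'.
have l2 : linear (fun v => g (f' v)) by move=> a v w; rewrite fl' gl.
have e : lin1_mx (fun v => g' (f v)) *m lin1_mx (fun v => g (f' v)) = 1%:M.
  apply/row_matrixP => i; rewrite !rowE mulmx1 mulmxA.
  by rewrite -(linear_matrix l1) -(linear_matrix l2) gK' fK.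
have : row_free (lin1_mx (fun v => g' (f v))) by apply/row_freeP; exists (lin1_mx (fun v => g (f' v))).
by rewrite /row_free => /eqP <-; exact: rank_leq_col.
Qed.

Lemma frame_iso_rank_eq (V : lmodType C) m n (f : 'rV[C]_m -> V) g (f' : 'rV[C]_n -> V) g' :
  frame_iso f g -> frame_iso f' g' -> m = n.
Proof.
move=> h h'; apply/eqP; rewrite eqn_leq (frame_iso_rank h h') (frame_iso_rank h' h).
exact: erefl.
Qed.

Lemma row_cvg (T : Type) (F : set_system T) (FF : Filter F) m n
    (f : T -> 'M[C]_(m, n)) (A : 'M[C]_(m, n)) :
  (forall i, row i (f t) @[t --> F] --> row i A) -> f @ F --> A.
Proof.
move=> h; apply: (@mx_cvg _ _ F) => i k.
have -> : A i k = row i A ord0 k by rewrite mxE.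
have -> : (fun t => f t i k) = (fun t => row i (f t) ord0 k) by apply/funext => t; rewrite mxE.
exact: (@cvg_coord _ _ F _ _ _ _ ord0 k (h i)).
Qed.

Lemma Tot_eta (X : Type) (F : X -> Type) (e : Defs.total F) : Tot (base e) (vec e) = e.
Proof. by case: e. Qed.
End linear_maps.

(** * Matrix models of quaternionic bundles *)

Section models.
Variables (R : realType) (X : involutive_space).
Local Notation C := R[i].

(** The frames [fr] of the fibres need not vary continuously; their composites with [gauge] are the
    local trivialisations. *)
Record model (Y : set X) m (E : qbundle R X) (M : mbundle R Y m) := Model {
  fr : forall x, 'rV[C]_m -> E x;
  cd : forall x, E x -> 'rV[C]_m;
  frP : forall x, Y x -> frame_iso (fr x) (@cd x);
  fr_theta : forall x v, Y x -> qtheta (fr x v) = fr (tau x) (conjmx v *m theta M x);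
  fr_cvg : forall z y (v : 'rV[C]_m), Y z -> nb M z y ->
    (Tot p.1 (fr p.1 (p.2 *m gauge M z p.1)) : tot E) @[p --> (y, v)] -->
      (Tot y (fr y (v *m gauge M z y)) : tot E);
  cd_cvg : forall z (e : tot E), Y z -> nb M z (base e) ->
    cd (vec e') *m invmx (gauge M z (base e')) @[e' --> e] -->
      cd (vec e) *m invmx (gauge M z (base e)) }.

Section existence.
Variables (Y : set X) (m : nat) (E : qbundle R X).
Hypothesis oY : open Y.
Hypothesis tauY : forall x, Y x -> Y (tau x).
Hypothesis rankY : forall x, Y x -> exists f : {linear 'rV[C]_m -> E x}, bijective f.

Definition chart (z : X) (U : set X) (phi : forall y, 'rV[C]_m -> E y)
    (psi : forall y, E y -> 'rV[C]_m) : Prop :=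
  [/\ open U, U z, U `<=` Y, forall y, U y -> frame_iso (phi y) (@psi y) &
    (forall y (v : 'rV[C]_m), U y -> (Tot p.1 (phi p.1 p.2) : tot E) @[p --> (y, v)] -->
       (Tot y (phi y v) : tot E)) /\
    (forall e : tot E, U (base e) -> psi (base e') (vec e') @[e' --> e] --> psi (base e) (vec e))].

Lemma chart_exists z : Y z -> exists U phi psi, chart z U phi psi.
Proof.
move=> Yz; have [U [n [phi [psi [[oU Uz] plin pK phic psic]]]]] := @vb_locally_trivial _ _ E z.
have iso y : U y -> frame_iso (phi y) (fun w => psi (Tot y w)).
  by move=> Uy; have [? ?] := pK y Uy; split=> //; exact: plin.
have [f [g fg]] := frame_iso_exists (rankY Yz).
have nm := frame_iso_rank_eq (iso z Uz) fg; subst n.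
exists (U `&` Y), phi, (fun y w => psi (Tot y w)).
split; [exact: openI|by split|by move=> y []|by move=> y [Uy _]; exact: iso|].
split=> [y v [Uy _]|e [Ue _]].
  have oUT := @open_cylinder X 'rV[C]_m U oU; rewrite (continuous_open_subspace _ oUT) in phic.
  exact: (phic (y, v) (mem_set (conj Uy I))).
have oP : open (@Defs.proj _ _ E @^-1` U).
  by apply: open_comp => // ? _; exact: vb_proj_continuous.
rewrite (continuous_open_subspace _ oP) in psic.
have h := psic e (mem_set Ue); rewrite (Tot_eta e).
have -> : (fun e' : tot E => psi (Tot (base e') (vec e'))) = psi.
  by apply/funext => e'; rewrite Tot_eta.
exact: h.
Qed.

(** Frames of single fibres and charts around single points are chosen independently, and [G]
    compares them. A product of [G] with an inverse is a chart followed by the inverse of another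
    chart, hence continuous. *)
Lemma model_exists : exists M : mbundle R Y m, inhabited (model E M).
Proof.
have frames x : exists fg : ('rV[C]_m -> E x) * (E x -> 'rV[C]_m), Y x -> frame_iso fg.1 fg.2.
  have [Yx|nYx] := pselect (Y x); last by exists (fun=> 0, fun=> 0).
  by have [f [g fg]] := frame_iso_exists (rankY Yx); exists (f, g).
have charts z : exists c : set X * ((forall y, 'rV[C]_m -> E y) * (forall y, E y -> 'rV[C]_m)),
    Y z -> chart z c.1 c.2.1 c.2.2.
  have [Yz|nYz] := pselect (Y z); last by exists (setT, (fun _ _ => 0, fun _ _ => 0)).
  by have [U [phi [psi h]]] := chart_exists Yz; exists (U, (phi, psi)).
pose f x := (projT1 (cid (frames x))).1; pose g x := (projT1 (cid (frames x))).2.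
have fg x : Y x -> frame_iso (f x) (g x) := projT2 (cid (frames x)).
pose U z := (projT1 (cid (charts z))).1; pose phi z := (projT1 (cid (charts z))).2.1.
pose psi z := (projT1 (cid (charts z))).2.2.
have ch z : Y z -> chart z (U z) (phi z) (psi z) := projT2 (cid (charts z)).
clearbody f g U phi psi.
pose G z y := lin1_mx (fun v => g y (phi z y v)).
(* Theta is conjugate linear; conjugating the argument first gives a map that has a matrix. *)
pose th x := lin1_mx (fun v => g (tau x) (qtheta (f x (conjmx v)))).
have GE z y v : Y z -> U z y -> phi z y v = f y (v *m G z y).
  move=> Yz Uzy; have [_ _ UY iso _] := ch z Yz; have Yy := UY y Uzy.
  have gl := frame_iso_linear (fg y Yy); have [pl _ _] := iso y Uzy.
  have l : linear (fun v => g y (phi z y v)) by move=> a v1 v2; rewrite pl gl.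
  by rewrite /G -(linear_matrix l); have [_ _ ->] := fg y Yy.
have thE x v : Y x -> qtheta (f x v) = f (tau x) (conjmx v *m th x).
  move=> Yx; have gl := frame_iso_linear (fg _ (tauY Yx)); have [fl _ _] := fg x Yx.
  have l : linear (fun v => g (tau x) (qtheta (f x (conjmx v)))).
    move=> a v1 v2; rewrite conjmxD conjmxZ fl qthetaD qthetaZ conjCK gl.
    exact: erefl.
  by rewrite /th -(linear_matrix l) conjmxK; have [_ _ ->] := fg _ (tauY Yx).
have GU z y : Y z -> U z y -> G z y \in unitmx.
  move=> Yz Uzy; have [_ _ UY iso _] := ch z Yz; have Yy := UY y Uzy.
  have [pl pK qK] := iso y Uzy; have ql := frame_iso_linear (iso y Uzy).
  have [fl fK gK] := fg y Yy; have gl := frame_iso_linear (fg y Yy).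
  have l : linear (fun v => psi z y (f y v)) by move=> a v1 v2; rewrite fl ql.
  have e : G z y *m lin1_mx (fun v => psi z y (f y v)) = 1%:M.
    apply/row_matrixP => i; rewrite !rowE mulmx1 mulmxA -(linear_matrix l).
    by rewrite -(GE z y _ Yz Uzy) pK.
  by have [] := mulmx1_unit e.
have psiE z y w : Y z -> U z y -> psi z y w = g y w *m invmx (G z y).
  move=> Yz Uzy; have [_ _ UY iso _] := ch z Yz; have Yy := UY y Uzy.
  have [pl pK qK] := iso y Uzy; have [fl fK gK] := fg y Yy.
  apply: (can_inj (mulmxK (GU z y Yz Uzy))); rewrite (mulmxKV (GU z y Yz Uzy)).
  apply: (can_inj fK); rewrite -(GE z y _ Yz Uzy) qK gK.
  exact: erefl.
have near_U z y : Y z -> U z y -> nbhs y (U z).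
  by move=> Yz Uzy; have [oU _ _ _ _] := ch z Yz; exact: open_nbhs_nbhs.
have slice z y v : Y z -> U z y -> (Tot y' (phi z y' v) : tot E) @[y' --> y] --> (Tot y (phi z y v) : tot E).
  move=> Yz Uzy; have [_ _ _ _ [pc _]] := ch z Yz.
  have pr : (y', v) @[y' --> y] --> (y, v).
    move=> W [[A B] [/= nA nB] AB]; apply: (@filterS _ (nbhs y) _ _ _ _ nA) => y' Ay'.
    by apply: (AB (y', v)); split=> //=; exact: nbhs_singleton.
  exact: (cvg_comp _ _ pr (pc y v Uzy)).
have Gc x x' y : Y x -> Y x' -> U x y -> U x' y ->
    G x z *m invmx (G x' z) @[z --> y] --> G x y *m invmx (G x' y).
  move=> Yx Yx' Ux Ux'; apply: (@row_cvg _ _ (nbhs y)) => i.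
  have e z : U x z -> U x' z -> row i (G x z *m invmx (G x' z)) =
      psi x' z (phi x z (delta_mx 0 i)).
    move=> h h'; rewrite (psiE x' z _ Yx' h') (GE x z _ Yx h) rowE mulmxA.
    by have [_ _ UY _ _] := ch x Yx; have [_ -> _] := fg z (UY z h).
  rewrite (e y Ux Ux'); apply: (@cvg_near_eq _ (nbhs y)).
    exact: (@filterS2 _ (nbhs y) _ _ _ _ e (near_U x y Yx Ux) (near_U x' y Yx' Ux')).
  have [_ _ _ _ [_ qc]] := ch x' Yx'.
  exact: (cvg_comp _ _ (slice x y (delta_mx 0 i) Yx Ux) (qc (Tot y (phi x y (delta_mx 0 i))) Ux')).
have thc x x' y : Y x -> Y x' -> U x y -> U x' (tau y) ->
    conjmx (G x z) *m th z *m invmx (G x' (tau z)) @[z --> y] -->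
      conjmx (G x y) *m th y *m invmx (G x' (tau y)).
  move=> Yx Yx' Ux Ux'; apply: (@row_cvg _ _ (nbhs y)) => i.
  have e z : U x z -> U x' (tau z) -> row i (conjmx (G x z) *m th z *m invmx (G x' (tau z))) =
      psi x' (tau z) (qtheta (phi x z (delta_mx 0 i))).
    move=> h h'; have [_ _ UY _ _] := ch x Yx; have Yz := UY z h.
    rewrite (psiE x' _ _ Yx' h') (GE x z _ Yx h) (thE _ _ Yz) rowE !mulmxA.
    have [_ -> _] := fg _ (tauY Yz); rewrite conjmxM /conjmx map_delta_mx.
    exact: erefl.
  rewrite (e y Ux Ux'); apply: (@cvg_near_eq _ (nbhs y)).
    have h' : nbhs y (@tau X @^-1` U x').
      by apply: tau_continuous; exact: near_U.
    exact: (@filterS2 _ (nbhs y) _ _ _ _ e (near_U x y Yx Ux) h').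
  have [_ _ _ _ [_ qc]] := ch x' Yx'; have [tc _] := qtheta_homeo E.
  have c1 := cvg_comp _ _ (slice x y (delta_mx 0 i) Yx Ux) (tc (Tot y (phi x y (delta_mx 0 i)))).
  exact: (cvg_comp _ _ c1 (qc (tot_map (@qtheta _ _ E) (Tot y (phi x y (delta_mx 0 i)))) Ux')).
have thsq x : Y x -> conjmx (th x) *m th (tau x) = - 1%:M.
  move=> Yx; apply/row_matrixP => i; rewrite !rowE mulmxN mulmx1 mulmxA.
  have h := qthetaK (f x (delta_mx 0 i)); rewrite /tot_map /= in h.
  rewrite (thE _ _ Yx) (thE _ _ (tauY Yx)) in h.
  have [fl fK gK] := fg x Yx.
  have fN w : - f x w = f x (- w) := esym (linearN (to_linear fl) w).
  rewrite fN in h.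
  have tr y w (xy : y = x) : Tot y (f y w) = Tot x (f x w) :> tot E by rewrite xy.
  rewrite (tr _ _ (tau_involutive x)) in h.
  by have := can_inj fK (Tot_inj h); rewrite conjmxM conjmxK.
have [nbo nbs nbY] : [/\ forall x, Y x -> open (U x), forall x, Y x -> U x x & forall x, Y x -> U x `<=` Y].
  by split=> x Yx; have [] := ch x Yx.
exists (@MBundle R X Y m U G th nbo nbs nbY GU Gc thsq thc).
have frc z y (v : 'rV[C]_m) : Y z -> U z y ->
    (Tot p.1 (f p.1 (p.2 *m G z p.1)) : tot E) @[p --> (y, v)] --> (Tot y (f y (v *m G z y)) : tot E).
  move=> Yz Uzy; have [_ _ _ _ [pc _]] := ch z Yz; have h := pc y v Uzy.
  rewrite -(GE z y _ Yz Uzy); apply: (@cvg_near_eq _ (nbhs (y, v)) _ (tot E) _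
    (fun p => (Tot p.1 (phi z p.1 p.2) : tot E))); last exact: h.
  have nU : nbhs (y, v) (fst @^-1` U z) by apply: cvg_fst; exact: near_U.
  by apply: (@filterS _ (nbhs (y, v)) _ _ _ _ nU) => p Up; rewrite (GE z p.1 _ Yz Up).
have cdc z (e : tot E) : Y z -> U z (base e) ->
    g (base e') (vec e') *m invmx (G z (base e')) @[e' --> e] -->
      g (base e) (vec e) *m invmx (G z (base e)).
  move=> Yz Uze; have [_ _ _ _ [_ qc]] := ch z Yz; have h := qc e Uze.
  rewrite -(psiE z _ _ Yz Uze).
  have nU : nbhs e (@Defs.proj _ _ E @^-1` U z) by apply: vb_proj_continuous; exact: near_U.
  have ne : \forall e' \near e, g (base e') (vec e') *m invmx (G z (base e')) =
      psi z (base e') (vec e').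
    by apply: (@filterS _ (nbhs e) _ _ _ _ nU) => p Up; rewrite (psiE z _ _ Yz Up).
  exact: (cvg_near_eq _ ne h).
exact: (inhabits (@Model Y m E (@MBundle R X Y m U G th nbo nbs nbY GU Gc thsq thc)
  f g fg thE frc cdc)).
Qed.
End existence.
End models.

Lemma initial_cvg (S : choiceType) (T : topologicalType) (f : S -> T) (I : Type)
    (F : set_system I) (FF : Filter F) (h : I -> initial_topology f)
    (s : initial_topology f) : f (h i) @[i --> F] --> f s -> h @ F --> s.
Proof.
move=> fh W; rewrite nbhsE => -[B [oB Bs] BW]; case: oB => A oA AB.
have nA : nbhs (f s) A by apply: open_nbhs_nbhs; split=> //; rewrite -AB in Bs.
by apply: (@filterS _ F _ _ _ _ (fh A nA)) => i /= Ai; apply: BW; rewrite -AB.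
Qed.

(** * The dictionary between bundle maps and matrix functions *)

Section bundle_maps.
Variables (R : realType) (X : involutive_space) (Y : set X).
Local Notation C := R[i].

Section model_theory.
Variables (m : nat) (E : qbundle R X) (M : mbundle R Y m) (ME : model E M).

Lemma fr_linear x : Y x -> linear (fr ME x).
Proof. by move=> Yx; have [] := frP ME Yx. Qed.

Lemma cd_linear x : Y x -> linear (@cd _ _ _ _ _ _ ME x).
Proof. by move=> Yx; exact: frame_iso_linear (frP ME Yx). Qed.

Lemma frK x v : Y x -> cd ME (fr ME x v) = v.
Proof. by move=> Yx; have [_ -> _] := frP ME Yx. Qed.

Lemma cdK x (w : E x) : Y x -> fr ME x (cd ME w) = w.
Proof. by move=> Yx; have [_ _ ->] := frP ME Yx. Qed.

Lemma cd_theta x (w : E x) : Y x -> Y (tau x) -> cd ME (qtheta w) = conjmx (cd ME w) *m theta M x.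
Proof. by move=> Yx Ytx; rewrite -{1}(cdK w Yx) (fr_theta ME _ Yx) (frK _ Ytx). Qed.

Definition lcd (z : X) (e : tot E) : 'rV[C]_m :=
  @cd _ _ _ _ _ _ ME (base e) (vec e) *m invmx (gauge M z (base e)).

Lemma lcd_cvg z (e : tot E) : Y z -> nb M z (base e) -> lcd z @ e --> lcd z e.
Proof. exact: cd_cvg. Qed.

Lemma base_cvg (T : Type) (F : set_system T) (FF : Filter F) (h : T -> tot E) (e : tot E) :
  h @ F --> e -> base (h t) @[t --> F] --> base e.
Proof.
move=> he; have := cvg_comp h (@Defs.proj _ _ E) he (@vb_proj_continuous _ _ E e).
exact.
Qed.

Lemma near_base z (e : tot E) : Y z -> nb M z (base e) -> \forall e' \near e, nb M z (base e').
Proof.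
move=> Yz nz; apply: (@vb_proj_continuous _ _ E e).
by apply: open_nbhs_nbhs; split=> //; exact: nb_open.
Qed.

(* Convergence in the total space is tested on the base point and on the
   coordinates in one local trivialisation. *)
Lemma tot_cvg (T : Type) (F : set_system T) (FF : Filter F) (h : T -> tot E) (e : tot E) z :
  Y z -> nb M z (base e) -> base (h t) @[t --> F] --> base e ->
  lcd z (h t) @[t --> F] --> lcd z e -> h @ F --> e.
Proof.
move=> Yz nz cb cc.
have eqe (e' : tot E) : nb M z (base e') ->
    (Tot (base e') (fr ME (base e') (lcd z e' *m gauge M z (base e'))) : tot E) = e'.
  move=> ne'; have Ye' := nb_sub Yz ne'.
  by rewrite /lcd (mulmxKV (gauge_unit Yz ne')) (cdK _ Ye') Tot_eta.
have cp : (base (h t), lcd z (h t)) @[t --> F] --> (base e, lcd z e) by exact: (cvg_pair cb cc).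
have c1 := cvg_comp _ _ cp (@fr_cvg _ _ _ _ _ _ ME z (base e) (lcd z e) Yz nz).
rewrite (eqe e nz) in c1.
apply: (@cvg_near_eq _ F FF (tot E) _ _ e _ c1).
have nb1 : \forall t \near F, nb M z (base (h t)).
  by apply: cb; apply: open_nbhs_nbhs; split=> //; exact: nb_open.
by apply: (@filterS _ F _ _ _ _ nb1) => t /eqe /esym.
Qed.

Lemma cvg_totD (T : Type) (F : set_system T) (FF : Filter F) (b : T -> X)
    (v w : forall t, E (b t)) x (v0 w0 : E x) : Y x ->
  (Tot (b t) (v t) : tot E) @[t --> F] --> (Tot x v0 : tot E) ->
  (Tot (b t) (w t) : tot E) @[t --> F] --> (Tot x w0 : tot E) ->
  (Tot (b t) (v t + w t) : tot E) @[t --> F] --> (Tot x (v0 + w0) : tot E).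
Proof.
move=> Yx cv cw; have nx := nb_self M Yx; have cb := base_cvg FF cv.
have cv' := cvg_comp _ _ cv (@lcd_cvg x (Tot x v0) Yx nx).
have cw' := cvg_comp _ _ cw (@lcd_cvg x (Tot x w0) Yx nx).
apply: (@tot_cvg _ F FF (fun t => Tot (b t) (v t + w t)) (Tot x (v0 + w0)) x Yx nx cb).
have cdD y (p q : E y) : Y y -> cd ME (p + q) = cd ME p + cd ME q.
  by move=> Yy; exact: (linearD (to_linear (cd_linear Yy))).
have lcdD y (p q : E y) : Y y ->
    lcd x (Tot y (p + q)) = lcd x (Tot y p) + lcd x (Tot y q).
  by move=> Yy; rewrite /lcd [vec _]/= (cdD y p q Yy) mulmxDl.
rewrite (lcdD x v0 w0 Yx).
apply: (@cvg_near_eq _ F FF _ _ _ _ _ (@cvg_addmx _ _ F FF _ _ _ _ _ _ cv' cw')).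
have nb1 : \forall t \near F, nb M x (b t).
  by apply: cb; apply: open_nbhs_nbhs; split=> //; exact: nb_open.
apply: (@filterS _ F _ _ _ _ nb1) => t nt.
exact: lcdD (nb_sub Yx nt).
Qed.
End model_theory.

Section homs.
Variables (m n : nat) (E F : qbundle R X) (M : mbundle R Y m) (N : mbundle R Y n).
Variables (ME : model E M) (MF : model F N).
Variables (f : forall x, E x -> F x) (u : X -> 'M[C]_(m, n)).

Lemma continuous_of_hom :
  (forall x v, Y x -> f v = fr MF x (cd ME v *m u x)) -> hom_cont M N setT id u ->
  forall e : tot E, Y (base e) -> {for e, continuous (tot_map (f := id) f : tot E -> tot F)}.
Proof.
move=> fE uc e Ye; set z := base e; have nM := nb_self M Ye; have nN := nb_self N Ye.
have nbs (e' : tot E) : nb M z (base e') -> nb N z (base e') ->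
    lcd MF z (tot_map (f := id) f e') = lcd ME z e' *m coords M N z (base e') (u (base e')).
  move=> h1 h2; have Ye' := nb_sub Ye h1.
  by rewrite /lcd /= (fE _ _ Ye') (frK MF _ Ye') /coords !mulmxA (mulmxKV (gauge_unit Ye h1)).
have cb : base e' @[e' --> e] --> base e by exact: (@vb_proj_continuous _ _ E e).
apply: (@tot_cvg _ _ _ MF _ (nbhs e) _ (tot_map (f := id) f) (tot_map (f := id) f e) z Ye nN cb).
rewrite (nbs e nM nN); have cu := (hom_contP M N u).1 uc z Ye.
have c2 := cvg_comp _ _ cb cu.
have c1 := @lcd_cvg _ _ _ ME z e Ye nM.
apply: (@cvg_near_eq _ (nbhs e) _ _ _ _ _ _ (@cvg_mulmx _ _ (nbhs e) _ _ _ _ _ _ _ _ c1 c2)).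
have n2 : \forall e' \near e, nb N z (base e').
  by apply: cb; apply: open_nbhs_nbhs; split=> //; exact: nb_open.
exact: (@filterS2 _ (nbhs e) _ _ _ _ nbs (near_base Ye nM) n2).
Qed.

Lemma hom_of_continuous :
  (forall x v, Y x -> cd MF (f (fr ME x v)) = v *m u x) ->
  (forall e : tot E, Y (base e) -> {for e, continuous (tot_map (f := id) f : tot E -> tot F)}) ->
  hom_cont M N setT id u.
Proof.
move=> fE fc; apply/hom_contP => z Yz; have nM := nb_self M Yz; have nN := nb_self N Yz.
apply: (@row_cvg _ _ (nbhs z)) => i; set v := (delta_mx 0 i : 'rV[C]_m).
pose s y : tot E := Tot y (fr ME y (v *m gauge M z y)).
have nbs y : nb M z y -> row i (coords M N z y (u y)) =
    lcd MF z (tot_map (f := id) f (s y)).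
  by move=> h; rewrite /lcd /= (fE _ _ (nb_sub Yz h)) rowE /coords !mulmxA.
have pr : (y, v) @[y --> z] --> (z, v).
  move=> W [[A B] [/= nA nB] AB]; apply: (@filterS _ (nbhs z) _ _ _ _ nA) => y Ay.
  by apply: (AB (y, v)); split=> //=; exact: nbhs_singleton.
have cs : s @ z --> s z := cvg_comp _ _ pr (@fr_cvg _ _ _ _ _ _ ME z z v Yz nM).
have c1 := cvg_comp _ _ cs (fc (s z) Yz).
have c2 := cvg_comp _ _ c1 (@lcd_cvg _ _ _ MF z (tot_map (f := id) f (s z)) Yz nN).
rewrite (nbs z nM); apply: (@cvg_near_eq _ (nbhs z) _ _ _ _ _ _ c2).
have n1 : nbhs z (nb M z) by apply: open_nbhs_nbhs; split=> //; exact: nb_open.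
exact: (@filterS _ (nbhs z) _ _ _ nbs n1).
Qed.
End homs.

Section sums.
Variables (m n : nat) (E F : qbundle R X) (M : mbundle R Y m) (N : mbundle R Y n).
Variables (ME : model E M) (MF : model F N).

Let fr2 x (v : 'rV[C]_(m + n)) : qsum E F x := (fr ME x (lsubmx v), fr MF x (rsubmx v)).
Let cd2 x (w : qsum E F x) : 'rV[C]_(m + n) := row_mx (cd ME w.1) (cd MF w.2).

Lemma bdiag_split (A : 'M[C]_m) (B : 'M[C]_n) (v : 'rV[C]_(m + n)) :
  v *m bdiag A B = row_mx (lsubmx v *m A) (rsubmx v *m B).
Proof.
by rewrite -{1}(hsubmxK v) /bdiag mul_row_block !mulmx0 addr0 add0r.
Qed.

Lemma model_sum : exists ES : model (qsum E F) (msum M N),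
  (forall x v, fr ES x v = fr2 x v) /\ forall x w, cd ES w = @cd2 x w.
Proof.
have frP2 x : Y x -> frame_iso (@fr2 x) (@cd2 x).
  move=> Yx; split.
  - move=> a v w; rewrite /fr2 !linearP (fr_linear ME Yx) (fr_linear MF Yx).
    exact: erefl.
  - by move=> v; rewrite /cd2 /= (frK ME _ Yx) (frK MF _ Yx) hsubmxK.
  - by move=> [w w']; rewrite /fr2 /cd2 row_mxKl row_mxKr (cdK ME _ Yx) (cdK MF _ Yx).
have th2 x v : Y x -> qtheta (@fr2 x v) = @fr2 (tau x) (conjmx v *m theta (msum M N) x).
  move=> Yx; rewrite [LHS]/= /qsum_theta /fr2 [_.1]/= [_.2]/=.
  rewrite (fr_theta ME _ Yx) (fr_theta MF _ Yx) bdiag_split row_mxKl row_mxKr.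
  by rewrite /conjmx !map_lsubmx !map_rsubmx.
have frc z y (v : 'rV[C]_(m + n)) : Y z -> nb (msum M N) z y ->
    (Tot p.1 (@fr2 p.1 (p.2 *m gauge (msum M N) z p.1)) : tot (qsum E F)) @[p --> (y, v)] -->
      (Tot y (@fr2 y (v *m gauge (msum M N) z y)) : tot (qsum E F)).
  move=> Yz [n1 n2]; apply: (@initial_cvg _ _ (@sum_split R X E F) _ (nbhs (y, v))).
  pose s1 (p : X * 'rV[C]_(m + n)) : tot E := Tot p.1 (fr ME p.1 (lsubmx p.2 *m gauge M z p.1)).
  pose s2 (p : X * 'rV[C]_(m + n)) : tot F := Tot p.1 (fr MF p.1 (rsubmx p.2 *m gauge N z p.1)).
  have e p : sum_split (Tot p.1 (@fr2 p.1 (p.2 *m gauge (msum M N) z p.1)) : tot (qsum E F)) =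
      (s1 p, s2 p).
    by rewrite /sum_split /= /fr2 bdiag_split row_mxKl row_mxKr.
  rewrite (e (y, v)); under eq_fun do rewrite e.
  have c0 : snd @ (y, v) --> v by exact: cvg_snd.
  have cl : (p.1, lsubmx p.2) @[p --> (y, v)] --> (y, lsubmx v).
    exact: (cvg_pair cvg_fst (cvg_comp snd _ c0 (@lsubmx_continuous R m n v))).
  have cr : (p.1, rsubmx p.2) @[p --> (y, v)] --> (y, rsubmx v).
    exact: (cvg_pair cvg_fst (cvg_comp snd _ c0 (@rsubmx_continuous R m n v))).
  have c1 : s1 @ (y, v) --> s1 (y, v) := cvg_comp _ _ cl (@fr_cvg _ _ _ _ _ _ ME z y (lsubmx v) Yz n1).
  have c2 : s2 @ (y, v) --> s2 (y, v) := cvg_comp _ _ cr (@fr_cvg _ _ _ _ _ _ MF z y (rsubmx v) Yz n2).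
  exact: (cvg_pair c1 c2).
have cdc z (e : tot (qsum E F)) : Y z -> nb (msum M N) z (base e) ->
    @cd2 _ (vec e') *m invmx (gauge (msum M N) z (base e')) @[e' --> e] -->
      @cd2 _ (vec e) *m invmx (gauge (msum M N) z (base e)).
  move=> Yz [n1 n2]; pose s (e' : tot (qsum E F)) := @sum_split R X E F e'.
  have eqs (e' : tot (qsum E F)) : nb M z (base e') -> nb N z (base e') ->
      @cd2 _ (vec e') *m invmx (gauge (msum M N) z (base e')) =
      row_mx (lcd ME z (s e').1) (lcd MF z (s e').2).
    move=> h1 h2; rewrite /= (bdiagV (gauge_unit Yz h1) (gauge_unit Yz h2)) bdiag_split.
    by rewrite /cd2 row_mxKl row_mxKr.
  have cs : s @ e --> s e by exact: sum_split_continuous.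
  have c1 : (s e').1 @[e' --> e] --> (s e).1 by exact: (cvg_comp _ _ cs cvg_fst).
  have c2 : (s e').2 @[e' --> e] --> (s e).2 by exact: (cvg_comp _ _ cs cvg_snd).
  have d1 := cvg_comp _ _ c1 (@lcd_cvg _ _ _ ME z (s e).1 Yz n1).
  have d2 := cvg_comp _ _ c2 (@lcd_cvg _ _ _ MF z (s e).2 Yz n2).
  rewrite (eqs e n1 n2).
  have nM : \forall e' \near e, nb M z (base e') 
    by apply: (@vb_proj_continuous _ _ (qsum E F) e); apply: open_nbhs_nbhs; split=> //; exact: nb_open.
  have nN : \forall e' \near e, nb N z (base e') 
    by apply: (@vb_proj_continuous _ _ (qsum E F) e); apply: open_nbhs_nbhs; split=> //; exact: nb_open.
  apply: (@cvg_near_eq _ (nbhs e) _ _ _ _ _ _ (@cvg_row_mx _ _ (nbhs e) _ _ _ _ _ _ _ _ d1 d2)).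
  exact: (@filterS2 _ (nbhs e) _ _ _ _ eqs nM nN).
by exists (@Model R X Y (m + n) (qsum E F) (msum M N) fr2 cd2 frP2 th2 frc cdc).
Qed.
End sums.
End bundle_maps.

(** * Cancellation *)

Section rank.
Variables (R : realType) (X : involutive_space) (E : qbundle R X).
Local Notation C := R[i].

(** Local triviality makes the rank locally constant. Theta is injective because its square is, so
    [rk x <= rk (tau x)], and equality follows as tau is an involution. *)
Lemma rank_exists : exists rk : X -> nat,
  [/\ forall x, exists f g, @frame_iso R (E x) (rk x) f g,
      forall x, \forall y \near x, rk y = rk x & forall x, rk (tau x) = rk x].
Proof.
have loc (x : X) : exists n, \forall y \near x, exists f g, @frame_iso R (E y) n f g.
  have [U [n [phi [psi [[oU Ux] plin pK _ _]]]]] := @vb_locally_trivial _ _ E x.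
  exists n; have nU : nbhs x U by exact: open_nbhs_nbhs.
  apply: (@filterS _ (nbhs x) _ _ _ _ nU) => y Uy; have [? ?] := pK y Uy.
  by exists (phi y), (fun w => psi (Tot y w)); split=> //; exact: plin.
pose rk x := projT1 (cid (loc x)).
have rk_near (x : X) : \forall y \near x, exists f g, @frame_iso R (E y) (rk x) f g :=
  projT2 (cid (loc x)).
have rkP x : exists f g, @frame_iso R (E x) (rk x) f g := nbhs_singleton (rk_near x).
have uniq x n f g : @frame_iso R (E x) n f g -> n = rk x.
  by move=> fg; have [f' [g' fg']] := rkP x; exact: frame_iso_rank_eq fg fg'.
have le x : (rk x <= rk (tau x))%N.
  have [f [g [fl fK gK]]] := rkP x; have [f' [g' fg']] := rkP (tau x).
  have gl' := frame_iso_linear fg'; have [fl' fK' gK'] := fg'.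
  have l : linear (fun v => g' (qtheta (f (conjmx v)))).
    by move=> a v w; rewrite conjmxD conjmxZ fl qthetaD qthetaZ conjCK gl'.
  suff : row_free (lin1_mx (fun v => g' (qtheta (f (conjmx v))))).
    by rewrite /row_free => /eqP <-; exact: rank_leq_col.
  apply: contraT => /not_row_free[v v0]; rewrite -(linear_matrix l) => h.
  have g0 : g' 0 = 0 := linear0 (to_linear gl').
  have h1 : qtheta (f (conjmx v)) = 0 by rewrite -(gK' (qtheta _)) h -g0 gK'.
  have h2 := qthetaK (f (conjmx v)); rewrite /tot_map /= h1 in h2.
  have q0 y : qtheta (0 : E y) = 0.
    by rewrite -[X in qtheta X](scale0r (0 : E y)) qthetaZ conjC0 scale0r.
  have t0 y : y = x -> Tot y (0 : E y) = Tot x (0 : E x) :> tot E by move=> ->.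
  rewrite q0 (t0 _ (tau_involutive x)) in h2; have h3 := Tot_inj h2.
  have h4 : f (conjmx v) = 0 by rewrite -[LHS]opprK -h3 oppr0.
  have h5 : conjmx v = 0.
    by rewrite -(fK (conjmx v)) h4 -(linear0 (to_linear fl)) /= fK.
  by move: v0; rewrite -(conjmxK v) h5 /conjmx map_mx0 eqxx.
exists rk; split=> // x.
  by apply: (@filterS _ (nbhs x) _ _ _ _ (rk_near x)) => y [f [g /uniq]].
by apply/eqP; rewrite eqn_leq le andbT; have := le (tau x); rewrite tau_involutive.
Qed.
End rank.

(** * Cancellation for matrix bundles *)

Section matrix_cancellation.
Variables (R : realType) (X : involutive_space) (cw : Z2_CW R X) (d1 d0 : nat).
Hypothesis hfree : forall n : nat, free_cell cw n -> (n <= d1)%N.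
Hypothesis hfixed : forall n : nat, fixed_cell cw n -> (n <= d0)%N.
Local Notation C := R[i].
Variable Y : set X.
Hypothesis oY : open Y.
Hypothesis cY : closed Y.
Hypothesis tauY : forall x, Y x -> Y (tau x).

Lemma near_nb2 m n (S : mbundle R Y m) (E : mbundle R Y n) (P : X -> Prop) z : Y z ->
  (forall y, nb S z y -> nb E z y -> P y) -> \forall y \near z, P y.
Proof.
move=> Yz; have h1 : nbhs z (nb S z) by apply: open_nbhs_nbhs; split; [exact: nb_open|exact: nb_self].
have h2 : nbhs z (nb E z) by apply: open_nbhs_nbhs; split; [exact: nb_open|exact: nb_self].
by move=> h; exact: (@filterS2 _ (nbhs z) _ _ _ _ h h1 h2).
Qed.

Lemma hom_cont_mul m n p (S : mbundle R Y m) (E : mbundle R Y n) (F : mbundle R Y p)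
    (u : X -> 'M[C]_(m, n)) (v : X -> 'M[C]_(n, p)) :
  hom_cont S E setT id u -> hom_cont E F setT id v ->
  hom_cont S F setT id (fun x => u x *m v x).
Proof.
move=> /hom_contP cu /hom_contP cv; apply/hom_contP => z Yz.
have e y : nb E z y -> nb F z y ->
    coords S F z y (u y *m v y) = coords S E z y (u y) *m coords E F z y (v y).
  by move=> h _; rewrite /coords !mulmxA (mulmxKV (gauge_unit Yz h)).
rewrite (e z (nb_self E Yz) (nb_self F Yz)).
apply: (@cvg_near_eq _ (nbhs z)); first exact: (near_nb2 Yz e).
by apply: (@cvg_mulmx _ _ (nbhs z)); [exact: cu|exact: cv].
Qed.

Lemma coords_unit n (E F : mbundle R Y n) z y u : Y z -> nb E z y -> nb F z y ->
  u \in unitmx -> coords E F z y u \in unitmx.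
Proof.
move=> Yz h1 h2 uu; rewrite /coords !unitmx_mul unitmx_inv uu (gauge_unit Yz h1).
by rewrite (gauge_unit Yz h2).
Qed.

Lemma hom_cont_inv n (E F : mbundle R Y n) (u : X -> 'M[C]_n) :
  hom_cont E F setT id u -> (forall x, Y x -> u x \in unitmx) ->
  hom_cont F E setT id (fun x => invmx (u x)).
Proof.
move=> /hom_contP cu uu; apply/hom_contP => z Yz.
have e y : nb E z y -> nb F z y -> coords F E z y (invmx (u y)) = invmx (coords E F z y (u y)).
  move=> h1 h2; have uy := uu y (nb_sub Yz h1).
  have u1 := gauge_unit Yz h1; have u2 : invmx (gauge F z y) \in unitmx.
    by rewrite unitmx_inv (gauge_unit Yz h2).
  have u3 : gauge E z y *m u y \in unitmx by rewrite unitmx_mul u1.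
  by rewrite /coords (invmxM u3 u2) (invmxM u1 uy) invmxK !mulmxA.
rewrite (e z (nb_self E Yz) (nb_self F Yz)).
apply: (@cvg_near_eq _ (nbhs z)); first exact: (near_nb2 Yz e).
apply: (@cvg_invmx _ _ (nbhs z)); first exact: cu.
by apply: coords_unit => //; [exact: nb_self|exact: nb_self|exact: uu].
Qed.

Lemma hom_tau_mul m n p (S : mbundle R Y m) (E : mbundle R Y n) (F : mbundle R Y p) x
    (u : 'M[C]_(m, n)) (v : 'M[C]_(n, p)) : Y x ->
  hom_tau S F x (u *m v) = hom_tau S E x u *m hom_tau E F x v.
Proof.
move=> Yx; rewrite /hom_tau conjmxM !mulmxA (mulmxK (theta_unit E Yx)).
exact: erefl.
Qed.

Lemma hom_tau_inv n (E F : mbundle R Y n) x (u : 'M[C]_n) : Y x -> u \in unitmx ->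
  hom_tau F E x (invmx u) = invmx (hom_tau E F x u).
Proof.
move=> Yx uu; have u1 : invmx (theta E x) \in unitmx by rewrite unitmx_inv theta_unit.
have u2 : conjmx u \in unitmx by rewrite conjmx_unit.
have u3 : invmx (theta E x) *m conjmx u \in unitmx by rewrite unitmx_mul u1.
rewrite /hom_tau (invmxM u3 (theta_unit F Yx)) (invmxM u1 u2) invmxK conjmxV !mulmxA.
exact: erefl.
Qed.

Lemma hom_cont_incl k m (F : mbundle R Y k) (S : mbundle R Y m) :
  hom_cont S (msum F S) setT id (fun=> incl R k m).
Proof.
apply/hom_contP => z Yz.
have e y : nb S z y -> nb (msum F S) z y -> coords S (msum F S) z y (incl R k m) = incl R k m.
  by move=> _ [h1 h2]; exact: (incl_frame (gauge_unit Yz h1) (gauge_unit Yz h2)).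
rewrite (e z (nb_self S Yz) (nb_self _ Yz)).
by apply: (@cvg_near_eq _ (nbhs z)); [exact: (near_nb2 Yz e)|exact: cvg_cst].
Qed.

Lemma pencil_sym m n (A B : 'M[C]_(m, n)) : pencil true A B -> pencil true B A.
Proof.
move=> AB t /andP[t0 t1]; have t01 : 0 <= 1 - t <= (true%:R : R).
  by move: t1 => /= t1; apply/andP; split; lra.
by have := AB (1 - t) t01; rewrite subKr addrC.
Qed.

Lemma ulsubmx_bdiag k m (A A' : 'M[C]_k) (B B' : 'M[C]_m) (M : 'M[C]_(k + m)) :
  ulsubmx (bdiag A B *m M *m bdiag A' B') = A *m ulsubmx M *m A'.
Proof.
rewrite -{1}(submxK M) /bdiag !mulmx_block !mul0mx !mulmx0 !addr0 !add0r.
exact: block_mxKul.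
Qed.

Lemma conj_ulsubmx k m (M : 'M[C]_(k + m)) : conjmx (ulsubmx M) = ulsubmx (conjmx M).
Proof. by rewrite /conjmx map_ulsubmx. Qed.

Lemma incl_mul k m (M : 'M[C]_(k + m)) : incl R k m *m M = dsubmx M.
Proof. by rewrite /incl -{1}(vsubmxK M) mul_row_col mul0mx mul1mx add0r. Qed.

Lemma matrix_cancellation k m (F1 F2 : mbundle R Y k) (S : mbundle R Y m)
    (Phi : X -> 'M[C]_(k + m)) :
  hom_cont (msum F1 S) (msum F2 S) setT id Phi ->
  (forall x, Y x -> Phi x \in unitmx) ->
  (forall x, Y x -> Phi (tau x) = hom_tau (msum F1 S) (msum F2 S) x (Phi x)) ->
  (m = 0%N \/ (d1 + 1 + (m.-1 + m.-1) < (k + m) + (k + m))%N) ->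
  (forall a, m = (a + a)%N ->
     m = 0%N \/ (d0 + 1 + ((a.-1 + a.-1) + (a.-1 + a.-1)) < (k + m) + (k + m))%N) ->
  exists f : X -> 'M[C]_k, hom_cont F1 F2 setT id f /\
    forall x, Y x -> f x \in unitmx /\ f (tau x) = hom_tau F1 F2 x (f x).
Proof.
move=> cPhi uPhi tPhi dim1 dim0; set E1 := msum F1 S; set E2 := msum F2 S.
have [u [cu uP]] := pencil_hom_exists hfree hfixed oY cY tauY cPhi uPhi tPhi dim1 dim0.
have [g1 [cg1 pg1]] := metric_exists hfree hfixed oY cY tauY E1.
have [g2 [cg2 pg2]] := metric_exists hfree hfixed oY cY tauY E2.
pose w x := u x *m invmx (Phi x).
have cw' : hom_cont S E1 setT id w.
  by apply: (hom_cont_mul cu); exact: hom_cont_inv.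
have tw x : Y x -> w (tau x) = hom_tau S E1 x (w x).
  move=> Yx; have [_ _ ut] := uP x Yx.
  rewrite /w (hom_tau_mul S E2 E1 _ _ Yx) (hom_tau_inv E1 E2 Yx (uPhi x Yx)) ut (tPhi x Yx).
  exact: erefl.
have [|T1 [cT1 T1P]] := hom_transport cg1 pg1 (hom_cont_incl (F := F1) (S := S)) cw'.
  move=> x Yx; have [_ p2 _] := uP x Yx; split; [exact: pencil_sym p2| |exact: tw].
  by rewrite /hom_tau conj_incl (incl_tau F1 S Yx).
have [|T2 [cT2 T2P]] := hom_transport cg2 pg2 cu (hom_cont_incl (F := F2) (S := S)).
  move=> x Yx; have [p1 _ ut] := uP x Yx; split; [exact: p1|exact: ut|].
  by rewrite /hom_tau conj_incl (incl_tau F2 S Yx).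
(* [T1] carries the inclusion to [w] and [T2] carries [u] to the inclusion, so the inclusion times
   [A] is [w *m Phi *m T2 = u *m T2], again the inclusion. *)
pose A x := T1 x *m Phi x *m T2 x.
have cA : hom_cont E1 E2 setT id A by apply: (hom_cont_mul _ cT2); exact: (hom_cont_mul cT1).
exists (fun x => ulsubmx (A x)); split.
  apply/hom_contP => z Yz; have cz := (hom_contP E1 E2 A).1 cA z Yz.
  have e y : nb E1 z y -> nb E2 z y ->
      coords F1 F2 z y (ulsubmx (A y)) = ulsubmx (coords E1 E2 z y (A y)).
    move=> [h1 h3] [h2 _].
    by rewrite /coords /= (bdiagV (gauge_unit Yz h2) (gauge_unit Yz h3)) ulsubmx_bdiag.
  rewrite (e z (nb_self E1 Yz) (nb_self E2 Yz)).
  apply: (@cvg_near_eq _ (nbhs z)); first exact: (near_nb2 Yz e).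
  by apply: (@cvg_lsubmx _ _ (nbhs z)); apply: (@cvg_usubmx _ _ (nbhs z)); exact: cz.
move=> x Yx; have [uT1 iT1 tT1] := T1P x Yx; have [uT2 iT2 tT2] := T2P x Yx.
split.
  have uA : A x \in unitmx by rewrite !unitmx_mul uT1 uT2 uPhi.
  have dA : dsubmx (A x) = incl R k m.
    by rewrite -incl_mul /A !mulmxA iT1 /w (mulmxKV (uPhi x Yx)) iT2.
  (* Block triangular with an identity block, so the determinant is that of the upper left block. *)
  have AE : A x = block_mx (ulsubmx (A x)) (ursubmx (A x)) 0 1%:M.
    by rewrite -{1}(submxK (A x)) /dlsubmx /drsubmx dA /incl row_mxKl row_mxKr.
  by move: uA; rewrite AE unitmxE det_ublock det1 mulr1 block_mxKul -unitmxE.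
have tA : A (tau x) = hom_tau E1 E2 x (A x).
  rewrite /A (hom_tau_mul E1 E2 E2 _ _ Yx) (hom_tau_mul E1 E1 E2 _ _ Yx) tT1 tT2 tPhi//.
rewrite tA /hom_tau /= (bdiagV (theta_unit F1 Yx) (theta_unit S Yx)) ulsubmx_bdiag.
by rewrite conj_ulsubmx.
Qed.
End matrix_cancellation.

Section bundle_isomorphisms.
Variables (R : realType) (X : involutive_space).
Local Notation C := R[i].

(** Plain functions over all of [X], arbitrary outside [Y], so that the solutions for several [Y]
    can be glued pointwise. *)
Definition iso_over (Y : set X) (E F : qbundle R X) (f : forall x, E x -> F x)
    (g : forall x, F x -> E x) : Prop :=
  [/\ forall x, Y x -> [/\ linear (f x), cancel (f x) (g x), cancel (g x) (f x) &
        forall v : E x, f (tau x) (qtheta v) = qtheta (f x v)],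
      forall e : tot E, Y (base e) -> {for e, continuous (tot_map (f := id) f : tot E -> tot F)} &
      forall e : tot F, Y (base e) -> {for e, continuous (tot_map (f := id) g : tot F -> tot E)}].

Lemma iso_of_hom (Y : set X) n (E F : qbundle R X) (M N : mbundle R Y n)
    (ME : model E M) (MF : model F N) (T : X -> 'M[C]_n) :
  (forall x, Y x -> Y (tau x)) -> hom_cont M N setT id T ->
  (forall x, Y x -> T x \in unitmx /\ T (tau x) = hom_tau M N x (T x)) ->
  exists f g, @iso_over Y E F f g.
Proof.
move=> tauY cT TP; have uT x Yx := (TP x Yx).1.
pose f x (v : E x) := fr MF x (cd ME v *m T x).
pose g x (w : F x) := fr ME x (cd MF w *m invmx (T x)).
exists f, g; split.
- move=> x Yx; split.
  + move=> a v w; rewrite /f (cd_linear ME Yx) mulmxDl -scalemxAl (fr_linear MF Yx).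
    exact: erefl.
  + by move=> v; rewrite /f /g (frK MF _ Yx) (mulmxK (uT x Yx)) (cdK ME _ Yx).
  + by move=> v; rewrite /f /g (frK ME _ Yx) (mulmxKV (uT x Yx)) (cdK MF _ Yx).
  move=> v; rewrite /f (fr_theta MF _ Yx) (cd_theta ME _ Yx (tauY x Yx)) (TP x Yx).2.
  by rewrite /hom_tau !mulmxA (mulmxK (theta_unit M Yx)) conjmxM.
- exact: (continuous_of_hom (f := f) (fun x v _ => erefl) cT).
exact: (continuous_of_hom (f := g) (fun x v _ => erefl) (hom_cont_inv cT uT)).
Qed.

Lemma frame_iso_bijective (V : lmodType C) m f g : @frame_iso R V m f g ->
  exists f : {linear 'rV[C]_m -> V}, bijective f.
Proof. by move=> [fl fK gK]; exists (to_linear fl), g. Qed.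
End bundle_isomorphisms.

(** * Cancellation for vector bundles *)

Section bundle_cancellation.
Variables (R : realType) (X : involutive_space) (cw : Z2_CW R X) (d1 d0 k : nat).
Hypothesis hfree : forall n : nat, free_cell cw n -> (n <= d1)%N.
Hypothesis hfixed : forall n : nat, fixed_cell cw n -> (n <= d0)%N.
Hypothesis d1k : (d1 <= k + k)%N.
Hypothesis d0k : (d0 <= (k + k).+2)%N.
Local Notation C := R[i].
Variables E1 E2 E3 : qbundle R X.
Hypothesis rank1 : has_rank E1 k.
Hypothesis rank2 : has_rank E2 k.

Lemma local_cancellation (Y : set X) m : open Y -> closed Y ->
  (forall x, Y x -> Y (tau x)) ->
  (forall x, Y x -> exists f : {linear 'rV[C]_m -> E3 x}, bijective f) ->
  qiso (qsum E1 E3) (qsum E2 E3) -> exists f g, @iso_over R X Y E1 E2 f g.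
Proof.
move=> oY cY tauY rank3 [phi [phi_homeo phi_theta]].
have [M1 [ME1]] := model_exists oY tauY (fun x _ => rank1 x).
have [M2 [ME2]] := model_exists oY tauY (fun x _ => rank2 x).
have [S [ME3]] := model_exists oY tauY rank3.
have [ES1 [fr1 cd1]] := model_sum ME1 ME3; have [ES2 [fr2 cd2]] := model_sum ME2 ME3.
pose Phi x := lin1_mx (fun v => cd ES2 (phi x (fr ES1 x v))).
have PhiE x v : Y x -> cd ES2 (phi x (fr ES1 x v)) = v *m Phi x.
  move=> Yx; have l : linear (fun v => cd ES2 (phi x (fr ES1 x v))).
    by move=> a v1 v2; rewrite (fr_linear ES1 Yx) linearP (cd_linear ES2 Yx).
  exact: linear_matrix l v.
have cPhi : hom_cont (msum M1 S) (msum M2 S) setT id Phi.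
  have [phic _] := phi_homeo.
  exact: (hom_of_continuous (f := fun x => phi x) PhiE (fun e _ => phic e)).
have phi_inj x : injective (phi x).
  move=> v w vw; have [_ [psi _ [phiK _]]] := phi_homeo.
  have := can_inj phiK; move=> /(_ (Tot x v) (Tot x w)); rewrite /tot_map /= vw => /(_ erefl).
  exact: Tot_inj.
have uPhi x : Y x -> Phi x \in unitmx.
  move=> Yx; rewrite -row_free_unit; apply: contraT => /not_row_free[v v0 vP].
  have := PhiE x v Yx; rewrite vP -[RHS](mul0mx _ (Phi x)) -(PhiE x 0 Yx).
  move=> /(congr1 (fr ES2 x)); rewrite !(cdK ES2 _ Yx) => /phi_inj /(congr1 (@cd _ _ _ _ _ _ ES1 x)).
  by rewrite !(frK ES1 _ Yx) => h; rewrite h eqxx in v0.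
have tPhi x : Y x -> Phi (tau x) = hom_tau (msum M1 S) (msum M2 S) x (Phi x).
  move=> Yx; have Ytx := tauY x Yx; have t1 := theta_unit (msum M1 S) Yx.
  suff e : theta (msum M1 S) x *m Phi (tau x) = conjmx (Phi x) *m theta (msum M2 S) x.
    by rewrite /hom_tau -mulmxA -e mulmxA (mulVmx t1) mul1mx.
  apply/row_matrixP => i; rewrite !rowE; set v := delta_mx 0 i.
  have := congr1 (@cd _ _ _ _ _ _ ES2 _) (phi_theta x (fr ES1 x v)).
  rewrite (fr_theta ES1 _ Yx) (PhiE _ _ Ytx) (cd_theta ES2 _ Yx Ytx) (PhiE _ _ Yx).
  have -> : conjmx v = v by rewrite /conjmx map_delta_mx.
  by rewrite conjmxM !mulmxA => ->; congr (_ *m _ *m _); rewrite /conjmx map_delta_mx.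
(* For [m > 0] the rank of [E3] cancels: the conditions are [d1 <= 2 k] here and [d0 <= 2 k + 2] in
   the quaternionic case. *)
have dim1 : m = 0%N \/ (d1 + 1 + (m.-1 + m.-1) < (k + m) + (k + m))%N.
  by have [->|m0] := eqVneq m 0%N; [left|right; lia].
have dim0 a : m = (a + a)%N ->
    m = 0%N \/ (d0 + 1 + ((a.-1 + a.-1) + (a.-1 + a.-1)) < (k + m) + (k + m))%N.
  by move=> ma; have [m0|m0] := eqVneq m 0%N; [left|right; lia].
have [T [cT TP]] := matrix_cancellation hfree hfixed oY cY tauY cPhi uPhi tPhi dim1 dim0.
exact: iso_of_hom ME1 ME2 _ tauY cT TP.
Qed.

Lemma bundle_cancellation : qiso (qsum E1 E3) (qsum E2 E3) -> qiso E1 E2.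
Proof.
move=> phi; have [rk [rkP rk_near rk_tau]] := rank_exists E3.
pose Y m : set X := [set x | rk x = m].
have loc m : exists fg : (forall x, E1 x -> E2 x) * (forall x, E2 x -> E1 x),
    iso_over (Y m) fg.1 fg.2.
  have oY : open (Y m).
    rewrite openE => x Yx; apply: (@filterS _ (nbhs x) _ _ _ _ (rk_near x)) => y.
    by rewrite /Y /= => ->.
  have cY : closed (Y m).
    rewrite -openC openE => x nYx; apply: (@filterS _ (nbhs x) _ _ _ _ (rk_near x)) => y.
    by rewrite /Y /= => ->.
  have tauY x : Y m x -> Y m (tau x) by rewrite /Y /= rk_tau.
  have r3 x : Y m x -> exists f : {linear 'rV[C]_m -> E3 x}, bijective f.
    by move=> <-; have [f [g fg]] := rkP x; exact: frame_iso_bijective fg.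
  by have [f [g fg]] := local_cancellation oY cY tauY r3 phi; exists (f, g).
pose F m := (projT1 (cid (loc m))).1; pose G m := (projT1 (cid (loc m))).2.
have FG m : iso_over (Y m) (F m) (G m) := projT2 (cid (loc m)).
clearbody F G.
(* Near each point this is a single [F m], since the rank is locally constant. *)
pose f x : E1 x -> E2 x := F (rk x) x; pose g x : E2 x -> E1 x := G (rk x) x.
have fl x : linear (f x) by have [/(_ x erefl)[]] := FG (rk x).
have fK x : cancel (f x) (g x) by have [/(_ x erefl)[]] := FG (rk x).
have gK x : cancel (g x) (f x) by have [/(_ x erefl)[]] := FG (rk x).
have fc : continuous (tot_map (f := id) f : tot E1 -> tot E2).
  move=> e; have [_ c _] := FG (rk (base e)); have {}c := c e erefl.
  have ne : \forall e' \near e, tot_map (f := id) f e' = tot_map (f := id) (F (rk (base e))) e'.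
    have n1 := @vb_proj_continuous _ _ E1 e _ (rk_near (base e)).
    apply: (@filterS _ (nbhs e) _ _ _ _ n1) => e' h; rewrite /tot_map /f.
    by rewrite [rk (base e')]h.
  exact: (cvg_near_eq _ ne c).
have gc : continuous (tot_map (f := id) g : tot E2 -> tot E1).
  move=> e; have [_ _ c] := FG (rk (base e)); have {}c := c e erefl.
  have ne : \forall e' \near e, tot_map (f := id) g e' = tot_map (f := id) (G (rk (base e))) e'.
    have n1 := @vb_proj_continuous _ _ E2 e _ (rk_near (base e)).
    apply: (@filterS _ (nbhs e) _ _ _ _ n1) => e' h; rewrite /tot_map /g.
    by rewrite [rk (base e')]h.
  exact: (cvg_near_eq _ ne c).
exists (fun x => to_linear (fl x)); split; last first.
  move=> x v; rewrite /= /f rk_tau; have [/(_ x erefl)[_ _ _]] := FG (rk x).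
  exact.
split; first exact: fc.
exists (tot_map (f := id) g); first exact: gc.
by split=> -[x v]; rewrite /tot_map /= ?fK ?gK.
Qed.
End bundle_cancellation.

(** * Splitting off trivial bundles *)

Section splitting.
Variable R : realType.
Local Notation C := R[i].

(** The matrix [1 - r u] is idempotent of rank [n], and in a full rank factorisation [A *m B] of an
    idempotent the product [B *m A] is the identity. *)
Lemma split_projection n m k (u : 'M[C]_(m, k)) (r : 'M[C]_(k, m)) : (n + m = k)%N ->
  u *m r = 1%:M -> exists (ka : 'M[C]_(n, k)) (rh : 'M[C]_(k, n)),
    ka *m rh = 1%:M /\ rh *m ka = 1%:M - r *m u.
Proof.
move=> nmk ur; pose P := 1%:M - r *m u.
have PP : P *m P = P.
  rewrite /P mulmxBr mulmx1 mulmxBl mul1mx -!mulmxA (mulmxA u r u) ur mul1mx subrr subr0.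
  exact: erefl.
have Pr : P *m r = 0 by rewrite /P mulmxBl mul1mx -mulmxA ur mulmx1 subrr.
have fu : row_free u by apply/row_freeP; exists r.
have ru : \rank (r *m u) = m.
  apply/eqP; rewrite eqn_leq; apply/andP; split.
    by apply: leq_trans (mxrankM_maxr _ _) _; exact: rank_leq_row.
  have e : u *m (r *m u) = u by rewrite mulmxA ur mul1mx.
  by move: fu; rewrite /row_free => /eqP h; rewrite -{1}h -{1}e; exact: mxrankM_maxr.
have rP : \rank P = n.
  apply/eqP; rewrite eqn_leq; apply/andP; split.
    have h : (P <= kermx r)%MS by apply/sub_kermxP.
    have := mxrankS h; rewrite mxrank_ker.
    have -> : \rank r = m.
      apply/eqP; rewrite eqn_leq rank_leq_col /=.
      by rewrite -{1}ru; exact: mxrankM_maxl.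
    by move/leq_trans; apply; lia.
  have := mxrank_add P (r *m u); rewrite /P subrK mxrank1 ru.
  by lia.
have fc := col_base_full P; have fr := row_base_free P; have e := mulmx_base P.
move: (col_base P) (row_base P) fc fr e; rewrite rP => A B fA /row_freeP[B' BB'] e.
have [A' AA'] : exists A', A' *m A = 1%:M by apply/row_fullP.
exists B, A; split; last exact: e.
have := PP; rewrite -e => h.
have {}h : A' *m (A *m B *m (A *m B)) *m B' = A' *m (A *m B) *m B' by rewrite h.
by move: h; rewrite !mulmxA AA' !mul1mx BB' -!mulmxA BB' mulmx1.
Qed.
End splitting.

(** * The orthogonal right inverse as an equivariant homomorphism *)

Section orthogonal_inverse.
Variables (R : realType) (X : involutive_space) (Y : set X).
Local Notation C := R[i].
Hypothesis tauY : forall x, Y x -> Y (tau x).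
Variables (m n : nat) (S : mbundle R Y m) (E : mbundle R Y n).
Variables (g : X -> 'M[C]_n) (u : X -> 'M[C]_(m, n)).
Hypothesis cg : hom_cont E (mdual E tauY) setT id g.
Hypothesis gP : forall x, Y x -> posdef (g x) /\ g (tau x) = hom_tau E (mdual E tauY) x (g x).
Hypothesis cu : hom_cont S E setT id u.
Hypothesis uP : forall x, Y x -> row_free (u x) /\ u (tau x) = hom_tau S E x (u x).

Lemma hom_cont_orth_inv : hom_cont E S setT id (fun x => orth_inv (g x) (u x)).
Proof.
apply/hom_contP => z Yz.
have gE y : coords E (mdual E tauY) z y (g y) = gauge E z y *m g y *m adj (gauge E z y).
  by rewrite /coords /= invmxK.
have e y : nb S z y -> nb E z y -> coords E S z y (orth_inv (g y) (u y)) =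
    orth_inv (coords E (mdual E tauY) z y (g y)) (coords S E z y (u y)).
  move=> h1 h2; have Yy := nb_sub Yz h1; have [pg _] := gP Yy; have [fu _] := uP Yy.
  rewrite gE /coords (orth_inv_frame (gauge_unit Yz h1) (gauge_unit Yz h2) (gram_unit pg fu)).
  exact: erefl.
have nS := nb_self S Yz; have nE := nb_self E Yz; rewrite (e z nS nE).
apply: (@cvg_near_eq _ (nbhs z)); first exact: (near_nb2 Yz e).
have cgz := (hom_contP _ _ _).1 cg z Yz; have cuz := (hom_contP _ _ _).1 cu z Yz.
have [pg _] := gP Yz; have [fu _] := uP Yz.
apply: (@cvg_orth_inv _ _ _ _ (nbhs z) _ _ _ _ _ cgz cuz); apply: gram_unit.
  by rewrite gE; apply: posdef_congr => //; exact: gauge_unit.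
by apply: row_free_transform => //; rewrite ?unitmx_inv; exact: gauge_unit.
Qed.

Lemma orth_inv_tau x : Y x ->
  orth_inv (g (tau x)) (u (tau x)) = hom_tau E S x (orth_inv (g x) (u x)).
Proof.
move=> Yx; have [pg gt] := gP Yx; have [fu ut] := uP Yx.
have uS : invmx (theta S x) \in unitmx by rewrite unitmx_inv theta_unit.
have uE : invmx (theta E x) \in unitmx by rewrite unitmx_inv theta_unit.
have := orth_inv_frame uS uE (gram_unit (posdef_conj pg) (row_free_conj fu)).
rewrite !invmxK -conj_orth_inv ut gt /hom_tau /= -adjV => ->.
exact: erefl.
Qed.
End orthogonal_inverse.

(** * The complement of the image as a quaternionic bundle *)

Section complement.
Variables (R : realType) (X : involutive_space).
Local Notation C := R[i].
Let tauT (x : X) (_ : [set: X] x) : [set: X] (tau x) := I.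
Variables (n m k : nat) (E F : qbundle R X).
Variables (M : mbundle R [set: X] k) (S : mbundle R [set: X] m).
Variables (ME : model E M) (MF : model F S).
Variables (u : X -> 'M[C]_(m, k)) (r : X -> 'M[C]_(k, m)).
Variables (ka : X -> 'M[C]_(n, k)) (rh : X -> 'M[C]_(k, n)).
Hypothesis cu : hom_cont S M setT id u.
Hypothesis cr : hom_cont M S setT id r.
Hypothesis tu : forall x, u (tau x) = hom_tau S M x (u x).
Hypothesis tr : forall x, r (tau x) = hom_tau M S x (r x).
Hypothesis ur : forall x, u x *m r x = 1%:M.
Hypothesis karh : forall x, ka x *m rh x = 1%:M.
Hypothesis rhka : forall x, rh x *m ka x = 1%:M - r x *m u x.

Let kar x : ka x *m r x = 0.
Proof.
rewrite -[ka x]mul1mx -(karh x) -!mulmxA (mulmxA _ _ (r x)) (rhka x) mulmxBl mul1mx.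
by rewrite -[r x *m u x *m r x]mulmxA (ur x) mulmx1 subrr mulmx0.
Qed.

Let urh x : u x *m rh x = 0.
Proof.
rewrite -[rh x]mulmx1 -(karh x) (mulmxA (rh x)) (rhka x) mulmxA mulmxBr mulmx1.
by rewrite mulmxA (ur x) mul1mx subrr mul0mx.
Qed.

(** [ka] and [rh] are chosen fibre by fibre without continuity; only the projection [rh x *m ka x]
    varies continuously. The complement therefore receives the topology induced from [E] by this
    inclusion. *)
Definition compl_incl (e : Defs.total (fun _ : X => 'rV[C]_n)) : tot E :=
  Tot (base e) (fr ME (base e) (vec e *m ka (base e))).

Definition compl_family : vfamily R X :=
  @VFamily R X (fun _ => 'rV[C]_n) (Topological.class (initial_topology compl_incl)).

Lemma compl_incl_continuous : continuous (compl_incl : tot compl_family -> tot E).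
Proof. exact: (@initial_continuous _ _ compl_incl). Qed.

Lemma compl_proj_continuous : continuous (@Defs.proj R X compl_family).
Proof.
move=> e; exact: (cvg_comp _ _ (@compl_incl_continuous e) (@vb_proj_continuous _ _ E _)).
Qed.

Definition ccd z (e : tot compl_family) : 'rV[C]_k :=
  vec e *m ka (base e) *m invmx (gauge M z (base e)).

Lemma ccdE z e : lcd ME z (compl_incl e) = ccd z e.
Proof. by rewrite /lcd /= (frK ME) . Qed.

Lemma compl_cvg (T : Type) (G : set_system T) (FG : Filter G) (h : T -> tot compl_family)
    (e : tot compl_family) z : nb M z (base e) -> base (h t) @[t --> G] --> base e ->
  ccd z (h t) @[t --> G] --> ccd z e -> h @ G --> e.
Proof.
move=> nz cb cc; apply: (@initial_cvg _ _ compl_incl _ G).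
apply: (@tot_cvg _ _ _ _ _ _ ME _ G FG (fun t => compl_incl (h t)) (compl_incl e) z I nz cb).
rewrite ccdE; have -> : (fun t => lcd ME z (compl_incl (h t))) = (fun t => ccd z (h t)).
  by apply/funext => t; exact: ccdE.
exact: cc.
Qed.

Lemma ccd_cvg z (e : tot compl_family) : nb M z (base e) -> ccd z @ e --> ccd z e.
Proof.
move=> nz; have c := cvg_comp _ _ (@compl_incl_continuous e) (@lcd_cvg _ _ _ _ _ _ ME z (compl_incl e) I nz).
rewrite -ccdE; have -> : ccd z = lcd ME z \o compl_incl by apply/funext => e'; rewrite /= ccdE.
exact: c.
Qed.

Let P x := 1%:M - r x *m u x.

Lemma hom_cont_compl : hom_cont M M setT id P.
Proof.
have /hom_contP cru := hom_cont_mul cr cu; apply/hom_contP => z _.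
have e y : nb M z y -> nb M z y -> coords M M z y (P y) =
    1%:M - coords M M z y (r y *m u y).
  move=> h _; rewrite /P /coords mulmxBr mulmx1 mulmxBl (mulmxV (gauge_unit I h)).
  exact: erefl.
have nz := nb_self M (I : [set: X] z); rewrite (e z nz nz).
apply: (@cvg_near_eq _ (nbhs z)); first exact: (near_nb2 I e).
apply: (@cvg_addmx _ _ (nbhs z)); first exact: cvg_cst.
by apply: (@cvg_oppmx _ _ (nbhs z)); exact: cru.
Qed.

(** The complement at [z] is moved to the fibre of [E] at [y] by a trivialisation of [E] and then
    projected to the complement at [y]; this is [A y]. It is the identity at [y = z], and it is
    invertible wherever [D y] is. *)
Lemma compl_locally_trivial : locally_trivial compl_family.
Proof.
move=> z; have nz := nb_self M (I : [set: X] z).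
pose G0 := invmx (gauge M z z); pose A y := ka z *m G0 *m gauge M z y *m rh y.
pose B y := ka z *m G0 *m coords M M z y (P y); pose Cz := gauge M z z *m rh z.
have AB y : A y *m ka y *m invmx (gauge M z y) = B y.
  by rewrite /A /B /coords -[P y](rhka y) !mulmxA.
have Bc y : nb M z y -> B @ y --> B y.
  move=> ny; apply: (@cvg_mulmx _ _ (nbhs y)); first exact: cvg_cst.
  move=> W nW; have h := hom_cont_compl I I ny ny nW.
  by apply: (@filterS _ (nbhs y) _ _ _ _ h) => y'; apply.
have BC : B z *m Cz = 1%:M.
  rewrite -AB /A /Cz /G0 !mulmxA (mulmxKV (gauge_unit I nz)) (mulmxKV (gauge_unit I nz)).
  by rewrite karh mul1mx karh.
pose D y := B y *m Cz.
have Dc y : nb M z y -> D @ y --> D y.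
  by move=> ny; apply: (@cvg_mulmx _ _ (nbhs y)); [exact: Bc|exact: cvg_cst].
pose V : set X := [set y | nb M z y /\ D y \in unitmx]; pose U := interior V.
have oU : open U by exact: open_interior.
have UV : U `<=` V by exact: interior_subset.
have Uz : U z.
  have n1 : nbhs z (nb M z) by apply: open_nbhs_nbhs; split=> //; exact: nb_open.
  have n2 : nbhs z [set y | D y \in unitmx].
    by apply: (@cvg_unitmx _ _ (nbhs z) _ _ _ _ (Dc z nz)); rewrite /D BC unitmx1.
  exact: (@filterS2 _ (nbhs z) _ _ _ _ (fun _ => @conj _ _) n1 n2).
pose N y := ka y *m invmx (gauge M z y) *m Cz *m invmx (D y).
have AN y : U y -> A y *m N y = 1%:M.
  move=> /UV[_ uD]; have -> : A y *m N y =
      A y *m ka y *m invmx (gauge M z y) *m Cz *m invmx (D y) by rewrite /N !mulmxA.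
  by rewrite AB; exact: mulmxV.
have NA y : U y -> N y *m A y = 1%:M by move=> /AN; exact: mulmx1C.
exists U, n, (fun y w => w *m A y), (fun e => ccd z e *m Cz *m invmx (D (base e))).
have ccdN y (w : 'rV[C]_n) : ccd z (Tot y w) *m Cz *m invmx (D y) = w *m N y.
  by rewrite /ccd /N !mulmxA.
split.
- by [].
- by move=> y Uy a v w; rewrite mulmxDl -scalemxAl.
- move=> y Uy; split=> w; rewrite ccdN.
    by rewrite -mulmxA (AN y Uy) mulmx1.
  by rewrite -mulmxA (NA y Uy) mulmx1.
- rewrite continuous_open_subspace; last exact: open_cylinder.
  move=> -[y w] /set_mem[/= Uy _]; have [ny _] := UV y Uy.
  have c1 : fst @ (y, w) --> y by exact: cvg_fst.
  have c2 : snd @ (y, w) --> w by exact: cvg_snd.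
  apply: (@compl_cvg _ (nbhs (y, w)) _ (fun p => Tot p.1 (p.2 *m A p.1)) (Tot y (w *m A y)) z ny c1).
  have ccdB y' (w' : 'rV[C]_n) : ccd z (Tot y' (w' *m A y')) = w' *m B y'.
    by rewrite /ccd /= -AB !mulmxA.
  rewrite ccdB; under eq_fun do rewrite ccdB.
  apply: (@cvg_mulmx _ _ (nbhs (y, w))); first exact: c2.
  exact: (cvg_comp _ _ c1 (Bc y ny)).
have oP : open (@Defs.proj _ _ compl_family @^-1` U).
  by apply: open_comp => // ? _; exact: compl_proj_continuous.
rewrite (continuous_open_subspace _ oP) => e /set_mem Ue; have [ne uD] := UV _ Ue.
apply: (@cvg_mulmx _ _ (nbhs e)).
  by apply: (@cvg_mulmx _ _ (nbhs e)); [exact: ccd_cvg|exact: cvg_cst].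
apply: (@cvg_invmx _ _ (nbhs e)); last exact: uD.
exact: (cvg_comp _ _ (@compl_proj_continuous e) (Dc _ ne)).
Qed.

Definition compl_vbundle : vbundle R X :=
  VBundle compl_proj_continuous compl_locally_trivial.

(** Theta of [E] in the coordinates of the complement. The projection loses nothing, because [r] is
    equivariant and so Theta preserves its kernel. *)
Definition compl_theta (x : X) (w : compl_vbundle x) : compl_vbundle (tau x) :=
  conjmx ((w : 'rV[C]_n) *m ka x) *m theta M x *m rh (tau x).

Let theta_ka x (w : 'rV[C]_n) :
  (compl_theta (x := x) w : 'rV[C]_n) *m ka (tau x) = conjmx (w *m ka x) *m theta M x.
Proof.
have h : conjmx (w *m ka x) *m theta M x *m r (tau x) = 0.
  rewrite (tr x) /hom_tau !mulmxA (mulmxK (theta_unit M (I : [set: X] x))) -conjmxM.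
  by rewrite -[w *m ka x *m r x]mulmxA (kar x) mulmx0 /conjmx map_mx0 mul0mx.
by rewrite /compl_theta -mulmxA (rhka (tau x)) mulmxBr mulmx1 mulmxA h mul0mx subr0.
Qed.

Lemma compl_incl_theta (e : tot compl_vbundle) :
  compl_incl (tot_map compl_theta e) = tot_map (@qtheta R X E) (compl_incl e).
Proof.
case: e => x w; rewrite /compl_incl /tot_map /= (theta_ka x w).
by rewrite (fr_theta ME _ (I : [set: X] x)).
Qed.

Lemma compl_incl_inj : injective compl_incl.
Proof.
move=> [x w] [x' w']; rewrite /compl_incl /= => e.
have xx : x = x' := congr1 (@base _ _) e; subst x'.
have := congr1 (fun v => v *m rh x) (congr1 (@cd _ _ _ _ _ _ ME x) (Tot_inj e)).
by rewrite !(frK ME _ (I : [set: X] x)) -!mulmxA (karh x) !mulmx1 => ->.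
Qed.

Lemma compl_thetaK (x : X) (w : compl_vbundle x) :
  tot_map compl_theta (tot_map compl_theta (Tot x w : tot compl_vbundle)) = Tot x (- w).
Proof.
apply: compl_incl_inj; rewrite !compl_incl_theta {1}/compl_incl /= qthetaK.
rewrite /compl_incl /= mulNmx; congr Tot.
exact: (esym (linearN (to_linear (fr_linear ME (I : [set: X] x))) _)).
Qed.

Lemma compl_theta_homeo : homeomorphism (tot_map compl_theta).
Proof.
apply: tot_map_homeomorphism; last exact: compl_thetaK.
move=> e; apply: (@initial_cvg _ _ compl_incl _ (nbhs e)).
rewrite compl_incl_theta; under eq_fun do rewrite compl_incl_theta.
have [qc _] := qtheta_homeo E.
exact: (cvg_comp _ _ (@compl_incl_continuous e) (qc (compl_incl e))).
Qed.

Lemma compl_thetaD (x : X) (v w : compl_vbundle x) :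
  compl_theta (v + w) = compl_theta v + compl_theta w.
Proof. by rewrite /compl_theta mulmxDl conjmxD !mulmxDl. Qed.

Lemma compl_thetaZ (x : X) (a : C) (v : compl_vbundle x) :
  compl_theta (a *: v) = Num.conj a *: compl_theta v.
Proof. by rewrite /compl_theta -scalemxAl conjmxZ -!scalemxAl. Qed.

Definition compl_qbundle : qbundle R X :=
  QBundle compl_theta_homeo compl_thetaD compl_thetaZ compl_thetaK.

(** The matrices with blocks [rh x], [r x] side by side and [ka x], [u x] stacked are inverse to
    each other. *)
Lemma compl_splitting : qiso E (qsum compl_qbundle F).
Proof.
have T x : [set: X] x by [].
pose f1 x (v : E x) : compl_qbundle x := cd ME v *m rh x.
pose f2 x (v : E x) : F x := fr MF x (cd ME v *m r x).
pose f x (v : E x) : qsum compl_qbundle F x := (f1 x v, f2 x v).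
pose g1 x (w : F x) : E x := fr ME x (cd MF w *m u x).
pose g x (w : qsum compl_qbundle F x) : E x := fr ME x ((w.1 : 'rV[C]_n) *m ka x) + g1 x w.2.
have frD x v w : fr ME x (v + w) = fr ME x v + fr ME x w.
  exact: (linearD (to_linear (fr_linear ME (T x)))).
have cdD x (v w : E x) : cd ME (v + w) = cd ME v + cd ME w.
  exact: (linearD (to_linear (cd_linear ME (T x)))).
have fl x : linear (f x).
  move=> a v w; rewrite /f /f1 /f2 (cd_linear ME (T x)) !mulmxDl -!scalemxAl (fr_linear MF (T x)).
  exact: erefl.
have fK x : cancel (f x) (g x).
  move=> v; rewrite /g /f /g1 /f1 /f2 /= (frK MF _ (T x)) -frD -!mulmxA (rhka x) -mulmxDr subrK.
  by rewrite mulmx1 (cdK ME _ (T x)).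
have gK x : cancel (g x) (f x).
  move=> [w s]; rewrite /f /f1 /f2 /g /g1 /= cdD !(frK ME _ (T x)) !mulmxDl -!mulmxA.
  by rewrite karh kar ur urh !mulmx1 !mulmx0 addr0 add0r (cdK MF _ (T x)).
have fc : continuous (tot_map (f := id) f : tot E -> tot (qsum compl_qbundle F)).
  move=> e; apply: (@initial_cvg _ _ (@sum_split R X compl_qbundle F) _ (nbhs e)).
  (* Continuity into the complement is tested in [E], where [f1] becomes the projection [P]. *)
  have c1 : tot_map (f := id) f1 @ e --> (tot_map (f := id) f1 e : tot compl_family).
    apply: (@initial_cvg _ _ compl_incl _ (nbhs e)).
    pose q x (v : E x) : E x := fr ME x (cd ME v *m P x).
    have qE (e' : tot E) : compl_incl (tot_map (f := id) f1 e') = tot_map (f := id) q e'.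
      by rewrite /compl_incl /tot_map /= /f1 -mulmxA rhka.
    rewrite qE; under eq_fun do rewrite qE.
    exact: (continuous_of_hom (f := q) (fun x v _ => erefl) hom_cont_compl (T _)).
  have c2 := continuous_of_hom (f := f2) (fun x v _ => erefl) cr (T (base e)).
  exact: (cvg_pair c1 c2).
have gc : continuous (tot_map (f := id) g : tot (qsum compl_qbundle F) -> tot E).
  move=> e; have cs := @sum_split_continuous R X compl_qbundle F e.
  pose s (e' : tot (qsum compl_qbundle F)) := @sum_split R X compl_qbundle F e'.
  have cs1 : (s e').1 @[e' --> e] --> (s e).1 by exact: (cvg_comp _ _ cs cvg_fst).
  have cs2 : (s e').2 @[e' --> e] --> (s e).2 by exact: (cvg_comp _ _ cs cvg_snd).
  have ci1 := cvg_comp _ _ cs1 (@compl_incl_continuous (s e).1).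
  have c2 := continuous_of_hom (f := g1) (fun x v _ => erefl) cu (e := (s e).2) (T _).
  have ci2 := cvg_comp _ _ cs2 c2.
  exact: (@cvg_totD _ _ _ _ _ _ ME _ (nbhs e) _ (fun e' => base e')
    (fun e' => fr ME (base e') (((vec e').1 : 'rV[C]_n) *m ka (base e')))
    (fun e' => g1 (base e') (vec e').2) (base e)
    (fr ME (base e) (((vec e).1 : 'rV[C]_n) *m ka (base e))) (g1 (base e) (vec e).2)
    (T (base e)) ci1 ci2).
have fth x (v : E x) : f (tau x) (qtheta v) = qtheta (f x v).
  have h : conjmx (u x) *m theta M x = theta S x *m u (tau x).
    by rewrite tu /hom_tau !mulmxA (mulmxV (theta_unit S (T x))) mul1mx.
  have e1 : conjmx (cd ME v *m rh x *m ka x) *m theta M x *m rh (tau x) =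
      conjmx (cd ME v) *m theta M x *m rh (tau x).
    rewrite -[cd ME v *m rh x *m ka x]mulmxA rhka mulmxBr mulmx1 conjmxD conjmxN.
    rewrite mulmxBl mulmxBl; suff -> : conjmx (cd ME v *m (r x *m u x)) *m theta M x *m rh (tau x) = 0.
      by rewrite subr0.
    by rewrite mulmxA conjmxM -!mulmxA (mulmxA _ (theta M x)) h -!mulmxA urh !mulmx0.
  rewrite /f /f1 /f2 (cd_theta ME _ (T x) (T (tau x))) /=; congr pair; first exact: (esym e1).
  rewrite (fr_theta MF _ (T x)); congr (fr MF _ _).
  by rewrite tr /hom_tau conjmxM !mulmxA (mulmxK (theta_unit M (T x))).
exists (fun x => to_linear (fl x)); split; last exact: fth.
split; first exact: fc.
exists (tot_map (f := id) g); first exact: gc.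
by split=> -[x v]; rewrite /tot_map /= ?fK ?gK.
Qed.
End complement.

Lemma trivial_rank (R : realType) (X : involutive_space) q :
  has_rank (qtrivial R X q) (2 * q).
Proof.
move=> x; have l : linear (fun v : 'rV[R[i]]_(2 * q) => v : qtrivial R X q x) by [].
by exists (to_linear l); exists (fun v : 'rV[R[i]]_(2 * q) => v).
Qed.

Lemma trivial_splitting (R : realType) (X : involutive_space) (cw : Z2_CW R X) (d1 d0 k q : nat)
    (E : qbundle R X) :
  (forall n : nat, free_cell cw n -> (n <= d1)%N) ->
  (forall n : nat, fixed_cell cw n -> (n <= d0)%N) ->
  (2 * q <= k)%N -> (d1 + 4 * q <= k + k + 1)%N -> (d0 + 4 * q <= k + k + 3)%N ->
  has_rank E k -> exists E0 : qbundle R X, qiso E (qsum E0 (qtrivial R X q)).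
Proof.
move=> hfree hfixed qk d1k d0k rankE.
have oT : open [set: X] by exact: openT.
have cT : closed [set: X] by exact: closedT.
have tauT (x : X) : [set: X] x -> [set: X] (tau x) by [].
have [M [ME]] := model_exists oT tauT (fun x _ => rankE x).
have [S [MS]] := model_exists oT tauT (fun x _ => @trivial_rank R X q x).
(* For [q > 0] the two conditions read [d1 + 2 (2 q - 1) < 2 k] and, since [a = q],
   [d0 + 4 (q - 1) < 2 k]. *)
have dim1 : (2 * q = 0 \/ d1 + ((2 * q).-1 + (2 * q).-1) < k + k)%N.
  by have [q0|q0] := eqVneq (2 * q)%N 0%N; [left|right; lia].
have dim0 a : (2 * q = a + a)%N ->
    (2 * q = 0 \/ d0 + ((a.-1 + a.-1) + (a.-1 + a.-1)) < k + k)%N.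
  by move=> qa; have [q0|q0] := eqVneq (2 * q)%N 0%N; [left|right; lia].
have [u [cu uP]] := row_free_hom_exists hfree hfixed oT cT tauT S M dim1 dim0.
have [g [cg gP]] := metric_exists hfree hfixed oT cT tauT M.
pose r x := orth_inv (g x) (u x).
have cr : hom_cont M S setT id r := hom_cont_orth_inv cg gP cu uP.
have ur x : u x *m r x = 1%:M by apply: orth_invP; [exact: (gP x I).1|exact: (uP x I).1].
have kq : (k - 2 * q + 2 * q = k)%N by rewrite subnK.
have split x : exists kr : 'M[R[i]]_(k - 2 * q, k) * 'M[R[i]]_(k, k - 2 * q),
    kr.1 *m kr.2 = 1%:M /\ kr.2 *m kr.1 = 1%:M - r x *m u x.
  by have [ka [rh h]] := split_projection kq (ur x); exists (ka, rh).
pose ka x := (projT1 (cid (split x))).1; pose rh x := (projT1 (cid (split x))).2.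
have karh x : ka x *m rh x = 1%:M := (projT2 (cid (split x))).1.
have rhka x : rh x *m ka x = 1%:M - r x *m u x := (projT2 (cid (split x))).2.
have tu x : u (tau x) = hom_tau S M x (u x) := (uP x I).2.
have tr x : r (tau x) = hom_tau M S x (r x) := orth_inv_tau gP uP I.
exists (compl_qbundle ME cu cr tr ur karh rhka).
exact: compl_splitting.
Qed.

(** * Arithmetic of the two bounds, and the conclusion *)

Lemma ceil_half_le (a b : nat) (n : int) :
  Num.ceil ((a%:R - b%:R) / 2 : rat) <= n -> a%:Z - b%:Z <= 2 * n.
Proof.
rewrite ceil_le_int => h; rewrite -(ler_int rat) rmorphB rmorphM /=.
by rewrite -!pmulrn; lra.
Qed.

(** The second term is at least the ceiling of [-1 / 2], which is 0. Hence the trivial summand has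
    rank at most [k]. *)
Lemma k0_ge0 d0 d1 : 0 <= k0 d0 d1.
Proof.
rewrite /k0 le_max; apply/orP; right; rewrite ceil_ge0.
by have : (0 : rat) <= d1%:R by []; lra.
Qed.

Lemma trivial_summand_le d0 d1 k : k0 d0 d1 <= k%:Z ->
  k0 d0 d1 <= k%:Z - 2 * (trivial_summand d0 d1 k)%:Z.
Proof.
move=> h; rewrite /trivial_summand; set x := (X in Num.floor X).
have x0 : 0 <= x by rewrite /x divr_ge0// ler0z subr_ge0.
have f0 : 0 <= Num.floor x by rewrite floor_ge0.
rewrite gez0_abs// lerBrDr -lerBrDl -(ler_int rat) rmorphM /=.
have := floor_le x; rewrite /x => h1; lra.
Qed.

Local Close Scope classical_set_scope.

Theorem theorem1p2 (R : realType) (d1 d0 k : nat) (X : involutive_space)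
    (cw : Z2_CW R X)
    (hfree : forall n : nat, free_cell cw n -> (n <= d1)%N)
    (hfixed : forall n : nat, fixed_cell cw n -> (n <= d0)%N) :
  (forall E : qbundle R X, has_rank E k -> k0 d0 d1 <= k%:Z ->
     exists E0 : qbundle R X,
       qiso E (qsum E0 (qtrivial R X (trivial_summand d0 d1 k))))
  /\
  (forall E1 E2 : qbundle R X, has_rank E1 k -> has_rank E2 k ->
     k1 d0 d1 <= k%:Z ->
     (exists E3 : qbundle R X, qiso (qsum E1 E3) (qsum E2 E3)) ->
     qiso E1 E2).
Proof.
split=> [E rankE h|E1 E2 rank1 rank2 h [E3 phi]].
  have h0 := k0_ge0 d0 d1; have hq := trivial_summand_le h.
  set q := trivial_summand d0 d1 k in hq *; set c := k0 d0 d1 in h0 hq.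
  (* The two ceilings give [d0 - 3 <= 2 (k - 2 q)] and [d1 - 1 <= 2 (k - 2 q)], the dimension
     hypotheses of [trivial_splitting]. *)
  have : c <= k%:Z - 2 * q%:Z by [].
  rewrite {1}/c /k0 ge_max => /andP[/(@ceil_half_le d0 3) b0 /(@ceil_half_le d1 1) b1].
  by apply: (trivial_splitting hfree hfixed _ _ _ rankE); lia.
have := h; rewrite /k1 ge_max => /andP[/(@ceil_half_le d0 2) b0].
rewrite -[d1%:R]subr0 => /(@ceil_half_le d1 0) b1.
by apply: (bundle_cancellation hfree hfixed _ _ rank1 rank2 phi); lia.
Qed.
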